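(* Consider the model $y_i=F(x_i)+z_i$, $1\le i\le n$, with $F=\sum_{k=1}^q f_k u_k$, described in the context. Suppose that $f_k\in L^2[0,1]^d$ for all $k$ and $\max_{1\le k\le q}\|f_k\|_\infty\le B$. Let $\tilde F=(F(x_1)\ \ldots\ F(x_n))\in\mathbb{R}^{p\times n}$ and $Z=(z_1\ \ldots\ z_n)\in\mathbb{R}^{p\times n}$. Then the matrix $\hat U\in\mathbb{R}^{p\times q}$ of top $q$ left singular vectors of $Y=\tilde F+Z$ satisfies $$E\left\{\|\sin\Theta(\hat U,U)\|^4\right\}\le C(p/n)^2,\qquad U=(u_1\ \ldots\ u_q).$$ Consequently, if in addition the General Estimation Procedure (with this $\hat U$ in Step 1) is direction invariant and results in a linear smoother $L$ with $\|L\|\le C$ that attains the rate $r$, and if $p=O(n)$ and $p=O(n^{1-r})$, then the resulting estimate $\hat F=\sum_{k=1}^q\hat u_k\hat f_k$ of $F$ satisfies $E\{R_n(\hat F)\}\lesssim q\,n^{-r}$.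
   Context: **Model.** $x_1,\dots,x_n$ are i.i.d. uniform on $[0,1]^d$; $z_1,\dots,z_n$ are i.i.d. $\mathcal N(0,\sigma^2 I_p)$, independent of the $x_i$; $y_i=F(x_i)+z_i\in\mathbb{R}^p$, where $F(x)=\sum_{k=1}^q f_k(x)u_k$, $q\le p$, $u_1,\dots,u_q\in\mathbb{R}^p$ are orthonormal, and $f_1,\dots,f_q$ are nonzero and mutually orthogonal in $L^2[0,1]^d$. **Asymptotic convention.** $n\to\infty$, $p=p_n$ may vary with $n$, and $q$, $f_1,\dots,f_q$, $\sigma^2$ are fixed. $C$ and $B$ denote constants not depending on $n,p$ ($C$ may differ between occurrences), and $a\lesssim b$ means $a\le C b$ for such a constant $C$. **Norms and angles.** For a matrix, $\|\cdot\|$ is the spectral norm; for vectors in $\mathbb{R}^m$ it is the Euclidean norm. For a function $g$, $\|g\|_n^2=\frac1n\sum_{i=1}^n g(x_i)^2$ (for a vector of fitted values, $\|\cdot\|_n^2=\frac1n\|\cdot\|^2$), and $\|g\|_\infty$ is the sup norm. For $p\times q$ matrices $U,V$ with orthonormal columns, if $\sigma_1\ge\dots\ge\sigma_q\ge0$ are the singular values of $U^{T}V$, then $\Theta(U,V)=\mathrm{diag}(\cos^{-1}\sigma_1,\dots,\cos^{-1}\sigma_q)$ and $\|\sin\Theta(U,V)\|$ is the spectral norm of the matrix obtained by applying $\sin$ to the diagonal entries. **Risk.** $R_n(G)=\frac1n\sum_{i=1}^n\|F(x_i)-G(x_i)\|^2$. **General Estimation Procedure.** Step 1: find an estimate $\hat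 U=(\hat u_1\ \ldots\ \hat u_q)$ of $U$ with orthonormal columns. Step 2: for each $k=1,\dots,q$ let $\hat f_k$ be the minimizer over $g_k$ of $\frac1n\sum_{i=1}^n\{\hat u_k^{T}y_i-g_k(x_i)\}^2$, or of a penalized version $\frac1n\sum_{i=1}^n\{\hat u_k^{T}y_i-g_k(x_i)\}^2+\mathcal P_k(g_k)$ with $\mathcal P_k$ a seminorm penalizing non-smoothness. The estimate is $\hat F=\sum_{k=1}^q\hat u_k\hat f_k$. **Direction invariance.** The procedure is direction invariant if, for any vectors $v_1,\dots,v_q$, the minimization of $\frac1n\sum_{i=1}^n\{v_k^{T}y_i-g_k(x_i)\}^2+\mathcal P_k(g_k)$ amounts to an identical smoothing procedure applied to the data $(v_k^{T}y_i)_{i=1}^n$ for each $k=1,\dots,q$. It results in a linear smoother $L$ if there is an $n\times n$ matrix $L$ (depending only on the design $x_1,\dots,x_n$) such that the vector of fitted values at $x_1,\dots,x_n$ in direction $v_k$ is $L\,(v_k^{T}y_1,\dots,v_k^{T}y_n)^{T}$. In particular $(\hat f_k(x_1),\dots,\hat f_k(x_n))^{T}=L(\hat u_k^{T}y_1,\dots,\hat u_k^{T}y_n)^{T}$. **Rate.** Let $Y^o_{\cdot k}=(u_k^{T}y_1,\dots,u_k^{T}y_n)^{T}$ be the oracle rotated data and $\hat f_k^o=LY^o_{\cdot k}$ the resulting fitted values. $L$ attains the rate $r$ if $\max_{1\le k\le q}E\|\hat f_k^o-f_k\|_n^2\le Cn^{-r}$. *)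

(* Defs.v *)
From HB Require Import structures.
From mathcomp Require Import all_boot all_order all_algebra.
From mathcomp Require Import all_classical all_reals all_analysis.

Set Implicit Arguments.
Unset Strict Implicit.
Unset Printing Implicit Defensive.

Import Order.TTheory GRing.Theory Num.Theory.
Import numFieldNormedType.Exports.

Local Open Scope classical_set_scope.
Local Open Scope ring_scope.

Section linear_algebra.
Variable R : realType.

Definition enorm m (v : 'cV[R]_m) : R := Num.sqrt (\sum_(i < m) v i 0 ^+ 2).

(* The norm `|A| that MathComp-Analysis puts on matrices is the entrywise
   maximum, not the spectral norm. *)
Definition spectral_norm m n (A : 'M[R]_(m, n)) : R :=
  sup [set enorm (A *m v) | v in [set v : 'cV[R]_n | enorm v <= 1]].

Definition orthonormal_cols m n (A : 'M[R]_(m, n)) : Prop :=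
  A^T *m A = 1%:M.

(* Full singular value decomposition A = W diag(s) V^T; the singular values are
   indexed from 0 and padded with zeros from index minn m n on. *)
Definition is_svd m n (A : 'M[R]_(m, n))
    (W : 'M[R]_m) (s : nat -> R) (V : 'M[R]_n) : Prop :=
  [/\ orthonormal_cols W,
      orthonormal_cols V,
      (forall i, 0 <= s i) /\ (forall i j, (i <= j)%N -> s j <= s i),
      forall i, (minn m n <= i)%N -> s i = 0 &
      A = W *m (\matrix_(i < m, j < n) (s i *+ (i == j :> nat))) *m V^T].

(* Every real matrix has an SVD and all its SVDs share the same s, so the
   default value of xget is never used. *)
Definition singular_values m n (A : 'M[R]_(m, n)) : nat -> R :=
  xget (fun=> 0) [set s | exists W V, is_svd A W s V].

(* The vectors are determined up to the choice of the SVD; q <= m is intended. *)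
Definition top_left_singular_vectors m n q
    (A : 'M[R]_(m, n)) (Uh : 'M[R]_(m, q)) : Prop :=
  exists W s V, is_svd A W s V /\
    forall (k : 'I_q) (j : 'I_m), k = j :> nat -> col k Uh = col j W.

Definition principal_angles p q (U V : 'M[R]_(p, q)) : 'rV[R]_q :=
  \row_k acos (singular_values (U^T *m V) k).

Definition sin_Theta_norm p q (U V : 'M[R]_(p, q)) : R :=
  spectral_norm (diag_mx (map_mx (@sin R) (principal_angles U V))).

End linear_algebra.

Section iid_law.
Context d (T : measurableType d) (R : realType).

Definition consT n (ut : T * n.-tuple T) : n.+1.-tuple T :=
  [tuple of ut.1 :: ut.2].

Lemma measurable_consT n : measurable_fun setT (@consT n).
Proof. exact: measurable_cons. Qed.

HB.instance Definition _ n :=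
  isMeasurableFun.Build _ _ _ _ (@consT n) (@measurable_consT n).

(* Law of m independent copies of mu. *)
Fixpoint iid_law (mu : probability T R) (m : nat) :
    probability (m.-tuple T) R :=
  match m with
  | 0 => \d_([tuple] : 0.-tuple T)
  | m'.+1 => distribution (mu \x iid_law mu m')%E (@consT m')
  end.

End iid_law.

Section model.
Variable R : realType.

Definition unit_cube d : set (d.-tuple R) :=
  [set t | forall j, 0 <= tnth t j <= 1].

(* The library states its distributions on measurableTypeR R and its random
   variables on R; the two carry the same Borel sets but differ in their display.
   real_law transports a law along the identity. *)
Definition idR : measurableTypeR R -> R := idfun.

Lemma measurable_idR : measurable_fun setT idR.
Proof. by move=> _ A mA; rewrite setTI. Qed.

HB.instance Definition _ :=
  isMeasurableFun.Build _ _ _ _ idR measurable_idR.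

Definition real_law (mu : probability (measurableTypeR R) R) :
    probability R R :=
  distribution mu idR.

(* Uniform law on [0,1]^d, i.e. Lebesgue measure restricted to the cube, so that
   Lfun (uniform_cube d) 2%:E is L^2[0,1]^d. *)
Definition uniform_cube d : probability (d.-tuple R) R :=
  iid_law (real_law (uniform_prob (@ltr01 R))) d.

(* N(0, sigma^2 I_p); the second parameter of normal_prob is the standard
   deviation. *)
Definition isotropic_normal (sigma : R) p : probability (p.-tuple R) R :=
  iid_law (real_law (normal_prob 0 sigma)) p.

Section independence.
Context dO (Om : measurableType dO) (P : probability Om R).

Definition mutually_independent d (T : measurableType d) n
    (X : 'I_n -> {RV P >-> T}) : Prop :=
  forall A : 'I_n -> set T, (forall i, measurable (A i)) ->
    P (\bigcap_(i in [set: 'I_n]) (X i @^-1` A i)) =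
    (\prod_(i < n) P (X i @^-1` A i))%E.

Definition iid_with_law d (T : measurableType d) n
    (X : 'I_n -> {RV P >-> T}) (mu : probability T R) : Prop :=
  mutually_independent X /\
  forall i A, measurable A -> distribution P (X i) A = mu A.

Definition independent d1 (T1 : measurableType d1) d2 (T2 : measurableType d2)
    (X : Om -> T1) (Z : Om -> T2) : Prop :=
  forall A B, measurable A -> measurable B ->
    P (X @^-1` A `&` Z @^-1` B) = (P (X @^-1` A) * P (Z @^-1` B))%E.

Definition joint d (T : measurableType d) n (X : 'I_n -> {RV P >-> T}) :
    Om -> n.-tuple T :=
  fun w => [tuple X i w | i < n].

Definition sampling_model d p n (sigma : R)
    (x : 'I_n -> {RV P >-> d.-tuple R}) (z : 'I_n -> {RV P >-> p.-tuple R}) :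
    Prop :=
  [/\ forall i w, unit_cube (x i w),
      iid_with_law x (uniform_cube d),
      iid_with_law z (isotropic_normal sigma p) &
      independent (joint x) (joint z)].

Definition noise p n (z : 'I_n -> {RV P >-> p.-tuple R}) (w : Om) :
    'M[R]_(p, n) :=
  \matrix_(a, i) tnth (z i w) a.

End independence.

(* F = sum_k f_k u_k, where u_k is the k-th column of U. *)
Definition combine d p q (f : 'I_q -> d.-tuple R -> R) (U : 'M[R]_(p, q))
    (t : d.-tuple R) : 'cV[R]_p :=
  \sum_(k < q) f k t *: col k U.

Definition eval_design d p n (F : d.-tuple R -> 'cV[R]_p)
    (xs : n.-tuple (d.-tuple R)) : 'M[R]_(p, n) :=
  \matrix_(a, i) F (tnth xs i) a 0.

Definition fitted d n (g : d.-tuple R -> R) (xs : n.-tuple (d.-tuple R)) :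
    'cV[R]_n :=
  \col_i g (tnth xs i).

Definition sqr_norm_n n (v : 'cV[R]_n) : R := n%:R^-1 * enorm v ^+ 2.

Definition risk d p n (F G : d.-tuple R -> 'cV[R]_p)
    (xs : n.-tuple (d.-tuple R)) : R :=
  n%:R^-1 * \sum_(i < n) enorm (F (tnth xs i) - G (tnth xs i)) ^+ 2.

End model.

Section procedure.
Variable R : realType.

(* PCA estimate, with the top-q left singular vectors chosen
   measurably. *)
Definition pca_estimate dO (Om : measurableType dO) p n q
    (Y : Om -> 'M[R]_(p, n)) (Uh : Om -> 'M[R]_(p, q)) : Prop :=
  (forall a k, measurable_fun setT (fun w => Uh w a k)) /\
  (forall w, top_left_singular_vectors (Y w) (Uh w)).

Definition seminorm_on (S : Type) (G : set (S -> R)) (N : (S -> R) -> R) :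
    Prop :=
  [/\ forall g, G g -> 0 <= N g,
      forall (c : R) g, G g -> G (c \o* g) -> N (c \o* g) = `|c| * N g &
      forall g h, G g -> G h -> G (g \+ h) -> N (g \+ h) <= N g + N h].

(* Candidate functions g_k and roughness penalties P_k. The penalty is a power
   of a seminorm, so that P_k may be a seminorm (exponent 1), the square of one
   as for smoothing splines, or absent (the zero seminorm). *)
Record smoothing_problem (d q : nat) := SmoothingProblem {
  candidates : 'I_q -> set (d.-tuple R -> R) ;
  penalty_seminorm : 'I_q -> (d.-tuple R -> R) -> R ;
  penalty_exponent : 'I_q -> nat ;
  penalty_seminormP : forall k, seminorm_on (candidates k) (penalty_seminorm k) ;
  penalty_exponent_gt0 : forall k, (0 < penalty_exponent k)%N
}.

Definition penalty d q (S : smoothing_problem d q) k g : R :=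
  penalty_seminorm S k g ^+ penalty_exponent S k.

Definition criterion d q n (S : smoothing_problem d q) k
    (xs : n.-tuple (d.-tuple R)) (y : 'cV[R]_n) (g : d.-tuple R -> R) : R :=
  n%:R^-1 * \sum_(i < n) (y i 0 - g (tnth xs i)) ^+ 2 + penalty S k g.

Definition is_fit d q n (S : smoothing_problem d q) k
    (xs : n.-tuple (d.-tuple R)) (y : 'cV[R]_n) (g : d.-tuple R -> R) : Prop :=
  candidates S k g /\
  forall h, candidates S k h -> criterion S k xs y g <= criterion S k xs y h.

Definition in_cube d n (xs : n.-tuple (d.-tuple R)) : Prop :=
  forall i, unit_cube (tnth xs i).

(* Y^T *m col k v is the vector (v_k^T y_i)_i. *)
Definition smooths_by d q n p (S : smoothing_problem d q)
    (smoother : n.-tuple (d.-tuple R) -> 'cV[R]_n -> 'cV[R]_n) : Prop :=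
  forall (xs : n.-tuple (d.-tuple R)) (Y : 'M[R]_(p, n)) (v : 'M[R]_(p, q)) k,
    in_cube xs ->
    (exists g, is_fit S k xs (Y^T *m col k v) g) /\
    (forall g, is_fit S k xs (Y^T *m col k v) g ->
       fitted g xs = smoother xs (Y^T *m col k v)).

Definition direction_invariant d q n p (S : smoothing_problem d q) : Prop :=
  exists smoother, @smooths_by d q n p S smoother.

Definition linear_smoother d q n p (S : smoothing_problem d q)
    (L : n.-tuple (d.-tuple R) -> 'M[R]_n) : Prop :=
  @smooths_by d q n p S (fun xs y => L xs *m y).

Definition direction_fits d q n p (S : smoothing_problem d q)
    (xs : n.-tuple (d.-tuple R)) (Y : 'M[R]_(p, n)) (Uh : 'M[R]_(p, q))
    (fh : 'I_q -> d.-tuple R -> R) : Prop :=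
  forall k, is_fit S k xs (Y^T *m col k Uh) (fh k).

(* L xs *m (Y^T *m col k U) is the oracle fit in the true direction u_k. *)
Definition attains_rate dO (Om : measurableType dO) (P : probability Om R)
    d q n p (f : 'I_q -> d.-tuple R -> R) (U : 'M[R]_(p, q))
    (xs : Om -> n.-tuple (d.-tuple R)) (Y : Om -> 'M[R]_(p, n))
    (L : n.-tuple (d.-tuple R) -> 'M[R]_n) (C r : R) : Prop :=
  forall k : 'I_q,
    ('E_P[fun w => sqr_norm_n (L (xs w) *m ((Y w)^T *m col k U)
                               - fitted (f k) (xs w))]
     <= (C * n%:R `^ (- r))%:E)%E.

End procedure.

(* Main.v *)
Require Import Defs.
From HB Require Import structures.
From mathcomp Require Import all_boot all_order all_algebra.
From mathcomp Require Import ring lra.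
From mathcomp Require Import all_classical all_reals all_analysis.
From mathcomp Require Import measurable_realfun.
Set Implicit Arguments.
Unset Strict Implicit.
Unset Printing Implicit Defensive.
Import Order.TTheory GRing.Theory Num.Theory.
Import numFieldNormedType.Exports.
Import HBNNSimple.
Local Open Scope classical_set_scope.
Local Open Scope ring_scope.

(** Write Y = U G + Z, where G is the q x n matrix of the values f_k(x_i), and
    measure the error of Uh by sin2 Uh U = q - |Uh^T U|_F^2, the sum of the
    squared sines of the principal angles, which dominates the square of
    sin_Theta_norm.

    The matrix Y Y^T is a perturbation of U G G^T U^T + n sigma^2, of size
    sqrt (n p) in spectral norm, but a Davis-Kahan bound in terms of the whole
    perturbation would ask for the norm of the p x p matrix Z Z^T - n sigma^2.
    Only its action on U matters.  If w is a left singular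
    vector of Y with index j >= q and singular value s_j, then
    s_j^2 w^T U = w^T Y Y^T U; comparing with
    Y Y^T U = U G G^T + n sigma^2 U + D
    gives gap * |w^T U| <= |w^T D|, hence gap^2 * sin2 <= |D|_F^2
    (sin2_perturbation).  The matrix D has only q columns and its entries are
    sums of n independent centred variables, so |D|_F^4 has mean of order
    (n p)^2 (mean_gram_error).  The gap is of order n as soon as

    - G G^T / n is close to the diagonal matrix of the energies of the f_k,
      which fails with probability O(1/n^2) by a fourth moment bound
      (mean_gram_dev);
    - s_q^2 <= |Z|^2 <= n (sigma^2 + small), where the first inequality is
      Weyl's (weyl_tail).  The second fails with exponentially small
      probability when p <= c n, by a union bound over a grid of directions
      (expectation_net_sum); when p > c n, the trivial bound sin2 <= q
      already has the right order.

    Every probabilistic estimate is the integral of a nonnegative function: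
    fourth moments are bounded through E exp (s X) and E exp (- s X) with s of
    order n^(-1/2) (fourth_moment_of_mgf), these exponentials factor over the
    sample (expectation_prod), and the Gaussian factors are computed in closed
    form (isotropic_normal_mgf).  The complement of a good event enters as a
    nonnegative term that is at least 1 there.

    For the risk, with P and Ph the orthogonal projections on the spans of U
    and Uh, the error of the fitted values is
    (U G - P Y L^T) + (P - Ph) Y L^T.
    The first term is the oracle error; the second is at most
    |L|^2 |Y|^2 |P - Ph|_F^2 = 2 |L|^2 |Y|^2 sin2 (plug_in_error), where |Y|^2
    is O(n) up to a term with bounded mean, by the same grid, and sin2 has mean
    O(p/n) = O(n^(-r)). *)


(** * Frobenius and spectral norms *)

Section frobenius.
Variable R : realType.

Lemma sum_sqr_ge0 (I : finType) (a : I -> R) : 0 <= \sum_i a i ^+ 2.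
Proof. by apply: sumr_ge0 => i _; exact: sqr_ge0. Qed.

Lemma cauchy_schwarz_sum (I : finType) (a b : I -> R) :
  (\sum_i a i * b i) ^+ 2 <= (\sum_i a i ^+ 2) * (\sum_i b i ^+ 2).
Proof.
set A := \sum_i a i ^+ 2; set B := \sum_i b i ^+ 2; set C := \sum_i a i * b i.
have A0 : 0 <= A by exact: sum_sqr_ge0.
have H t : 0 <= A - 2 * t * C + t ^+ 2 * B.
  have -> : A - 2 * t * C + t ^+ 2 * B = \sum_i (a i - t * b i) ^+ 2.
    rewrite /A /B /C !mulr_sumr -sumrB -big_split /=.
    by apply: eq_bigr => i _; ring.
  exact: sum_sqr_ge0.
have [B0|B0] := eqVneq B 0.
  (* For B = 0 the polynomial H is affine in t and takes the value -1 here. *)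
  have := H ((A + 1) / (2 * C)); rewrite B0 mulr0 addr0 mulr0.
  have [->|C0] := eqVneq C 0; first by rewrite expr0n.
  have -> : A - 2 * ((A + 1) / (2 * C)) * C = - 1 by field.
  by rewrite lerNr oppr0 ler10.
have Bp : 0 < B by rewrite lt_def B0 sum_sqr_ge0.
have := H (C / B).
have -> : A - 2 * (C / B) * C + (C / B) ^+ 2 * B = A - C ^+ 2 / B by field.
by rewrite subr_ge0 ler_pdivrMr.
Qed.

(** Squared Frobenius norm; on vectors it is the square of enorm. *)
Definition sqn m n (A : 'M[R]_(m, n)) : R := \sum_i \sum_j A i j ^+ 2.

Lemma sqn_ge0 m n (A : 'M[R]_(m, n)) : 0 <= sqn A.
Proof. by apply: sumr_ge0 => i _; exact: sum_sqr_ge0. Qed.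

Lemma sqn_tr m n (A : 'M[R]_(m, n)) : sqn A^T = sqn A.
Proof. by rewrite /sqn exchange_big; do 2 (apply: eq_bigr => ? _); rewrite mxE. Qed.

Lemma sqn_trace m n (A : 'M[R]_(m, n)) : sqn A = \tr (A^T *m A).
Proof.
rewrite -sqn_tr /sqn /mxtrace; apply: eq_bigr => i _; rewrite mxE.
by apply: eq_bigr => j _; rewrite !mxE expr2.
Qed.

Lemma sqn_cV m (v : 'cV[R]_m) : sqn v = \sum_i v i 0 ^+ 2.
Proof. by apply: eq_bigr => i _; rewrite big_ord1. Qed.

Lemma sqn_rV m (v : 'rV[R]_m) : sqn v = \sum_i v 0 i ^+ 2.
Proof. by rewrite /sqn big_ord1. Qed.

Lemma enorm_sqr m (v : 'cV[R]_m) : enorm v ^+ 2 = sqn v.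
Proof. by rewrite /enorm sqr_sqrtr ?sqn_cV// sum_sqr_ge0. Qed.

Lemma enorm_ge0 m (v : 'cV[R]_m) : 0 <= enorm v.
Proof. exact: sqrtr_ge0. Qed.

Lemma sqn0 m n : sqn (0 : 'M[R]_(m, n)) = 0.
Proof. by rewrite /sqn big1// => i _; rewrite big1// => j _; rewrite mxE expr0n. Qed.

Lemma sqn_eq0 m n (A : 'M[R]_(m, n)) : sqn A = 0 -> A = 0.
Proof.
move=> /eqP; rewrite psumr_eq0; last by move=> i _; exact: sum_sqr_ge0.
move=> /allP H; apply/matrixP => i j; rewrite mxE.
have := H i (mem_index_enum i); rewrite psumr_eq0; last by move=> ? _; exact: sqr_ge0.
by move=> /allP/(_ j (mem_index_enum j)); rewrite sqrf_eq0 => /eqP.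
Qed.

Lemma sqnZ m n c (A : 'M[R]_(m, n)) : sqn (c *: A) = c ^+ 2 * sqn A.
Proof.
rewrite /sqn mulr_sumr; apply: eq_bigr => i _; rewrite mulr_sumr.
by apply: eq_bigr => j _; rewrite mxE exprMn.
Qed.

Lemma sqnD2 m n (A B : 'M[R]_(m, n)) : sqn (A + B) <= 2 * sqn A + 2 * sqn B.
Proof.
rewrite /sqn !mulr_sumr -big_split; apply: ler_sum => i _ /=.
rewrite !mulr_sumr -big_split; apply: ler_sum => j _ /=.
by rewrite mxE; have := sqr_ge0 (A i j - B i j); nra.
Qed.

Lemma sqnD3 m n (A B C : 'M[R]_(m, n)) :
  sqn (A + B + C) <= 3 * (sqn A + sqn B + sqn C).
Proof.
rewrite /sqn -!big_split mulr_sumr; apply: ler_sum => i _ /=.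
rewrite -!big_split mulr_sumr; apply: ler_sum => j _ /=.
rewrite !mxE; have := sqr_ge0 (A i j - B i j); have := sqr_ge0 (A i j - C i j).
by have := sqr_ge0 (B i j - C i j); nra.
Qed.

Lemma sqn_cols m n (A : 'M[R]_(m, n)) : sqn A = \sum_j sqn (col j A).
Proof.
rewrite /sqn exchange_big; apply: eq_bigr => j _; apply: eq_bigr => i _.
by rewrite big_ord1 mxE.
Qed.

Lemma sqn_rows m n (A : 'M[R]_(m, n)) : sqn A = \sum_i sqn (row i A).
Proof. by apply: eq_bigr => i _; rewrite sqn_rV; apply: eq_bigr => j _; rewrite mxE. Qed.

Lemma sqn_orth m n k (W : 'M[R]_(m, n)) (A : 'M[R]_(n, k)) :
  orthonormal_cols W -> sqn (W *m A) = sqn A.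
Proof. by move=> WW; rewrite !sqn_trace trmx_mul mulmxA -(mulmxA A^T) WW mulmx1. Qed.

Lemma orthonormal_sqr_trmx m (W : 'M[R]_m) : orthonormal_cols W -> W *m W^T = 1%:M.
Proof. exact: mulmx1C. Qed.

Lemma sqn_orthT m k (W : 'M[R]_m) (A : 'M[R]_(m, k)) :
  orthonormal_cols W -> sqn (W^T *m A) = sqn A.
Proof.
move=> WW; apply: sqn_orth; rewrite /orthonormal_cols trmxK.
exact: orthonormal_sqr_trmx.
Qed.

Lemma sqn_orthonormal m n (W : 'M[R]_(m, n)) : orthonormal_cols W -> sqn W = n%:R.
Proof. by move=> WW; rewrite sqn_trace WW mxtrace1. Qed.

Lemma sqn_mul m n k (A : 'M[R]_(m, n)) (B : 'M[R]_(n, k)) :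
  sqn (A *m B) <= sqn A * sqn B.
Proof.
rewrite /sqn mulr_suml; apply: ler_sum => i _.
rewrite [X in _ <= _ * X]exchange_big mulr_sumr; apply: ler_sum => j _.
by rewrite mxE cauchy_schwarz_sum.
Qed.

Lemma mx11_cauchy_schwarz n (a : 'rV[R]_n) (b : 'cV[R]_n) :
  (a *m b) 0 0 ^+ 2 <= sqn a * sqn b.
Proof. by have := sqn_mul a b; rewrite {1}/sqn !big_ord1. Qed.

(** Frobenius norms are computed column by column, so a bound on the action of
    [B] on vectors multiplies the Frobenius norm of any matrix. *)
Lemma sqn_mull_le m n k (B : 'M[R]_(m, n)) (A : 'M[R]_(n, k)) c :
  (forall v : 'cV_n, sqn (B *m v) <= c * sqn v) -> sqn (B *m A) <= c * sqn A.
Proof.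
move=> H; rewrite sqn_cols [in leRHS]sqn_cols mulr_sumr; apply: ler_sum => j _.
by rewrite colE -mulmxA -colE; exact: H.
Qed.

Lemma enorm_sqn m (v : 'cV[R]_m) : enorm v = Num.sqrt (sqn v).
Proof. by rewrite /enorm sqn_cV. Qed.

Lemma enorm_le m (v : 'cV[R]_m) c : 0 <= c -> (enorm v <= c) = (sqn v <= c ^+ 2).
Proof.
by move=> c0; rewrite -enorm_sqr ler_pXn2r ?nnegrE ?enorm_ge0.
Qed.

Lemma enormD m (u v : 'cV[R]_m) : enorm (u + v) <= enorm u + enorm v.
Proof.
rewrite enorm_le ?addr_ge0 ?enorm_ge0// sqrrD !enorm_sqr.
have -> : sqn (u + v) = sqn u + (\sum_i u i 0 * v i 0) *+ 2 + sqn v.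
  rewrite !sqn_cV -sumrMnl -!big_split; apply: eq_bigr => i _ /=.
  by rewrite mxE sqrrD.
rewrite lerD2r lerD2l lerMn2r /=.
apply: le_trans (ler_norm _) _.
rewrite -(@ler_pXn2r _ 2) ?nnegrE ?mulr_ge0 ?enorm_ge0//.
rewrite real_normK ?num_real// exprMn !enorm_sqr !sqn_cV.
exact: cauchy_schwarz_sum.
Qed.

Lemma enormZ m c (v : 'cV[R]_m) : enorm (c *: v) = `|c| * enorm v.
Proof. by rewrite !enorm_sqn sqnZ sqrtrM ?sqr_ge0// sqrtr_sqr. Qed.

Lemma spectral_norm_has_sup m n (A : 'M[R]_(m, n)) :
  has_sup [set enorm (A *m v) | v in [set v : 'cV[R]_n | enorm v <= 1]].
Proof.
split.
  exists (enorm (A *m 0)); exists 0 => //=.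
  by rewrite enorm_le// sqn0 expr1n ler01.
exists (Num.sqrt (sqn A)) => _ [v /= v1 <-].
rewrite enorm_sqn ler_wsqrtr// (le_trans (sqn_mul _ _))// ler_piMr ?sqn_ge0//.
by move: v1; rewrite enorm_le// expr1n.
Qed.

Lemma spectral_norm_ub m n (A : 'M[R]_(m, n)) (v : 'cV[R]_n) :
  enorm (A *m v) <= spectral_norm A * enorm v.
Proof.
have [v0|v0] := eqVneq (sqn v) 0.
  by rewrite (sqn_eq0 v0) mulmx0 !enorm_sqn !sqn0 sqrtr0 mulr0.
have e0 : 0 < enorm v by rewrite enorm_sqn sqrtr_gt0 lt_def v0 sqn_ge0.
rewrite -ler_pdivrMr//.
have -> : enorm (A *m v) / enorm v = enorm (A *m ((enorm v)^-1 *: v)).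
  by rewrite -scalemxAr enormZ ger0_norm ?invr_ge0 ?enorm_ge0// mulrC.
apply: ub_le_sup; first by have [] := spectral_norm_has_sup A.
exists ((enorm v)^-1 *: v) => //=.
by rewrite enormZ ger0_norm ?invr_ge0 ?enorm_ge0// mulVf// gt_eqF.
Qed.

Lemma spectral_norm_ge0 m n (A : 'M[R]_(m, n)) : 0 <= spectral_norm A.
Proof.
apply: (@le_trans _ _ (enorm (A *m 0))); first exact: enorm_ge0.
apply: ub_le_sup; first by have [] := spectral_norm_has_sup A.
by exists 0 => //=; rewrite enorm_le// sqn0 expr1n ler01.
Qed.

Lemma spectral_norm_le m n (A : 'M[R]_(m, n)) c :
  (forall v : 'cV_n, enorm v <= 1 -> enorm (A *m v) <= c) -> spectral_norm A <= c.
Proof.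
move=> H; apply: ge_sup; first by have [] := spectral_norm_has_sup A.
by move=> _ [v /= v1 <-]; exact: H.
Qed.

Lemma sqn_mul_spectral m n (A : 'M[R]_(m, n)) c (v : 'cV[R]_n) :
  spectral_norm A <= c -> sqn (A *m v) <= c ^+ 2 * sqn v.
Proof.
move=> Ac; have c0 : 0 <= c := le_trans (spectral_norm_ge0 A) Ac.
rewrite -!enorm_sqr -exprMn lerXn2r ?nnegrE ?mulr_ge0 ?enorm_ge0//.
by rewrite (le_trans (spectral_norm_ub A v))// ler_wpM2r ?enorm_ge0.
Qed.

End frobenius.

(** * Existence of singular value decompositions *)

Section svd.
Variable R : realType.

Lemma continuous_sumr (T : topologicalType) (I : Type) (s : seq I) (F : I -> T -> R) :
  (forall i, continuous (F i)) -> continuous (fun x => \sum_(i <- s) F i x).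
Proof.
move=> cF; elim: s => [|i s IH] x.
  by under eq_fun do rewrite big_nil; exact: cvg_cst.
under eq_fun do rewrite big_cons.
by apply: (@cvgD _ R^o); [exact: cF|exact: IH].
Qed.

Lemma continuous_sqn_mulr m n (B : 'M[R]_(n.+1, m)) :
  continuous (fun r : 'rV[R]_n.+1 => sqn (r *m B)).
Proof.
under eq_fun do rewrite sqn_rV.
apply: continuous_sumr => i.
have cB : continuous (fun r : 'rV[R]_n.+1 => (r *m B) 0 i).
  under eq_fun do rewrite mxE.
  apply: (continuous_sumr (F := fun j (r : 'rV[R]_n.+1) => r 0 j * B j i)) => j y.
  by apply: continuousM; [exact: (@coord_continuous R 1 n.+1 0 j)|exact: cst_continuous].
under eq_fun do rewrite expr2.
by move=> x; apply: continuousM; exact: cB.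
Qed.

(** By compactness of the unit sphere; the maximal value is the square of the
    largest singular value. *)
Lemma exists_max_direction n m (A : 'M[R]_(m, n.+1)) : exists v : 'cV[R]_n.+1,
  sqn v = 1 /\ forall u : 'cV[R]_n.+1, sqn (A *m u) <= sqn (A *m v) * sqn u.
Proof.
pose S := [set r : 'rV[R]_n.+1 | sqn r = 1].
have cS : compact S.
  apply: bounded_closed_compact.
    exists 1; split; first exact: num_real.
    move=> M M1 r /= r1; rewrite /Num.Def.normr/= mx_normrE.
    apply/bigmax_leP; split => /=; first by rewrite ltW// (lt_trans ltr01).
    move=> [i j] _ /=; rewrite (ord1 i) {i}.
    apply/ltW/(le_lt_trans _ M1).
    rewrite -(@ler_pXn2r _ 2) ?nnegrE// real_normK ?num_real// expr1n -r1 sqn_rV.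
    by rewrite (bigD1 j)//= lerDl sumr_ge0// => k _; exact: sqr_ge0.
  have -> : S = (fun r : 'rV[R]_n.+1 => sqn (r *m 1%:M)) @^-1` [set 1].
    by apply/seteqP; split => r /=; rewrite mulmx1.
  apply: preimage_closed; last exact: closed_eq.
  by move=> x _; exact: continuous_sqn_mulr.
have S0 : S !=set0.
  exists (delta_mx 0 0); rewrite /S /= sqn_rV (bigD1 0)//= mxE eqxx expr1n big1 ?addr0//.
  by move=> i i0; rewrite mxE eqxx (negbTE i0) expr0n.
have [|r rS rmax] := EVT_max_rV (f := fun r => sqn (r *m A^T)) S0 cS.
  apply: continuous_subspaceT => x; exact: continuous_sqn_mulr.
have r1 : sqn r = 1 by rewrite inE in rS.
exists r^T; split; first by rewrite sqn_tr.
have E (x : 'rV[R]_n.+1) : sqn (A *m x^T) = sqn (x *m A^T).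
  by rewrite -[RHS]sqn_tr trmx_mul trmxK.
move=> u; rewrite -[u]trmxK !E sqn_tr.
move: u^T => {}u.
have [u0|u0] := eqVneq (sqn u) 0.
  by rewrite (sqn_eq0 u0) mul0mx !sqn0 mulr0.
have up : 0 < sqn u by rewrite lt_def u0 sqn_ge0.
pose c := (Num.sqrt (sqn u))^-1.
have c2 : c ^+ 2 = (sqn u)^-1 by rewrite exprVn sqr_sqrtr ?sqn_ge0.
have /rmax : c *: u \in S by rewrite inE /S /= sqnZ c2 mulVf.
by rewrite -scalemxAl sqnZ c2 mulrC ler_pdivrMr.
Qed.

(** The Householder reflection that exchanges [v] and the first basis vector. *)
Lemma orthogonal_with_first_col n (v : 'cV[R]_n.+1) : sqn v = 1 ->
  exists H : 'M[R]_n.+1, orthonormal_cols H /\ col 0 H = v.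
Proof.
move=> v1; pose e : 'cV[R]_n.+1 := delta_mx 0 0.
have sqn11 (u : 'cV[R]_n.+1) : u^T *m u = (sqn u)%:M.
  by rewrite [LHS]mx11_scalar sqn_trace /mxtrace big_ord1.
have ve : v^T *m e = (v 0 0)%:M.
  by rewrite [LHS]mx11_scalar -colE !mxE.
have ev : e^T *m v = (v 0 0)%:M.
  by rewrite -[LHS]trmxK trmx_mul trmxK ve tr_scalar_mx.
have ee : e^T *m e = 1%:M by rewrite trmx_delta mul_delta_mx [LHS]mx11_scalar mxE eqxx.
have evT : (e - v)^T = e^T - v^T by apply/matrixP => i j; rewrite !mxE.
have [v00|v00] := eqVneq (v 0 0) 1.
  exists 1%:M; split; first by rewrite /orthonormal_cols trmx1 mulmx1.
  rewrite colE mul1mx -/e; apply/eqP; rewrite -subr_eq0; apply/eqP/sqn_eq0.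
  have : (sqn (e - v))%:M = 0 :> 'M[R]_1.
    rewrite -sqn11 evT mulmxBl !mulmxBr ee ev ve sqn11 v1 v00.
    by rewrite !(subrr, subr0).
  by move=> /matrixP/(_ 0 0); rewrite !mxE.
pose u := e - v.
have u2 : u^T *m u = (2 * (1 - v 0 0))%:M.
  rewrite /u evT mulmxBl !mulmxBr ee ev ve sqn11 v1.
  by rewrite -!raddfB /=; congr _%:M; ring.
have nz : 1 - v 0 0 != 0 by rewrite subr_eq0 eq_sym.
pose c := (1 - v 0 0)^-1.
pose H := 1%:M - c *: (u *m u^T).
have HT : H^T = H by rewrite /H linearB /= linearZ /= trmx_mul trmxK trmx1.
exists H; split.
  have NN : (u *m u^T) *m (u *m u^T) = (2 * (1 - v 0 0)) *: (u *m u^T).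
    by rewrite mulmxA -(mulmxA u) u2 mul_mx_scalar -scalemxAl.
  rewrite /orthonormal_cols HT /H; move: (u *m u^T) NN => N NN.
  rewrite mulmxBl !mulmxBr !mul1mx mulmx1 -scalemxAl -scalemxAr NN !scalerA.
  by apply/matrixP => i j; rewrite !mxE /c; field.
rewrite colE -/e /H mulmxBl mul1mx -scalemxAl -mulmxA.
have -> : u^T *m e = (1 - v 0 0)%:M.
  by rewrite /u evT mulmxBl ee ve -raddfB.
rewrite mul_mx_scalar scalerA /c mulVf// scale1r /u opprB addrC subrK //.
Qed.

(** The largest singular value is the norm of the image of the first right
    singular vector. *)
Lemma singular_value_le q (A W V : 'M[R]_q) s c : is_svd A W s V -> 0 <= c ->
  (forall u : 'cV[R]_q, sqn (A *m u) <= c ^+ 2 * sqn u) -> forall i, s i <= c.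
Proof.
move=> [Wo Vo [sge snd] s0 AE] c0 Ac i.
apply: le_trans (snd 0%N i (leq0n i)) _.
case: q => [|q] in A W V Wo Vo s0 AE Ac *; first by rewrite s0.
rewrite -(@ler_pXn2r _ 2) ?nnegrE//.
have := Ac (V *m delta_mx 0 0); rewrite (sqn_orth _ Vo).
have -> : sqn (delta_mx 0 0 : 'cV[R]_q.+1) = 1.
  rewrite sqn_cV (bigD1 0)//= mxE eqxx expr1n big1 ?addr0// => k k0.
  by rewrite mxE (negbTE k0) expr0n.
rewrite mulr1 AE -!mulmxA (mulmxA V^T) Vo mul1mx (sqn_orth _ Wo) -colE sqn_cV.
rewrite (bigD1 0)//= !mxE eqxx mulr1n; apply: le_trans.
by rewrite lerDl; apply: sumr_ge0 => k _; exact: sqr_ge0.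
Qed.

Lemma mulmx_block_svd q (W1 V1 : 'M[R]_(1 + q)) (W V S : 'M[R]_q) (c : R) :
  W1 *m block_mx c%:M 0 0 (W *m S *m V^T) *m V1^T =
  (W1 *m block_mx 1%:M 0 0 W) *m block_mx c%:M 0 0 S *m
    (V1 *m block_mx 1%:M 0 0 V)^T.
Proof.
rewrite trmx_mul tr_block_mx trmx1 !trmx0 !mulmxA -2![in RHS](mulmxA W1).
by rewrite !mulmx_block !(mul1mx, mulmx1, mulmx0, mul0mx, addr0, add0r).
Qed.

(** Induction on the size.  Let [v] maximize the norm of the image, with value [s0].
    In orthonormal bases starting with [v] and with its normalized image, the
    matrix has first column (s0, 0, ..., 0).  Its first row is then (s0, 0, ..., 0)
    as well, since a nonzero remainder [r] would make the image of (s0, r^T) too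
    long.  The remaining block is bounded by [s0], so its decomposition extends
    with singular values in decreasing order. *)
Lemma svd_exists q (A : 'M[R]_q) : exists W s V, is_svd A W s V.
Proof.
elim: q A => [|q IH] A.
  exists 0, (fun=> 0), 0; split => //; by [apply/matrixP => -[]|apply/matrixP => -[] []].
have [v [v1 vmax]] := exists_max_direction A.
pose s0 := Num.sqrt (sqn (A *m v)).
have s02 : s0 ^+ 2 = sqn (A *m v) by rewrite sqr_sqrtr// sqn_ge0.
have s0ge : 0 <= s0 by exact: sqrtr_ge0.
have [s00|s0neq] := eqVneq s0 0.
  have A0 : A = 0.
    apply/sqn_eq0/eqP; rewrite eq_le sqn_ge0 andbT sqn_cols big1// => j _.
    apply/eqP; rewrite eq_le sqn_ge0 andbT colE (le_trans (vmax _))//.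
    by rewrite -s02 s00 expr0n mul0r.
  exists 1%:M, (fun=> 0), 1%:M; split => //; try by rewrite /orthonormal_cols trmx1 mulmx1.
  rewrite A0 mul1mx trmx1 mulmx1; apply/matrixP => i j; by rewrite !mxE mul0rn.
have s0p : 0 < s0 by rewrite lt_def s0neq.
have [V1 [V1o V1v]] := orthogonal_with_first_col v1.
have w1 : sqn (s0^-1 *: (A *m v)) = 1 by rewrite sqnZ -s02 exprVn mulVf// expf_neq0.
have [W1 [W1o W1w]] := orthogonal_with_first_col w1.
pose B : 'M[R]_(1 + q) := W1^T *m A *m V1.
have AB : A = W1 *m B *m V1^T.
  rewrite /B !mulmxA (orthonormal_sqr_trmx W1o) mul1mx -mulmxA.
  by rewrite (orthonormal_sqr_trmx V1o) mulmx1.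
have Bmax (u : 'cV[R]_(1 + q)) : sqn (B *m u) <= s0 ^+ 2 * sqn u.
  by rewrite /B -!mulmxA sqn_orthT// (le_trans (vmax _))// s02 ler_wpM2l ?sqn_ge0// sqn_orth.
have Bcol : col 0 B = s0 *: delta_mx 0 0.
  rewrite /B colE -!mulmxA -colE V1v.
  have -> : A *m v = s0 *: (s0^-1 *: (A *m v)) by rewrite scalerA divff// scale1r.
  by rewrite -W1w -scalemxAr colE mulmxA W1o mul1mx.
clearbody B.
pose A' := drsubmx B; pose r := ursubmx B.
have Bul : ulsubmx B = s0%:M.
  apply/matrixP => i j; rewrite (ord1 i) (ord1 j) !mxE eqxx mulr1n.
  have /matrixP/(_ 0 0) := Bcol; rewrite !mxE eqxx mulr1 => <-.
  by congr (B _ _); apply/val_inj.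
have Bdl : dlsubmx B = 0.
  apply/matrixP => i j; rewrite (ord1 j) !mxE.
  have /matrixP/(_ (rshift 1 i) 0) := Bcol; rewrite !mxE /= mulr0 => <-.
  by congr (B _ _); apply/val_inj.
have sqn_col_mx k l t (X : 'M[R]_(k, t)) (Y : 'M[R]_(l, t)) :
    sqn (col_mx X Y) = sqn X + sqn Y.
  rewrite /sqn big_split_ord /=; congr (_ + _); apply: eq_bigr => i _;
  by apply: eq_bigr => j _; rewrite ?col_mxEu ?col_mxEd.
have Bblock : B = block_mx s0%:M r 0 A' by rewrite -[LHS]submxK Bul Bdl.
have r0 : r = 0.
  have := Bmax (col_mx s0%:M r^T).
  rewrite {1}Bblock mul_block_col !sqn_col_mx sqn_tr.
  have -> : sqn (s0%:M : 'M[R]_1) = s0 ^+ 2.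
    by rewrite sqn_cV big_ord1 mxE eqxx.
  have -> : s0%:M *m s0%:M + r *m r^T = (s0 ^+ 2 + sqn r)%:M.
    rewrite -scalar_mxM -expr2 raddfD /=; congr (_ + _).
    by rewrite [LHS]mx11_scalar -sqn_tr sqn_trace trmxK /mxtrace big_ord1.
  have -> : sqn ((s0 ^+ 2 + sqn r)%:M : 'M[R]_1) = (s0 ^+ 2 + sqn r) ^+ 2.
    by rewrite sqn_cV big_ord1 mxE eqxx.
  move=> h; apply: sqn_eq0.
  have h1 := sqn_ge0 r; have h2 := sqn_ge0 (0 *m s0%:M + A' *m r^T).
  have h3 : 0 < s0 ^+ 2 by rewrite exprn_gt0.
  apply/eqP; rewrite eq_le h1 andbT; nra.
have A'max (u : 'cV[R]_q) : sqn (A' *m u) <= s0 ^+ 2 * sqn u.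
  have := Bmax (col_mx 0 u).
  rewrite {1}Bblock mul_block_col !sqn_col_mx !mulmx0 r0 mul0mx.
  by rewrite !(sqn0, add0r, addr0).
have [W' [s' [V' svdA']]] := IH A'.
have s's0 i : s' i <= s0 := singular_value_le svdA' s0ge A'max i.
have [W'o V'o [s'ge s'nd] s'0 A'E] := svdA'.
pose W : 'M[R]_(1 + q) := (W1 : 'M[R]_(1 + q)) *m block_mx (1%:M : 'M[R]_1) 0 0 W'.
pose V : 'M[R]_(1 + q) := (V1 : 'M[R]_(1 + q)) *m block_mx (1%:M : 'M[R]_1) 0 0 V'.
have blocko (X : 'M[R]_q) (Y : 'M[R]_(1 + q)) : orthonormal_cols X -> orthonormal_cols Y ->
    orthonormal_cols (Y *m block_mx (1%:M : 'M[R]_1) 0 0 X).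
  move=> Xo Yo; rewrite /orthonormal_cols trmx_mul mulmxA -(mulmxA _ Y^T) Yo mulmx1.
  rewrite tr_block_mx trmx1 !trmx0 mulmx_block !mul1mx !mulmx0 !mul0mx Xo.
  by rewrite !addr0 add0r -scalar_mx_block.
exists W, (fun i => if i is j.+1 then s' j else s0), V; split.
- exact: blocko.
- exact: blocko.
- split; first by case.
  by case=> [|i] [|j] //= ij; exact: s'nd.
- by case=> [|i]; rewrite minnn // ltnS => qi; apply: s'0; rewrite minnn.
set D' : 'M[R]_(1 + q) := \matrix_(i, j) _.
have D'E : D' = block_mx s0%:M 0 0 (\matrix_(i < q, j < q) (s' i *+ (i == j :> nat))).
  apply/matrixP => i j; rewrite /D' mxE.
  case: (split_ordP i) => i' ->; case: (split_ordP j) => j' ->;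
    rewrite ?block_mxEul ?block_mxEur ?block_mxEdl ?block_mxEdr !mxE /=.
  - by rewrite (ord1 i') (ord1 j').
  - by rewrite (ord1 i').
  - by rewrite (ord1 j').
  - by rewrite !add1n eqSS.
by rewrite AB Bblock r0 A'E D'E; exact: mulmx_block_svd.
Qed.

End svd.

(** * Principal angles between subspaces *)

Section subspaces.
Variable R : realType.

(** Pythagoras for the orthogonal projection on the column space of [U]. *)
Lemma sqn_sub_proj p q k (U : 'M[R]_(p, q)) (X : 'M[R]_(p, k)) :
  orthonormal_cols U -> sqn (X - U *m (U^T *m X)) = sqn X - sqn (U^T *m X).
Proof.
move=> UU; set A := U^T *m X; rewrite !sqn_trace -raddfB /=; congr (\tr _).
have XU : X^T *m U = A^T by rewrite trmx_mul trmxK.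
have -> : (X - U *m A)^T = X^T - A^T *m U^T.
  by rewrite -trmx_mul; apply/matrixP => i j; rewrite !mxE.
rewrite mulmxBl !mulmxBr (mulmxA X^T) XU -(mulmxA A^T U^T X) -/A.
by rewrite -(mulmxA A^T) (mulmxA U^T) UU mul1mx subrr subr0.
Qed.

Lemma sqn_trmul_le p q k (U : 'M[R]_(p, q)) (X : 'M[R]_(p, k)) :
  orthonormal_cols U -> sqn (U^T *m X) <= sqn X.
Proof. by move=> UU; rewrite -subr_ge0 -sqn_sub_proj// sqn_ge0. Qed.

(** Sum of the squared sines of the principal angles, that is, the squared
    Frobenius norm of the part of [U] orthogonal to the column space of [Uh]. *)
Definition sin2 p q (Uh U : 'M[R]_(p, q)) : R := q%:R - sqn (Uh^T *m U).

Lemma sin2_ge0 p q (Uh U : 'M[R]_(p, q)) :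
  orthonormal_cols Uh -> orthonormal_cols U -> 0 <= sin2 Uh U.
Proof. by move=> Uho Uo; rewrite subr_ge0 -(sqn_orthonormal Uo) sqn_trmul_le. Qed.

Lemma sin2_le p q (Uh U : 'M[R]_(p, q)) : sin2 Uh U <= q%:R.
Proof. by rewrite gerBl sqn_ge0. Qed.

(** Both projections have trace [q], and the trace of their product is the sum of
    the squared cosines of the principal angles. *)
Lemma sqn_proj_diff p q (Uh U : 'M[R]_(p, q)) :
  orthonormal_cols Uh -> orthonormal_cols U ->
  sqn (U *m U^T - Uh *m Uh^T) = 2 * sin2 Uh U.
Proof.
move=> Uho Uo.
have PT (V : 'M[R]_(p, q)) : (V *m V^T)^T = V *m V^T by rewrite trmx_mul trmxK.
have PP (V : 'M[R]_(p, q)) : orthonormal_cols V ->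
    V *m V^T *m (V *m V^T) = V *m V^T.
  by move=> Vo; rewrite mulmxA -(mulmxA V) Vo mulmx1.
have trP (V : 'M[R]_(p, q)) : orthonormal_cols V -> \tr (V *m V^T) = q%:R.
  by move=> Vo; rewrite mxtrace_mulC Vo mxtrace1.
rewrite sqn_trace [_^T]linearB /= !PT mulmxBl !mulmxBr !PP// !raddfB /= !trP//.
rewrite (mxtrace_mulC (U *m U^T)).
have -> : \tr (Uh *m Uh^T *m (U *m U^T)) = sqn (Uh^T *m U).
  by rewrite sqn_trace trmx_mul trmxK mulmxA mxtrace_mulC !mulmxA.
by rewrite /sin2; ring.
Qed.

(** The cosines [s k] are the singular values of [Uh^T *m U], so [sin2] is the sum
    of the [1 - s k ^+ 2], each of which is a squared diagonal entry. *)
Lemma sin_Theta_norm_le p q (Uh U : 'M[R]_(p, q)) :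
  orthonormal_cols Uh -> orthonormal_cols U ->
  sin_Theta_norm Uh U ^+ 2 <= sin2 Uh U.
Proof.
move=> Uho Uo; rewrite /sin_Theta_norm.
set s := singular_values (Uh^T *m U).
have [W [V svdA]] : exists W V, is_svd (Uh^T *m U) W s V.
  have h : exists t, [set t | exists W V, is_svd (Uh^T *m U) W t V] t.
    by have [W [t [V h]]] := svd_exists (Uh^T *m U); exists t, W, V.
  exact: (xgetPex (fun=> 0) h).
have s1 : forall i, s i <= 1.
  apply: (singular_value_le svdA) => // u; rewrite expr1n mul1r -mulmxA.
  by rewrite (le_trans (sqn_trmul_le _ Uho))// sqn_orth.
have [Wo Vo [s0 _] _ AE] := svdA.
have sqnA : sqn (Uh^T *m U) = \sum_(k < q) s k ^+ 2.
  rewrite AE -mulmxA sqn_orth// -sqn_tr trmx_mul trmxK sqn_orth// sqn_tr.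
  apply: eq_bigr => i _; rewrite (bigD1 i)//= mxE eqxx mulr1n big1 ?addr0//.
  move=> j ji; rewrite mxE; case: eqP => [ij|_]; last by rewrite expr0n.
  by move/eqP: ji; case; apply/val_inj.
have sin2E : sin2 Uh U = \sum_(k < q) (1 - s k ^+ 2).
  by rewrite /sin2 sqnA sumrB sumr_const card_ord.
have sk2 k : s k ^+ 2 <= 1 by rewrite expr_le1.
have sink k : (1 - s (k : 'I_q) ^+ 2) <= sin2 Uh U.
  rewrite sin2E (bigD1 k)//= lerDl sumr_ge0// => j _.
  by rewrite subr_ge0.
set N := spectral_norm _.
have N0 : 0 <= N by exact: spectral_norm_ge0.
have S0 := sin2_ge0 Uho Uo.
suff : N <= Num.sqrt (sin2 Uh U).
  by move=> h; rewrite -[leRHS](sqr_sqrtr S0) lerXn2r ?nnegrE// sqrtr_ge0.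
apply: spectral_norm_le => v v1.
rewrite enorm_sqn ler_wsqrtr// mul_diag_mx sqn_cV.
apply: (@le_trans _ _ (sin2 Uh U * sqn v)); last first.
  by rewrite ler_piMr//; move: v1; rewrite enorm_le// expr1n.
rewrite sqn_cV mulr_sumr; apply: ler_sum => k _.
rewrite !mxE -/s exprMn ler_wpM2r ?sqr_ge0// sin_acos ?sqr_sqrtr ?subr_ge0//.
by rewrite s1 andbT (le_trans _ (s0 k))// oppr_le0.
Qed.

Lemma top_left_orthonormal p n q (Y : 'M[R]_(p, n)) (Uh : 'M[R]_(p, q)) :
  (q <= p)%N -> top_left_singular_vectors Y Uh -> orthonormal_cols Uh.
Proof.
move=> qp [W [s [V [[Wo _ _ _ _] UhW]]]].
have UhE i k : Uh i k = W i (widen_ord qp k).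
  by have /matrixP/(_ i 0) := UhW k (widen_ord qp k) erefl; rewrite !mxE.
apply/matrixP => k l; rewrite !mxE.
have /matrixP/(_ (widen_ord qp k) (widen_ord qp l)) := Wo; rewrite !mxE => H.
rewrite -[RHS]H; apply: eq_bigr => i _; by rewrite !mxE !UhE.
Qed.

Lemma svd_left_eigen p n (Y : 'M[R]_(p, n)) W s V (j : 'I_p) :
  is_svd Y W s V -> Y *m Y^T *m col j W = s j ^+ 2 *: col j W.
Proof.
move=> [Wo Vo _ s0 ->].
set S := \matrix_(_, _) _.
have -> : W *m S *m V^T *m (W *m S *m V^T)^T = W *m (S *m S^T) *m W^T.
  by rewrite !trmx_mul trmxK !mulmxA -(mulmxA _ V^T V) Vo mulmx1.
rewrite !colE -!mulmxA (mulmxA W^T) Wo mul1mx.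
rewrite scalemxAr; congr (_ *m _); rewrite mulmxA.
apply/matrixP => i k; rewrite (ord1 k) {k} !mxE.
rewrite (bigD1 j)//= big1; last first.
  by move=> k kj; rewrite mxE [X in _ * X]mxE (negbTE kj) mulr0.
rewrite addr0 !mxE !eqxx andbT mulr1.
have [jn|jn] := ltnP j n.
  rewrite (bigD1 (Ordinal jn))//= big1; last first.
    move=> l ln; rewrite !mxE; have -> : (j == l :> nat) = false; last by rewrite mulr0.
    by apply: contraNF ln => /eqP jl; apply/eqP/val_inj.
  rewrite !mxE /= eqxx mulr1n addr0.
  case: (eqVneq i j) => [->|ij].
    by rewrite eqxx !mulr1n mulr1 expr2.
  by rewrite (_ : (i == j :> nat) = false) ?mulr0n ?mul0r ?mulr0//; exact/negbTE.
rewrite (s0 j); last by rewrite geq_min jn orbT.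
rewrite expr0n mul0r big1// => l _; rewrite !mxE; rewrite (_ : (j == l :> nat) = false) ?mulr0n ?mulr0//.
by apply/eqP => jl; have := ltn_ord l; rewrite -jl ltnNge jn.
Qed.

End subspaces.

(** * Perturbation of the leading left singular subspace *)

Section perturbation.
Variable R : realType.

(** More unknowns than equations. *)
Lemma wide_kernel q (M : 'M[R]_(q, q.+1)) : exists2 a : 'cV[R]_q.+1, a != 0 & M *m a = 0.
Proof.
pose K := kermx M^T.
have K0 : K != 0.
  rewrite kermx_eq0 /row_free neq_ltn mxrank_tr.
  by rewrite (leq_ltn_trans (rank_leq_row M)).
exists (nz_row K)^T.
  by rewrite -trmx0 (inj_eq trmx_inj) nz_row_eq0.
rewrite -[LHS]trmxK trmx_mul trmxK.
by have /sub_kermxP -> := nz_row_sub K; rewrite trmx0.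
Qed.

(** Among the combinations of the first [q.+1] left singular vectors there is one
    orthogonal to the [q] columns of [U]; on it [Y^T] acts as [Z^T]. *)
Lemma weyl_tail p q n (U : 'M[R]_(p, q)) (G : 'M[R]_(q, n)) (Y Z : 'M[R]_(p, n))
    W s V c (j : 'I_p) :
  Y = U *m G + Z -> is_svd Y W s V ->
  (forall v : 'cV_p, sqn (Z^T *m v) <= c * sqn v) -> (q <= j)%N ->
  s j ^+ 2 <= c.
Proof.
move=> YE svdY Zc qj.
have qp : (q.+1 <= p)%N := leq_ltn_trans qj (ltn_ord j).
have [Wo _ [s0 snd] _ _] := svdY.
pose W' : 'M[R]_(p, q.+1) := \matrix_(i, k) W i (widen_ord qp k).
have colW' k : col k W' = col (widen_ord qp k) W by apply/colP => i; rewrite !mxE.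
have W'o : orthonormal_cols W'.
  apply/matrixP => k l; rewrite !mxE.
  have /matrixP/(_ (widen_ord qp k) (widen_ord qp l)) := Wo; rewrite !mxE => H.
  by rewrite -[RHS]H; apply: eq_bigr => i _; rewrite !mxE.
have [a a0 Ua] := wide_kernel (U^T *m W').
pose v := W' *m a.
have va : sqn v = sqn a by rewrite sqn_orth.
have ap : 0 < sqn a.
  by rewrite lt_def sqn_ge0 andbT; apply: contra_neq a0; exact: sqn_eq0.
have Yv : Y^T *m v = Z^T *m v.
  have -> : Y^T = G^T *m U^T + Z^T by rewrite YE -trmx_mul; apply/matrixP => i k; rewrite !mxE.
  by rewrite mulmxDl -mulmxA /v (mulmxA U^T) Ua mulmx0 add0r.
have eig : Y *m Y^T *m W' = W' *m diag_mx (\row_k (s k ^+ 2)).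
  apply/matrixP => i k.
  have /colP/(_ i) : col k (Y *m Y^T *m W') = s k ^+ 2 *: col k W'.
    by rewrite colE -mulmxA -colE colW' (svd_left_eigen _ svdY).
  by rewrite mxE => ->; rewrite mul_mx_diag !mxE mulrC.
have sqY : sqn (Y^T *m v) = \sum_k s (k : 'I_q.+1) ^+ 2 * a k 0 ^+ 2.
  rewrite sqn_trace trmx_mul trmxK -mulmxA (mulmxA Y) /v (mulmxA (Y *m Y^T)) eig.
  rewrite trmx_mul -!mulmxA (mulmxA W'^T) W'o mul1mx mul_diag_mx /mxtrace big_ord1 mxE.
  by apply: eq_bigr => k _; rewrite !mxE; ring.
have h1 : s j ^+ 2 * sqn a <= sqn (Y^T *m v).
  rewrite sqY sqn_cV mulr_sumr; apply: ler_sum => k _.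
  rewrite ler_wpM2r ?sqr_ge0// lerXn2r ?nnegrE//; apply: snd.
  by rewrite (leq_trans _ qj)// -ltnS.
rewrite -(ler_pM2r ap); apply: (le_trans h1); rewrite Yv -va; exact: Zc.
Qed.

(** For a left singular vector [w] of index at least [q], let [S := w^T *m U].  Then
    [s_j ^+ 2 *: S = S *m (G *m G^T) + tau *: S + w^T *m D] with [D] the matrix on the
    right-hand side.  Multiplying by [S^T] and using that [s_j ^+ 2 <= c] gives
    [g * |S| <= |w^T *m D|]; summing the squares over these [w] yields [sin2] on the
    left. *)
Lemma sin2_perturbation p q n (U Uh : 'M[R]_(p, q)) (G : 'M[R]_(q, n))
    (Y Z : 'M[R]_(p, n)) (tau b c g : R) :
  (q <= p)%N -> orthonormal_cols U -> Y = U *m G + Z ->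
  top_left_singular_vectors Y Uh ->
  (forall v : 'cV_p, sqn (Z^T *m v) <= c * sqn v) ->
  (forall v : 'cV_q, b * sqn v <= sqn (G^T *m v)) ->
  0 < g -> g <= tau + b - c ->
  g ^+ 2 * sin2 Uh U <= sqn (Y *m Y^T *m U - U *m (G *m G^T) - tau *: U).
Proof.
move=> qp Uo YE topY Zc Gb g0 gap.
have [W [s [V [svdY UhW]]]] := topY.
have [Wo _ [s0 snd] _ _] := svdY.
set D := _ - _ - _.
pose S (j : 'I_p) : 'rV[R]_q := (col j W)^T *m U.
have rowWT (X : 'M[R]_(p, q)) j : row j (W^T *m X) = (col j W)^T *m X.
  by rewrite row_mul tr_col.
have sUh : sqn (Uh^T *m U) = \sum_(j < p | (j < q)%N) sqn (S j).
  rewrite sqn_rows (big_ord_narrow qp).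
  apply: eq_bigr => k _; rewrite /S row_mul -tr_col.
  by rewrite (UhW k (widen_ord qp k)).
have sU : q%:R = \sum_(j < p) sqn (S j).
  rewrite -(sqn_orthonormal Uo) -(sqn_orthT U Wo) sqn_rows.
  by apply: eq_bigr => j _; rewrite rowWT.
have sE : sin2 Uh U = \sum_(j < p | (q <= j)%N) sqn (S j).
  rewrite /sin2 sUh sU (bigID (fun j : 'I_p => (j < q)%N))/= addrC addrK.
  by apply: eq_bigl => j; rewrite -leqNgt.
have DE : sqn D = \sum_(j < p) sqn ((col j W)^T *m D).
  by rewrite -(sqn_orthT D Wo) sqn_rows; apply: eq_bigr => j _; rewrite rowWT.
rewrite sE DE mulr_sumr [leRHS](bigID (fun j : 'I_p => (q <= j)%N))/=.
rewrite -[leLHS]addr0 lerD// ?sumr_ge0//; last by move=> j _; exact: sqn_ge0.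
apply: ler_sum => j qj.
have sjc : s j ^+ 2 <= c := weyl_tail YE svdY Zc qj.
have eig : (col j W)^T *m (Y *m Y^T) = s j ^+ 2 *: (col j W)^T.
  by have := congr1 trmx (svd_left_eigen j svdY); rewrite linearZ /= !trmx_mul trmxK.
have [Sj0|Sj0] := eqVneq (sqn (S j)) 0; first by rewrite Sj0 mulr0 sqn_ge0.
have Sjp : 0 < sqn (S j) by rewrite lt_def Sj0 sqn_ge0.
have key : s j ^+ 2 * sqn (S j) = sqn (G^T *m (S j)^T) + tau * sqn (S j) +
    ((col j W)^T *m D *m (S j)^T) 0 0.
  have SS : S j *m (S j)^T = (sqn (S j))%:M.
    by rewrite [LHS]mx11_scalar -sqn_tr sqn_trace trmxK /mxtrace big_ord1.
  have GS : S j *m (G *m G^T) *m (S j)^T = (sqn (G^T *m (S j)^T))%:M.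
    by rewrite [LHS]mx11_scalar sqn_trace (trmx_mul G^T) !trmxK /mxtrace big_ord1 !mulmxA.
  have E : (col j W)^T *m D = s j ^+ 2 *: S j - S j *m (G *m G^T) - tau *: S j.
    rewrite /D !mulmxBr -scalemxAr (mulmxA _ U) -/(S j) (mulmxA _ (Y *m Y^T)) eig.
    by rewrite -scalemxAl.
  rewrite E !mulmxBl -!scalemxAl GS SS !mxE eqxx !mulr1n; ring.
have Gj := Gb (S j)^T; rewrite sqn_tr in Gj.
have cs := mx11_cauchy_schwarz ((col j W)^T *m D) (S j)^T; rewrite sqn_tr in cs.
set t := (_ *m (S j)^T) 0 0 in key cs.
have h : g * sqn (S j) <= - t by nra.
have h2 : (g * sqn (S j)) ^+ 2 <= t ^+ 2.
  rewrite -[leRHS]sqrrN lerXn2r ?nnegrE ?mulr_ge0 ?(ltW g0) ?sqn_ge0//.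
  by apply: le_trans h; rewrite mulr_ge0 ?(ltW g0) ?sqn_ge0.
rewrite -(ler_pM2r Sjp) (le_trans _ cs)// (le_trans _ h2)// exprMn.
by rewrite -mulrA -expr2.
Qed.

End perturbation.

(** * Expectations of products of independent variables *)

Section nonneg_integrals.
Context d (T : measurableType d) (R : realType) (mu : {measure set T -> \bar R}).
Local Open Scope ereal_scope.

(** The integral of a nonnegative function is the supremum of the integrals of
    the simple functions below it, which makes it monotone on all nonnegative
    functions.  The risk is majorized in this way, its dependence on the choice of
    the fits being arbitrary. *)
Lemma ge0_le_integral_nonmeasurable (f g : T -> \bar R) :
  (forall x, 0 <= f x) -> (forall x, f x <= g x) ->
  \int[mu]_x f x <= \int[mu]_x g x.
Proof.
move=> f0 fg.
have g0 x : 0 <= g x by exact: le_trans (f0 x) (fg x).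
rewrite !ge0_integralTE//; apply: ereal_sup_le => _ /= [h hf <-].
by exists h => // x; exact: le_trans (hf x) (fg x).
Qed.

End nonneg_integrals.

Section weighted.
Context d1 d2 (Om : measurableType d1) (T : measurableType d2) (R : realType).
Variables (mu : {measure set Om -> \bar R}) (nu : {measure set T -> \bar R}).
Variables (X : Om -> T) (mX : measurable_fun setT X).
Variables (h : Om -> R) (mh : measurable_fun setT h) (h0 : forall w, 0 <= h w).
Variables (c : R) (c0 : 0 <= c).
Hypothesis hE : forall A, measurable A ->
  (\int[mu]_w (\1_A (X w) * h w)%:E = c%:E * nu A)%E.

Let weighted_nnsfun (g : {nnsfun T >-> R}) :
  (\int[mu]_w (g (X w) * h w)%:E = c%:E * \int[nu]_t (g t)%:E)%E.
Proof.
have -> : (\int[mu]_w (g (X w) * h w)%:E = \int[mu]_w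
    \sum_(y \in range g) (y%:E * (\1_(g @^-1` [set y]) (X w) * h w)%:E))%E.
  apply: eq_integral => w _; rewrite (fimfunE g) fsumEFin; last by [].
  congr EFin; rewrite mulrC mulr_fsumr//; apply: eq_fsbigr => y _; ring.
rewrite ge0_integral_fsum//; last 2 first.
- move=> y; apply: emeasurable_funM => //.
  apply/measurable_EFinP/measurable_funM => //.
  by apply: measurableT_comp => //; exact: measurable_indic.
- move=> y w _; case: (ltP y 0%R) => y0; last first.
    by rewrite -EFinM lee_fin !mulr_ge0.
  rewrite preimage_nnfun0// indicE in_set0 mul0r mule0//.
rewrite integralT_nnsfun sintegralE ge0_mule_fsumr; last first.
  exact: nnsfun_mulemu_ge0.
apply: eq_fsbigr => y _.
case: (ltP y 0%R) => y0.
  rewrite preimage_nnfun0// measure0 mule0 mule0.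
  by apply: integral0_eq => w _; rewrite indicE in_set0 mul0r mule0.
rewrite ge0_integralZl//.
- by rewrite hE// muleCA.
- apply/measurable_EFinP/measurable_funM => //.
  by apply: measurableT_comp => //; exact: measurable_indic.
- by move=> w _; rewrite lee_fin mulr_ge0.
Qed.

(** An identity between measures extends from indicators to nonnegative functions
    by monotone convergence.  It serves to replace the factors of a product one at
    a time, and to integrate against a law given by a density. *)
Lemma ge0_integral_weighted (g : T -> R) :
  measurable_fun setT g -> (forall t, 0 <= g t) ->
  (\int[mu]_w (g (X w) * h w)%:E = c%:E * \int[nu]_t (g t)%:E)%E.
Proof.
move=> mg g0.
have mg' : measurable_fun setT (EFin \o g) by exact/measurable_EFinP.
pose gn := nnsfun_approx measurableT mg'.
have gncvg t : (EFin \o gn^~ t) n @[n --> \oo] --> (g t)%:E.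
  by apply: cvg_nnsfun_approx => //= x _; rewrite lee_fin.
have gnnd t m n : (m <= n)%N -> gn m t <= gn n t.
  by move=> mn; exact/lefP/nd_nnsfun_approx.
transitivity (limn (fun n => \int[mu]_w (gn n (X w) * h w)%:E)%E).
  rewrite -monotone_convergence//.
  - apply: eq_integral => w _; apply/esym/cvg_lim => //.
    under eq_fun do rewrite EFinM.
    rewrite EFinM; apply: cvgeZr => //.
    exact: gncvg.
  - move=> n; apply/measurable_EFinP/measurable_funM => //.
    exact: measurableT_comp.
  - by move=> n w _; rewrite lee_fin mulr_ge0.
  - by move=> w _ m n mn; rewrite lee_fin ler_wpM2r// gnnd.
transitivity (limn (fun n => \int[nu]_t (c * gn n t)%:E)%E).
  congr (limn _); apply/funext => n; rewrite weighted_nnsfun.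
  under [RHS]eq_integral do rewrite EFinM.
  rewrite ge0_integralZl//.
  - exact/measurable_EFinP.
  - by move=> t _; rewrite lee_fin.
rewrite -monotone_convergence//.
- rewrite -ge0_integralZl//; last by move=> t _; rewrite lee_fin.
  apply: eq_integral => t _; apply/cvg_lim => //.
  under eq_fun do rewrite EFinM.
  by apply: cvgeZl => //; exact: gncvg.
- by move=> n; apply/measurable_EFinP/measurable_funM.
- by move=> n t _; rewrite lee_fin mulr_ge0.
- by move=> t _ m n mn; rewrite lee_fin ler_wpM2l// gnnd.
Qed.

End weighted.

Section independent_products.
Context dO d (Om : measurableType dO) (T : measurableType d) (R : realType).
Variable P : probability Om R.

Lemma prodr_indic n (A : 'I_n -> set T) (X : 'I_n -> Om -> T) w :
  \prod_(i < n) (\1_(A i) (X i w) : R) =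
  \1_(\bigcap_(i in [set: 'I_n]) (X i @^-1` A i)) w.
Proof.
rewrite indicE; case: (boolP (w \in _)) => [/set_mem wA|].
  by rewrite big1// => i _; rewrite indicE mem_set//; exact: wA.
apply: contraNeq => /prodf_neq0 H; apply/mem_set => i _ /=.
have := H i isT; rewrite indicE; case: (boolP (X i w \in A i)) => //=.
  by rewrite inE.
by rewrite eqxx.
Qed.

(** The definition of independence is the case where all factors are indicators;
    factors are turned into general functions one after the other. *)
Lemma expectation_prod n (X : 'I_n -> {RV P >-> T}) (g : 'I_n -> T -> R)
    (c : 'I_n -> R) :
  mutually_independent X ->
  (forall i, measurable_fun setT (g i)) -> (forall i t, 0 <= g i t) ->
  (forall i, (\int[P]_w (g i (X i w))%:E = (c i)%:E)%E) ->
  (\int[P]_w (\prod_(i < n) g i (X i w))%:E = (\prod_(i < n) c i)%:E)%E.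
Proof.
move=> indX.
have mgX (f : T -> R) i : measurable_fun setT f ->
    measurable_fun setT (fun w => f (X i w)).
  by move=> mf; exact: measurableT_comp.
suff H : forall j, (j <= n)%N -> forall (g : 'I_n -> T -> R) (c : 'I_n -> R),
  (forall i, measurable_fun setT (g i)) -> (forall i t, 0 <= g i t) ->
  (forall i, (\int[P]_w (g i (X i w))%:E = (c i)%:E)%E) ->
  (forall i : 'I_n, (j <= i)%N -> exists2 A, measurable A & g i = \1_A) ->
  (\int[P]_w (\prod_(i < n) g i (X i w))%:E = (\prod_(i < n) c i)%:E)%E.
  move=> mg g0 gc; apply: (H n) => // i; by rewrite leqNgt ltn_ord.
elim=> [_|j IH jn] {}g {}c mg g0 gc gA.
  have /choice[A mA] : forall i, exists A, measurable A /\ g i = \1_A.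
    by move=> i; have [A mA gAE] := gA i isT; exists A.
  under eq_integral => w _.
    have -> : \prod_(i < n) g i (X i w) = \prod_(i < n) \1_(A i) (X i w).
      by apply: eq_bigr => i _; rewrite (mA i).2.
    rewrite (prodr_indic A (fun i => X i : Om -> T)); over.
  have mXA i : measurable (X i @^-1` A i).
    by rewrite -[X in measurable X]setTI; apply: measurable_funP => //; exact: (mA i).1.
  rewrite integral_indic//; last first.
    by apply: fin_bigcap_measurable => //; exact: finite_finset.
  rewrite setIT.
  transitivity (\prod_(i < n) P (X i @^-1` A i))%E; first exact: (indX A (fun i => (mA i).1)).
  rewrite -prodEFin; apply: eq_bigr => i _.
  rewrite -gc (mA i).2 -[X in (\int[_]_w (X w)%:E)%E]/(\1_(X i @^-1` A i) : Om -> R).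
  by rewrite integral_indic// setIT.
pose i0 : 'I_n := Ordinal jn.
have c0 i : 0 <= c i.
  by rewrite -lee_fin -gc; apply: integral_ge0 => w _; rewrite lee_fin.
rewrite (bigD1 i0)//= EFinM muleC.
under eq_integral => w _ do rewrite (bigD1 i0)//=.
rewrite -gc -(@ge0_integral_distribution _ _ _ _ _ _ (X i0) (EFin \o g i0))//;
  [|exact/measurable_EFinP|by move=> y; rewrite lee_fin].
apply: ge0_integral_weighted => //.
- under eq_fun do rewrite -big_filter.
  by apply: measurable_prod => i _; exact: mgX.
- by move=> w; apply: prodr_ge0.
- exact: prodr_ge0.
- move=> A mA.
  pose g' i := if i == i0 then \1_A else g i.
  pose c' i := if i == i0 then fine (P (X i0 @^-1` A)) else c i.
  have mXA : measurable (X i0 @^-1` A).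
    by rewrite -[X in measurable X]setTI; exact: measurable_funP.
  transitivity (\int[P]_w (\prod_(i < n) g' i (X i w))%:E)%E.
    apply: eq_integral => w _; rewrite [in RHS](bigD1 i0)//= /g' eqxx.
    by congr (_ * _)%:E; apply: eq_bigr => i /negbTE ->.
  rewrite (IH (ltnW jn) g' c').
  - rewrite (bigD1 i0)//= {1}/c' eqxx muleC EFinM fineK ?fin_num_measure//.
    by congr (_ * _%:E)%E; apply: eq_bigr => i; rewrite /c' => /negbTE ->.
  - by move=> i; rewrite /g'; case: ifP => // _; exact: measurable_indic.
  - by move=> i t; rewrite /g'; case: ifP.
  - move=> i; rewrite /g' /c'; case: ifP => [/eqP ->|_]; last exact: gc.
    rewrite -[X in (\int[_]_w (X w)%:E)%E]/(\1_(X i0 @^-1` A) : Om -> R).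
    by rewrite integral_indic// setIT fineK// fin_num_measure.
  - move=> i ji; rewrite /g'; case: eqP => [_|/eqP ii0]; first by exists A.
    apply: gA; rewrite ltn_neqAle ji andbT.
    by apply: contra ii0 => /eqP ji'; apply/eqP/val_inj.
Qed.

End independent_products.

Section independent_pair.
Context dO d1 d2 (Om : measurableType dO) (T1 : measurableType d1)
  (T2 : measurableType d2) (R : realType).
Variable P : probability Om R.

(** By independence the joint law is the product of the laws, so Tonelli's theorem
    reduces the bound to frozen values of [X]. *)
Lemma expectation_independent_le (X : Om -> T1) (Z : Om -> T2)
    (h : T1 * T2 -> R) (K : R) :
  measurable_fun setT X -> measurable_fun setT Z -> independent P X Z ->
  measurable_fun setT h -> (forall t, 0 <= h t) ->
  (forall t, (\int[P]_w (h (t, Z w))%:E <= K%:E)%E) ->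
  (\int[P]_w (h (X w, Z w))%:E <= K%:E)%E.
Proof.
move=> mX mZ indXZ mh h0 hK.
pose X' : {mfun Om >-> T1} := HB.pack X (isMeasurableFun.Build _ _ _ _ X mX).
pose Z' : {mfun Om >-> T2} := HB.pack Z (isMeasurableFun.Build _ _ _ _ Z mZ).
have mXZ : measurable_fun setT (fun w => (X w, Z w)) by exact: measurable_fun_pair.
pose XZ : {mfun Om >-> (T1 * T2)%type} :=
  HB.pack (fun w => (X w, Z w)) (isMeasurableFun.Build _ _ _ _ _ mXZ).
pose PX : probability T1 R := distribution P X'.
pose PZ : probability T2 R := distribution P Z'.
pose PXZ : probability (T1 * T2)%type R := distribution P XZ.
have mh' : measurable_fun setT (EFin \o h) by exact/measurable_EFinP.
have h0' t : (0 <= (EFin \o h) t)%E by rewrite lee_fin.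
have -> : (\int[P]_w (h (X w, Z w))%:E = \int[PXZ]_t (h t)%:E)%E.
  by rewrite (@ge0_integral_distribution _ _ _ _ _ _ XZ (EFin \o h)).
have mE (A : set (T1 * T2)) : measurable A -> (PX \x PZ)%E A = PXZ A.
  apply: (@product_measure_unique _ _ _ _ _ PX PZ PXZ) => B C mB mC.
  exact: indXZ.
have -> : (\int[PXZ]_t (h t)%:E = \int[PX \x PZ]_t (h t)%:E)%E.
  by apply: eq_measure_integral => A mA _; apply/esym/mE.
rewrite (@fubini_tonelli1 _ _ _ _ _ _ _ (EFin \o h))//.
apply: (@le_trans _ _ (\int[PX]_t K%:E)%E).
  apply: ge0_le_integral_nonmeasurable => t /=.
    by apply: integral_ge0 => z _; rewrite lee_fin.
  rewrite /fubini_F.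
  rewrite (@ge0_integral_distribution _ _ _ _ _ _ Z' (fun z => (EFin \o h) (t, z)))//.
    exact: hK.
  exact: (measurableT_comp mh' (pair1_measurable t)).
by rewrite (integral_cst PX measurableT) [X in (_ * X)%E](probability_setT PX) mule1.
Qed.

End independent_pair.

Section iid_law_integral.
Context d (T : measurableType d) (R : realType).

Lemma ge0_integral_iid_lawS (mu : probability T R) m (h : m.+1.-tuple T -> R) :
  measurable_fun setT h -> (forall t, 0 <= h t) ->
  (\int[iid_law mu m.+1]_t (h t)%:E =
   \int[mu]_a \int[iid_law mu m]_u (h (consT (a, u)))%:E)%E.
Proof.
move=> mh h0.
have mh' : measurable_fun setT (EFin \o h) by exact/measurable_EFinP.
rewrite /= (@ge0_integral_distribution _ _ _ _ _ _ (@consT _ T m) (EFin \o h))//.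
rewrite (@fubini_tonelli1 _ _ _ _ _ _ _ (EFin \o (h \o @consT _ T m)))//.
  by apply: measurableT_comp => //; apply: measurableT_comp => //; exact: measurable_consT.
by move=> t /=; rewrite lee_fin; exact: h0.
Qed.

End iid_law_integral.

(** * Moment generating functions of Gaussian quadratics *)

Section gaussian_mgf.
Variable R : realType.

(** Value of E exp (al X^2 + be X) for a centred Gaussian X of variance [s]. *)
Definition gauss_mgf (s al be : R) : R :=
  (Num.sqrt (1 - 2 * al * s))^-1 * expR (be ^+ 2 * s / (2 * (1 - 2 * al * s))).

Lemma gauss_mgf_ge0 s al be : 0 <= gauss_mgf s al be.
Proof. by rewrite mulr_ge0 ?invr_ge0 ?expR_ge0. Qed.

Lemma ge0_integral_normal_prob (m s : R) (g : R -> R) :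
  measurable_fun setT g -> (forall t, 0 <= g t) ->
  (\int[real_law (normal_prob m s)]_t (g t)%:E =
   \int[lebesgue_measure]_x (g x * normal_pdf m s x)%:E)%E.
Proof.
move=> mg g0.
have mg' : measurable_fun setT (EFin \o g) by exact/measurable_EFinP.
rewrite (@ge0_integral_distribution _ _ _ _ _ _ (@idR R) (EFin \o g))//.
symmetry; rewrite -[RHS]mul1e.
apply: (@ge0_integral_weighted _ _ _ _ _ lebesgue_measure
  (normal_prob m s) (@idfun (measurableTypeR R))) => //.
- by move=> _ A mA; rewrite setTI.
- exact: measurable_normal_pdf.
- by move=> w; exact: normal_pdf_ge0.
move=> A mA; rewrite mul1e /= /normal_prob [RHS]integral_mkcond.
apply: eq_integral => x _; rewrite patchE indicE.
by case: ifP => _; rewrite ?mul1r ?mul0r.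
Qed.

Lemma measurable_exp_quad (al be : R) :
  measurable_fun setT (fun t : R => expR (al * t ^+ 2 + be * t)).
Proof.
apply: measurableT_comp => //; apply: measurable_funD; apply: measurable_funM => //.
Qed.

Lemma gauss_complete_square (x al be s k : R) : k != 0 -> s != 0 ->
  k = 1 - 2 * al * s ^+ 2 ->
  al * x ^+ 2 + be * x + - (x - 0) ^+ 2 / (s ^+ 2 *+ 2) =
  be ^+ 2 * s ^+ 2 / (2 * k) + - (x - be * s ^+ 2 / k) ^+ 2 / (s ^+ 2 / k *+ 2).
Proof.
move=> k0 s0 kE.
have -> : al = (1 - k) / (2 * s ^+ 2) by rewrite kE; field.
by field; rewrite k0 s0.
Qed.

Lemma gauss_exponent_step (a v al be s k : R) : k != 0 -> k = 1 - 2 * al * s ->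
  (be + 2 * al * (v * a)) ^+ 2 * s / (2 * k) +
    (al * (v * a) ^+ 2 + be * (v * a)) =
  be ^+ 2 * s / (2 * k) + (al * v ^+ 2 / k * a ^+ 2 + be * v / k * a).
Proof.
by move=> k0 kE; field: kE.
Qed.

(** Completing the square turns the integrand into a constant times another
    normal density, of variance [sigma ^+ 2 / k]. *)
Lemma normal_mgf (sigma al be : R) : 0 < sigma -> 0 < 1 - 2 * al * sigma ^+ 2 ->
  (\int[real_law (normal_prob 0 sigma)]_t (expR (al * t ^+ 2 + be * t))%:E =
   (gauss_mgf (sigma ^+ 2) al be)%:E)%E.
Proof.
move=> s0 k0; rewrite ge0_integral_normal_prob//; last exact: measurable_exp_quad.
set k := 1 - _ in k0 *.
pose s' := sigma / Num.sqrt k; pose m' := be * sigma ^+ 2 / k.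
have sk0 : 0 < Num.sqrt k by rewrite sqrtr_gt0.
have s'0 : 0 < s' by rewrite divr_gt0.
have s'2 : s' ^+ 2 = sigma ^+ 2 / k by rewrite expr_div_n sqr_sqrtr// ltW.
have aux (c : R) : sigma ^+ 2 / k * c *+ 2 = sigma ^+ 2 * c *+ 2 / k.
  by ring.
have E x : expR (al * x ^+ 2 + be * x) * normal_pdf 0 sigma x =
    gauss_mgf (sigma ^+ 2) al be * normal_pdf m' s' x.
  rewrite !normal_pdfE ?gt_eqF// /normal_fun /normal_peak s'2.
  rewrite /gauss_mgf -/k mulrCA -expRD.
  have -> : Num.sqrt (sigma ^+ 2 / k * pi *+ 2) =
      Num.sqrt (sigma ^+ 2 * pi *+ 2) / Num.sqrt k.
    rewrite -sqrtrV; last exact: ltW.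
    rewrite -sqrtrM; last by rewrite mulrn_wge0// mulr_ge0 ?sqr_ge0// pi_ge0.
    by rewrite aux.
  have n0 : 0 < Num.sqrt (sigma ^+ 2 * pi *+ 2).
    by rewrite sqrtr_gt0 mulrn_wgt0// mulr_gt0 ?pi_gt0// exprn_gt0.
  have -> : expR (al * x ^+ 2 + be * x + - (x - 0) ^+ 2 / (sigma ^+ 2 *+ 2)) =
     expR (be ^+ 2 * sigma ^+ 2 / (2 * k)) *
     expR (- (x - m') ^+ 2 / (sigma ^+ 2 / k *+ 2)).
    rewrite -expRD; congr expR; apply: gauss_complete_square; rewrite ?gt_eqF//.
  move: (Num.sqrt (sigma ^+ 2 * pi *+ 2)) n0 => c n0.
  by field; rewrite !gt_eqF.
under eq_integral do rewrite E EFinM.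
rewrite ge0_integralZl//=.
- by rewrite integral_normal_pdf mule1.
- by apply/measurable_EFinP; exact: measurable_normal_pdf.
- by move=> x _; rewrite lee_fin normal_pdf_ge0.
- by rewrite lee_fin gauss_mgf_ge0.
Qed.

Definition tdot p (v : 'I_p -> R) (z : p.-tuple R) : R := \sum_(a < p) v a * tnth z a.

Lemma measurable_tdot p (v : 'I_p -> R) : measurable_fun setT (tdot v).
Proof.
apply: measurable_sum => a; apply: measurable_funM => //; exact: measurable_tnth.
Qed.

Lemma measurable_exp_tdot p (v : 'I_p -> R) al be :
  measurable_fun setT (fun z => expR (al * tdot v z ^+ 2 + be * tdot v z)).
Proof.
apply: measurableT_comp => //; apply: measurable_funD => //;
  apply: measurable_funM => //; first apply: measurable_funX.
all: exact: measurable_tdot.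
Qed.

(** The linear form [tdot v] is Gaussian with variance sigma^2 |v|^2.  Rather than
    identifying its law, the formula is proved by induction on the dimension:
    integrating out all coordinates but the first one leaves the exponential of a
    quadratic polynomial in that coordinate. *)
Lemma isotropic_normal_mgf (sigma : R) p (v : 'I_p -> R) al be : 0 < sigma ->
  0 < 1 - 2 * al * (sigma ^+ 2 * \sum_(a < p) v a ^+ 2) ->
  (\int[isotropic_normal sigma p]_z
     (expR (al * tdot v z ^+ 2 + be * tdot v z))%:E =
   (gauss_mgf (sigma ^+ 2 * \sum_(a < p) v a ^+ 2) al be)%:E)%E.
Proof.
move=> s0; elim: p v al be => [|p IH] v al be.
  rewrite big_ord0 mulr0 => _; rewrite integral_dirac//.
    by rewrite /tdot big_ord0 /gauss_mgf diracT !(mulr0, mul0r, subr0, addr0, expr0n, expR0, sqrtr1, invr1, mule1, mulr1).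
  by apply/measurable_EFinP; exact: measurable_exp_tdot.
rewrite big_ord_recl /=.
set v' := fun a : 'I_p => v (lift ord0 a).
have <- : \sum_(a < p) v' a ^+ 2 = \sum_(i < p) v (lift ord0 i) ^+ 2 by [].
set s := sigma ^+ 2 * \sum_(a < p) v' a ^+ 2.
have sge0 : 0 <= s by rewrite mulr_ge0 ?sqr_ge0// sumr_ge0// => i _; exact: sqr_ge0.
rewrite mulrDr -/s; set s1 := sigma ^+ 2 * v ord0 ^+ 2.
have s1ge0 : 0 <= s1 by rewrite mulr_ge0 ?sqr_ge0.
move=> k'0.
have k0 : 0 < 1 - 2 * al * s.
  have [al0|al0] := leP al 0.
    by have := mulr_ge0_le0 sge0 al0; nra.
  by have := mulr_ge0 (ltW al0) s1ge0; nra.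
rewrite ge0_integral_iid_lawS//; last exact: measurable_exp_tdot.
set k := 1 - 2 * al * s in k0 *.
pose al1 := al * v ord0 ^+ 2 / k; pose be1 := be * v ord0 / k.
transitivity (\int[real_law (normal_prob 0 sigma)]_a
  (((Num.sqrt k)^-1 * expR (be ^+ 2 * s / (2 * k)))%:E *
   (expR (al1 * a ^+ 2 + be1 * a))%:E))%E.
  apply: eq_integral => a _.
  have tdotS (u : p.-tuple R) : tdot v (consT (a, u)) = v ord0 * a + tdot v' u.
    rewrite /tdot big_ord_recl /= tnth0; congr (_ + _).
    by apply: eq_bigr => i _; rewrite tnthS.
  set w := v ord0 * a.
  transitivity (\int[isotropic_normal sigma p]_u
     ((expR (al * w ^+ 2 + be * w))%:E *
      (expR (al * tdot v' u ^+ 2 + (be + 2 * al * w) * tdot v' u))%:E))%E.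
    apply: eq_integral => u _; rewrite tdotS -EFinM -expRD; congr (expR _)%:E.
    by rewrite /w; ring.
  rewrite ge0_integralZl//; first last.
    by apply/measurable_EFinP; exact: measurable_exp_tdot.
  rewrite IH// -!EFinM /gauss_mgf -/s -/k mulrCA -expRD; congr EFin; rewrite -[RHS]mulrA -expRD; congr (_ * expR _).
  by rewrite addrC; apply: gauss_exponent_step; rewrite // gt_eqF.
rewrite ge0_integralZl//; first last.
- by apply/measurable_EFinP; exact: measurable_exp_quad.
have k1E : 1 - 2 * al1 * sigma ^+ 2 = (1 - 2 * al * (s1 + s)) / k.
  rewrite /al1 /s1 [in RHS]mulrDr [in RHS]opprD.
  have -> : 1 + (- (2 * al * (sigma ^+ 2 * v ord0 ^+ 2)) - 2 * al * s) = k - 2 * al * (sigma ^+ 2 * v ord0 ^+ 2).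
    by rewrite /k; ring.
  by field; rewrite gt_eqF.
rewrite normal_mgf//; last by rewrite k1E divr_gt0.
rewrite -EFinM /gauss_mgf k1E mulrACA -expRD; congr (_ * expR _)%:E.
  rewrite -invfM -sqrtrM; last exact: ltW.
  by congr (Num.sqrt _)^-1; field; rewrite gt_eqF.
set k' := 1 - _ in k'0 *.
have -> : be ^+ 2 * s / (2 * k) + be1 ^+ 2 * sigma ^+ 2 / (2 * (k' / k)) =
  be ^+ 2 * (s * k' + s1) / (2 * k * k').
  by rewrite /be1 /s1; field; rewrite !gt_eqF.
have -> : s * k' + s1 = k * (s1 + s) by rewrite /k' /k; ring.
by field; rewrite !gt_eqF.
Qed.

End gaussian_mgf.

(** * From exponential to fourth moments *)

Section scalar_bounds.
Variable R : realType.
Implicit Types x y : R.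

Lemma expR_quartic_ge0 y : 0 <= y -> y ^+ 4 <= 4 ^+ 4 * expR y.
Proof.
move=> y0; have -> : expR y = expR (y / 4) ^+ 4.
  by rewrite -expRM_natl; congr expR; field.
have h : y / 4 <= expR (y / 4) by apply: le_trans (expR_ge1Dx _); lra.
have -> : y ^+ 4 = 4 ^+ 4 * (y / 4) ^+ 4 by field.
by rewrite ler_pM2l ?exprn_gt0// lerXn2r// ?nnegrE ?expR_ge0// divr_ge0.
Qed.

Lemma expR_quartic y : y ^+ 4 <= 4 ^+ 4 * (expR y + expR (- y)).
Proof.
have [y0|/ltW y0] := leP 0 y.
  by apply: le_trans (expR_quartic_ge0 y0) _; rewrite ler_pM2l ?exprn_gt0// lerDl expR_ge0.
have -> : y ^+ 4 = (- y) ^+ 4 by ring.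
rewrite -oppr_ge0 in y0; apply: le_trans (expR_quartic_ge0 y0) _.
by rewrite ler_pM2l ?exprn_gt0// lerDr expR_ge0.
Qed.

Lemma expR_le_quadratic y : `|y| <= 1 / 2 -> expR y <= 1 + y + 2 * y ^+ 2.
Proof.
rewrite ler_norml => /andP[y1 y2].
have h : 1 - y <= expR (- y) by exact: expR_ge1Dx.
have h2 : expR y * expR (- y) = 1 by rewrite -expRD subrr expR0.
have e0 := expR_gt0 y.
have h3 : expR y * (1 - y) <= 1 by rewrite -[leRHS]h2 ler_pM2l.
have h4 : 1 <= (1 - y) * (1 + y + 2 * y ^+ 2).
  have -> : (1 - y) * (1 + y + 2 * y ^+ 2) = 1 + y ^+ 2 * (1 - 2 * y) by ring.
  by rewrite lerDl mulr_ge0 ?sqr_ge0//; lra.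
rewrite -(@ler_pM2r _ (1 - y)); last lra.
by rewrite (le_trans h3)// mulrC.
Qed.

(** A form of [- ln (1 - y) <= y + y ^+ 2] without logarithm; for nonnegative [y] the
    bound [1 + u <= expR u] is too weak and is applied to [u / 2]. *)
Lemma expR_log_bound y : `|y| <= 1 / 4 -> 1 <= (1 - y) * expR (y + y ^+ 2).
Proof.
rewrite ler_norml => /andP[y1 y2].
have [y0|/ltW y0] := leP 0 y.
  have -> : expR (y + y ^+ 2) = expR ((y + y ^+ 2) / 2) ^+ 2.
    by rewrite -expRM_natl; congr expR; field.
  have h : 1 + (y + y ^+ 2) / 2 <= expR ((y + y ^+ 2) / 2) by exact: expR_ge1Dx.
  have h2 : (1 + (y + y ^+ 2) / 2) ^+ 2 <= expR ((y + y ^+ 2) / 2) ^+ 2.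
    by rewrite lerXn2r// ?nnegrE ?expR_ge0//; nra.
  have h3 : (1 - y) * (1 + (y + y ^+ 2) / 2) ^+ 2 <=
      (1 - y) * expR ((y + y ^+ 2) / 2) ^+ 2 by rewrite ler_wpM2l//; lra.
  apply: le_trans h3.
  have -> : (1 - y) * (1 + (y + y ^+ 2) / 2) ^+ 2 =
    1 + y ^+ 2 / 4 * ((1 - y) * (1 + y) ^+ 2 - 4 * y) by field.
  rewrite lerDl mulr_ge0 ?divr_ge0 ?sqr_ge0//.
  have -> : (1 - y) * (1 + y) ^+ 2 - 4 * y = 1 - 3 * y - y ^+ 2 - y * y ^+ 2 by ring.
  have : y ^+ 2 <= 1 / 16 by nra.
  by nra.
have h : 1 + (y + y ^+ 2) <= expR (y + y ^+ 2) by exact: expR_ge1Dx.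
have h3 : (1 - y) * (1 + (y + y ^+ 2)) <= (1 - y) * expR (y + y ^+ 2).
  by rewrite ler_wpM2l//; lra.
apply: le_trans h3.
have -> : (1 - y) * (1 + (y + y ^+ 2)) = 1 + (- y) * y ^+ 2 by ring.
by rewrite lerDl mulr_ge0 ?sqr_ge0// oppr_ge0.
Qed.

Lemma invsqrt_bound y : `|y| <= 1 / 4 ->
  (Num.sqrt (1 - y))^-1 <= expR ((y + y ^+ 2) / 2).
Proof.
move=> y1; have h := expR_log_bound y1.
move: y1; rewrite ler_norml => /andP[y1 y2].
have k0 : 0 < 1 - y by lra.
rewrite -[leLHS]mul1r ler_pdivrMr ?sqrtr_gt0//.
rewrite -(@ler_pXn2r _ 2)// ?nnegrE ?mulr_ge0 ?expR_ge0//.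
rewrite expr1n exprMn sqr_sqrtr ?(ltW k0)// -expRM_natl mulrC.
by have -> : (2%:R * ((y + y ^+ 2) / 2)) = y + y ^+ 2 by field.
Qed.

End scalar_bounds.

Section moments.
Context dO (Om : measurableType dO) (R : realType) (P : probability Om R).

(** If X / sqrt n has exponential moments bounded on a neighbourhood of 0, then
    E X^4 is O(n^2): take [s] of order n^(-1/2). *)
Lemma fourth_moment_of_mgf (X : Om -> R) (s K : R) : 0 < s ->
  measurable_fun setT X ->
  (\int[P]_w (expR (s * X w))%:E <= K%:E)%E ->
  (\int[P]_w (expR (- s * X w))%:E <= K%:E)%E ->
  (\int[P]_w (X w ^+ 4)%:E <= (2 * 4 ^+ 4 * K / s ^+ 4)%:E)%E.
Proof.
move=> s0 mX K1 K2.
have me (c : R) : measurable_fun setT (fun w => (expR (c * X w))%:E).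
  apply/measurable_EFinP; apply: measurableT_comp => //.
  exact: measurable_funM.
have c0 : 0 <= 4 ^+ 4 / s ^+ 4 by rewrite divr_ge0// exprn_ge0// ltW.
apply: (@le_trans _ _ (\int[P]_w ((4 ^+ 4 / s ^+ 4)%:E *
   ((expR (s * X w))%:E + (expR (- s * X w))%:E)))%E).
  apply: ge0_le_integral_nonmeasurable => w; first by rewrite lee_fin exprn_even_ge0.
  rewrite -EFinD -EFinM lee_fin -mulrA mulrCA ler_pdivlMl ?exprn_gt0//.
  by rewrite -exprMn (le_trans (expR_quartic _))// mulNr.
rewrite ge0_integralZl//; last 2 first.
- by apply: emeasurable_funD.
- by move=> w _; rewrite -EFinD lee_fin addr_ge0 ?expR_ge0.
rewrite ge0_integralD//.
have -> : 2 * 4 ^+ 4 * K / s ^+ 4 = 4 ^+ 4 / s ^+ 4 * (K + K) by field; rewrite gt_eqF.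
by rewrite [leRHS]EFinM EFinD lee_wpmul2l ?leeD ?lee_fin.
Qed.

Context d (T : measurableType d).

Lemma expectation_prod_le n (X : 'I_n -> {RV P >-> T}) (g : 'I_n -> T -> R)
    (c : R) :
  mutually_independent X ->
  (forall i, measurable_fun setT (g i)) -> (forall i t, 0 <= g i t) ->
  (forall i, (\int[P]_w (g i (X i w))%:E <= c%:E)%E) ->
  (\int[P]_w (\prod_(i < n) g i (X i w))%:E <= (c ^+ n)%:E)%E.
Proof.
move=> indX mg g0 gc.
have i0 i : (0 <= \int[P]_w (g i (X i w))%:E)%E.
  by apply: integral_ge0 => w _; rewrite lee_fin.
pose c' i := fine (\int[P]_w (g i (X i w))%:E)%E.
have cE i : (\int[P]_w (g i (X i w))%:E = (c' i)%:E)%E.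
  by rewrite /c' fineK// ge0_fin_numE// (le_lt_trans (gc i))// ltry.
rewrite (expectation_prod indX mg g0 cE) lee_fin.
rewrite -[in leRHS](card_ord n) -prodr_const; apply: ler_prod => i _.
by rewrite -!lee_fin -cE i0 gc.
Qed.

Lemma ge0_expectation_of_law (X : {RV P >-> T}) (mu : probability T R)
    (g : T -> R) :
  (forall A, measurable A -> distribution P X A = mu A) ->
  measurable_fun setT g -> (forall t, 0 <= g t) ->
  (\int[P]_w (g (X w))%:E = \int[mu]_t (g t)%:E)%E.
Proof.
move=> law mg g0.
rewrite -(@ge0_integral_distribution _ _ _ _ _ _ X (EFin \o g))//.
- by apply: eq_measure_integral => A mA _; exact: law.
- exact/measurable_EFinP.
Qed.

End moments.

(** * Fourth moments of the noise and design statistics *)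

Section noise_statistics.
Context dO (Om : measurableType dO) (R : realType) (P : probability Om R).
Variables (n p : nat) (sigma : R) (sigma_gt0 : 0 < sigma).
Variable z : 'I_n -> {RV P >-> p.-tuple R}.
Hypothesis z_iid : iid_with_law z (isotropic_normal sigma p).

Lemma measurable_tdot_rv (v : 'I_p -> R) i : measurable_fun setT (fun w => tdot v (z i w)).
Proof. by apply: (measurableT_comp (measurable_tdot v)). Qed.

Lemma noise_mgf (v : 'I_p -> R) al be i :
  0 < 1 - 2 * al * (sigma ^+ 2 * \sum_(a < p) v a ^+ 2) ->
  (\int[P]_w (expR (al * tdot v (z i w) ^+ 2 + be * tdot v (z i w)))%:E =
   (gauss_mgf (sigma ^+ 2 * \sum_(a < p) v a ^+ 2) al be)%:E)%E.
Proof.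
move=> k0; rewrite (@ge0_expectation_of_law _ _ _ _ _ _ (z i) _
  (fun t => expR (al * tdot v t ^+ 2 + be * tdot v t)) (z_iid.2 i)) //.
- exact: isotropic_normal_mgf.
- exact: measurable_exp_tdot.
Qed.

(** In law, sigma^2 |v|^2 times a chi-square variable with [n] degrees of freedom. *)
Definition chi_sum (v : 'I_p -> R) w : R := \sum_(i < n) tdot v (z i w) ^+ 2.

Lemma measurable_chi_sum v : measurable_fun setT (chi_sum v).
Proof. by apply: measurable_sum => i; apply: measurable_funX; exact: measurable_tdot_rv. Qed.

(** In the logarithm of the Gaussian factor the linear term in [al] is the mean; the
    quadratic term of the exponent bounds the remainder, by [invsqrt_bound]. *)
Lemma chi_sum_mgf (v : 'I_p -> R) al m :
  `|2 * al * (sigma ^+ 2 * \sum_(a < p) v a ^+ 2)| <= 1 / 4 ->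
  (\int[P]_w (expR (al * (chi_sum v w - n%:R * m)))%:E <=
   (expR (n%:R * (al * (sigma ^+ 2 * \sum_(a < p) v a ^+ 2 - m) +
      2 * (al * (sigma ^+ 2 * \sum_(a < p) v a ^+ 2)) ^+ 2)))%:E)%E.
Proof.
set s := sigma ^+ 2 * _ => als.
have k0 : 0 < 1 - 2 * al * s by move: als; rewrite ler_norml => /andP[_]; lra.
pose g := fun (_ : 'I_n) (t : p.-tuple R) => expR (- al * m + (al * tdot v t ^+ 2 + 0 * tdot v t)).
have -> : (\int[P]_w (expR (al * (chi_sum v w - n%:R * m)))%:E =
    \int[P]_w (\prod_(i < n) g i (z i w))%:E)%E.
  apply: eq_integral => w _; rewrite -expR_sum; congr (expR _)%:E.
  rewrite /chi_sum big_split /= sumr_const card_ord.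
  rewrite mulrBr mulr_sumr addrC; congr (_ + _).
    by apply: eq_bigr => i _; rewrite mul0r addr0.
  by rewrite -[RHS]mulr_natr; ring.
have -> : expR (n%:R * (al * (s - m) + 2 * (al * s) ^+ 2)) =
    expR (al * (s - m) + 2 * (al * s) ^+ 2) ^+ n by rewrite expRM_natl.
apply: expectation_prod_le.
- exact: z_iid.1.
- move=> i; apply: measurableT_comp => //; apply: measurable_funD => //.
  apply: measurable_funD; apply: measurable_funM => //; last exact: measurable_tdot.
  by apply: measurable_funX; exact: measurable_tdot.
- by move=> i t; exact: expR_ge0.
- move=> i; rewrite /g.
  under eq_integral do rewrite expRD EFinM.
  have mE : measurable_fun setT (fun w =>
      (expR (al * tdot v (z i w) ^+ 2 + 0 * tdot v (z i w)))%:E).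
    apply/measurable_EFinP.
    by apply: (measurableT_comp (measurable_exp_tdot v al 0)).
  rewrite ge0_integralZl ?lee_fin ?expR_ge0//.
  rewrite noise_mgf// -/s -EFinM lee_fin /gauss_mgf expr0n /= !mul0r expR0 mulr1.
  apply: (le_trans (ler_wpM2l (expR_ge0 _) (invsqrt_bound als))).
  by rewrite -expRD ler_expR le_eqVlt; apply/orP; left; apply/eqP; field.
Qed.

Lemma sqrt_natr_gt0 : (0 < n)%N -> 0 < Num.sqrt n%:R :> R.
Proof. by move=> n0; rewrite sqrtr_gt0 ltr0n. Qed.

(** The scale [s] is chosen so that [s * sigma ^+ 2 * |v| ^+ 2] is at most
    1 / (8 sqrt n), which keeps the exponent of [chi_sum_mgf] below 1. *)
Lemma chi_sum_fourth_moment (v : 'I_p -> R) : (0 < n)%N ->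
  \sum_(a < p) v a ^+ 2 <= 4 ->
  (\int[P]_w ((chi_sum v w - n%:R * (sigma ^+ 2 * \sum_(a < p) v a ^+ 2)) ^+ 4)%:E
   <= (2 * 4 ^+ 4 * expR 1 * (32 * sigma ^+ 2) ^+ 4 * n%:R ^+ 2)%:E)%E.
Proof.
move=> n0 V4; have sn0 := sqrt_natr_gt0 n0.
set V := \sum_(a < p) _ in V4 *.
have V0 : 0 <= V by apply: sumr_ge0 => a _; exact: sqr_ge0.
have s20 : 0 < sigma ^+ 2 by rewrite exprn_gt0.
pose s := (32 * sigma ^+ 2 * Num.sqrt n%:R)^-1.
have s0 : 0 < s by rewrite invr_gt0 !mulr_gt0.
have sn2 : Num.sqrt (n%:R : R) ^+ 2 = n%:R by rewrite sqr_sqrtr.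
have sn1 : 1 <= Num.sqrt (n%:R : R) by rewrite -[leLHS]sqrtr1 ler_sqrt// ler1n.
have ssV : s * (sigma ^+ 2 * V) <= (8 * Num.sqrt n%:R)^-1.
  have -> : s * (sigma ^+ 2 * V) = V / 32 * (Num.sqrt n%:R)^-1.
    by rewrite /s; field; rewrite !gt_eqF.
  have -> : (8 * Num.sqrt n%:R)^-1 = 8^-1 * (Num.sqrt n%:R)^-1 :> R.
    by rewrite invfM.
  by rewrite ler_wpM2r ?invr_ge0 ?(ltW sn0)//; lra.
have ssV0 : 0 <= s * (sigma ^+ 2 * V) by rewrite mulr_ge0 ?(ltW s0)// mulr_ge0 ?(ltW s20).
have ssV1 : s * (sigma ^+ 2 * V) <= 1 / 8.
  by apply: le_trans ssV _; rewrite mul1r lef_pV2 ?posrE ?mulr_gt0// ler_peMr.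
have ssV2 : n%:R * (2 * (s * (sigma ^+ 2 * V)) ^+ 2) <= 1.
  have : (s * (sigma ^+ 2 * V)) ^+ 2 <= ((8 * Num.sqrt n%:R)^-1) ^+ 2.
    by rewrite lerXn2r ?nnegrE// invr_ge0 mulr_ge0.
  have -> : ((8 * Num.sqrt n%:R)^-1) ^+ 2 = (8 ^+ 2 * n%:R)^-1 :> R.
    by rewrite exprVn exprMn sn2.
  move=> h.
  rewrite mulrCA (@le_trans _ _ (2 * (n%:R * (8 ^+ 2 * n%:R)^-1)))//.
    by rewrite ler_wpM2l// ler_wpM2l.
  have -> : n%:R * (8 ^+ 2 * n%:R)^-1 = (8 ^+ 2)^-1 :> R by field; rewrite gt_eqF// ltr0n.
  lra.
have K (e : R) : e = s \/ e = - s ->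
  (\int[P]_w (expR (e * (chi_sum v w - n%:R * (sigma ^+ 2 * V))))%:E <= (expR 1)%:E)%E.
  move=> es.
  have eE : (e * (sigma ^+ 2 * V)) ^+ 2 = (s * (sigma ^+ 2 * V)) ^+ 2.
    by case: es => -> //; ring.
  have eN : `|e * (sigma ^+ 2 * V)| <= 1 / 8.
    case: es => ->; first by rewrite ger0_norm.
    by rewrite mulNr normrN ger0_norm.
  apply: le_trans (chi_sum_mgf _ _) _.
    by rewrite -mulrA normrM ger0_norm//; move: eN; rewrite -/V; lra.
  by rewrite lee_fin ler_expR -/V subrr mulr0 add0r eE.
have -> : 2 * 4 ^+ 4 * expR 1 * (32 * sigma ^+ 2) ^+ 4 * n%:R ^+ 2 =
    2 * 4 ^+ 4 * expR 1 / s ^+ 4.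
  rewrite -[in LHS]sn2 /s; field.
  by rewrite !gt_eqF.
apply: fourth_moment_of_mgf => //.
- by apply: measurable_funB => //; exact: measurable_chi_sum.
- by apply: K; left.
- by apply: K; right.
Qed.

End noise_statistics.

Section design_statistics.
Context dO (Om : measurableType dO) (R : realType) (P : probability Om R).

Lemma measurable_joint d (T : measurableType d) n (X : 'I_n -> {RV P >-> T}) :
  measurable_fun setT (joint X).
Proof.
apply/measurable_fun_tnthP => i.
rewrite (_ : _ \o _ = X i); first exact: measurable_funP.
by apply/funext => w /=; rewrite tnth_mktuple.
Qed.

Lemma measurable_unit_cube d : measurable (@unit_cube R d).
Proof.
have -> : @unit_cube R d =
    \bigcap_(j in [set: 'I_d]) ((@tnth d R ^~ j) @^-1` `[0, 1]%classic).
  by apply/seteqP; split => t /= H j => [_|]; have := H j; rewrite /= in_itv/=; apply.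
apply: fin_bigcap_measurable => [|j _]; first exact: finite_finset.
by rewrite -[X in measurable X]setTI; apply: measurable_tnth.
Qed.

Variables (n d : nat) (x : 'I_n -> {RV P >-> d.-tuple R}).
Hypothesis x_cube : forall i w, unit_cube (x i w).

Section cross.
Variables (p : nat) (sigma : R) (sigma_gt0 : 0 < sigma).
Variable z : 'I_n -> {RV P >-> p.-tuple R}.
Hypothesis z_iid : iid_with_law z (isotropic_normal sigma p).
Hypothesis xz_indep : independent P (joint x) (joint z).
Variables (g : d.-tuple R -> R) (B : R).
Hypothesis mg : measurable_fun setT g.
Hypothesis gB : forall t, unit_cube t -> `|g t| <= B.

Definition cross_sum (v : 'I_p -> R) w : R :=
  \sum_(i < n) g (x i w) * tdot v (z i w).

Lemma measurable_cross_sum v : measurable_fun setT (cross_sum v).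
Proof.
apply: measurable_sum => i; apply: measurable_funM.
  by apply: (measurableT_comp mg).
exact: measurable_tdot_rv.
Qed.

(** For frozen design points the sum is a linear form in the Gaussian noise.  As [g]
    is bounded on the cube only, it is first replaced by 0 outside the cube. *)
Lemma cross_sum_mgf (v : 'I_p -> R) s :
  (\int[P]_w (expR (s * cross_sum v w))%:E <=
   (expR (n%:R * (s ^+ 2 * B ^+ 2 * (sigma ^+ 2 * \sum_(a < p) v a ^+ 2) / 2)))%:E)%E.
Proof.
set V := sigma ^+ 2 * _.
have V0 : 0 <= V.
  by rewrite mulr_ge0 ?sqr_ge0// sumr_ge0// => a _; exact: sqr_ge0.
pose g' t := g t * \1_(@unit_cube R d) t.
have mg' : measurable_fun setT g'.
  by apply: measurable_funM => //; apply: measurable_indic; exact: measurable_unit_cube.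
have g'2 t : g' t ^+ 2 <= B ^+ 2.
  rewrite /g' indicE; case: (boolP (t \in _)) => [/set_mem tc|_]; last first.
    by rewrite mulr0 expr0n/= sqr_ge0.
  have := gB tc => gB'; rewrite mulr1 -real_normK ?num_real//.
  by rewrite lerXn2r ?nnegrE// (le_trans _ gB').
pose h (tu : n.-tuple (d.-tuple R) * n.-tuple (p.-tuple R)) : R :=
  \prod_(i < n) expR (s * (g' (tnth tu.1 i) * tdot v (tnth tu.2 i))).
have -> : (\int[P]_w (expR (s * cross_sum v w))%:E =
           \int[P]_w (h (joint x w, joint z w))%:E)%E.
  apply: eq_integral => w _; rewrite /h -expR_sum mulr_sumr; congr (expR _)%:E.
  apply: eq_bigr => i _; rewrite /= !tnth_mktuple /g' indicE mem_set ?mulr1//.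
apply: expectation_independent_le => //.
- exact: measurable_joint.
- exact: measurable_joint.
- apply: measurable_prod => i _; apply: measurableT_comp => //.
  apply: measurable_funM => //; apply: measurable_funM.
    apply: (measurableT_comp mg').
    by apply: (measurableT_comp (@measurable_tnth _ _ n i)).
  apply: (measurableT_comp (measurable_tdot v)).
  by apply: (measurableT_comp (@measurable_tnth _ _ n i)).
- by move=> t; apply: prodr_ge0 => i _; exact: expR_ge0.
move=> t.
rewrite expRM_natl.
pose gg := fun (i : 'I_n) u => expR (0 * tdot v u ^+ 2 + (s * g' (tnth t i)) * tdot v u).
have -> : (\int[P]_w (h (t, joint z w))%:E = \int[P]_w (\prod_(i < n) gg i (z i w))%:E)%E.
  apply: eq_integral => w _; congr EFin; apply: eq_bigr => i _.
  by rewrite /gg mul0r add0r /= tnth_mktuple mulrA.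
apply: expectation_prod_le.
- exact: z_iid.1.
- by move=> i; exact: measurable_exp_tdot.
- by move=> i u; exact: expR_ge0.
- move=> i; rewrite (noise_mgf sigma_gt0 z_iid); last by rewrite mulr0 mul0r subr0.
  rewrite lee_fin /gauss_mgf mulr0 mul0r subr0 sqrtr1 invr1 mul1r mulr1 ler_expR -/V.
  rewrite ler_wpM2r ?invr_ge0// ler_wpM2r// exprMn ler_wpM2l ?sqr_ge0//.
Qed.

Lemma cross_sum_fourth_moment (v : 'I_p -> R) : (0 < n)%N ->
  \sum_(a < p) v a ^+ 2 <= 1 ->
  (\int[P]_w (cross_sum v w ^+ 4)%:E
   <= (2 * 4 ^+ 4 * expR (B ^+ 2 * sigma ^+ 2) * n%:R ^+ 2)%:E)%E.
Proof.
move=> n0 V1; have sn0 := sqrt_natr_gt0 R n0.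
have sn2 : Num.sqrt (n%:R : R) ^+ 2 = n%:R by rewrite sqr_sqrtr.
pose s := (Num.sqrt (n%:R : R))^-1.
have K (e : R) : e ^+ 2 = s ^+ 2 ->
    (\int[P]_w (expR (e * cross_sum v w))%:E <= (expR (B ^+ 2 * sigma ^+ 2))%:E)%E.
  move=> es; apply: le_trans (cross_sum_mgf _ _) _.
  rewrite lee_fin ler_expR es exprVn sn2.
  set V := \sum_(a < p) _ in V1 *.
  have -> : n%:R * (n%:R^-1 * B ^+ 2 * (sigma ^+ 2 * V) / 2) =
      B ^+ 2 * sigma ^+ 2 * (V / 2) by field; rewrite gt_eqF ?ltr0n.
  by rewrite ler_piMr ?(mulr_ge0 (sqr_ge0 _) (sqr_ge0 _))//; lra.
have -> : 2 * 4 ^+ 4 * expR (B ^+ 2 * sigma ^+ 2) * n%:R ^+ 2 =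
    2 * 4 ^+ 4 * expR (B ^+ 2 * sigma ^+ 2) / s ^+ 4.
  rewrite -[in LHS]sn2 /s; field.
  by rewrite !gt_eqF.
apply: fourth_moment_of_mgf => //.
- by rewrite invr_gt0.
- exact: measurable_cross_sum.
- exact: K.
- by apply: K; rewrite sqrrN.
Qed.

End cross.

Section centered.
Hypothesis x_iid : iid_with_law x (uniform_cube R d).
Variables (xi : d.-tuple R -> R) (M : R).
Hypothesis mxi : measurable_fun setT xi.
Hypothesis xiM : forall t, unit_cube t -> `|xi t| <= M.
Hypothesis xi0 : (\int[uniform_cube R d]_t (xi t)%:E = 0)%E.

Definition design_sum w : R := \sum_(i < n) xi (x i w).

Lemma measurable_design_sum : measurable_fun setT design_sum.
Proof. by apply: measurable_sum => i; apply: (measurableT_comp mxi). Qed.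

Lemma integrable_design i : P.-integrable setT (fun w => (xi (x i w))%:E).
Proof.
have mxx : measurable_fun setT (fun w => xi (x i w)).
  exact: (measurableT_comp mxi).
apply: (@le_integrable _ _ _ _ _ _ _ (fun=> M%:E)) => //.
- exact/measurable_EFinP.
- by move=> w _; rewrite lee_fin; apply: (le_trans (xiM (x_cube i w))); exact: ler_norm.
- by apply: finite_measure_integrable_cst.
Qed.

Lemma integral_design i : (\int[P]_w (xi (x i w))%:E = 0)%E.
Proof.
rewrite -(@integral_distribution _ _ _ _ _ _ (x i) (EFin \o xi)).
- rewrite -[RHS]xi0; apply: eq_measure_integral => A mA _; exact: x_iid.2.
- exact/measurable_EFinP.
- exact: integrable_design.
Qed.

(** Since [xi] has mean zero, the linear term of the quadratic upper bound of the
    exponential disappears. *)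
Lemma design_mgf i s : `|s| * M <= 1 / 2 ->
  (\int[P]_w (expR (s * xi (x i w)))%:E <= (expR (2 * (s * M) ^+ 2))%:E)%E.
Proof.
move=> sM.
apply: (@le_trans _ _ (\int[P]_w ((1 + 2 * (s * M) ^+ 2)%:E + s%:E * (xi (x i w))%:E))%E).
  apply: ge0_le_integral_nonmeasurable => w; first by rewrite lee_fin expR_ge0.
  have xM := xiM (x_cube i w).
  have sx : `|s * xi (x i w)| <= `|s| * M by rewrite normrM ler_wpM2l.
  rewrite lee_fin (le_trans (expR_le_quadratic (le_trans sx sM)))//.
  have : (s * xi (x i w)) ^+ 2 <= (s * M) ^+ 2.
    rewrite -[leLHS]real_normK ?num_real// -[leRHS]real_normK ?num_real//.
    rewrite lerXn2r ?nnegrE// (le_trans sx)// normrM ler_wpM2l// ler_norm//.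
  by lra.
rewrite integralD//.
- rewrite integralZl//; last exact: integrable_design.
  rewrite integral_design mule0 adde0.
  rewrite (integral_cst P measurableT) [X in (_ * X)%E](probability_setT P) mule1.
  by rewrite lee_fin expR_ge1Dx.
- by apply: finite_measure_integrable_cst.
- by apply: integrableZl => //; exact: integrable_design.
Qed.

Lemma design_sum_fourth_moment : (0 < n)%N ->
  (\int[P]_w (design_sum w ^+ 4)%:E
   <= (2 * 4 ^+ 4 * expR 1 * (2 * (`|M| + 1)) ^+ 4 * n%:R ^+ 2)%:E)%E.
Proof.
move=> n0; have sn0 := sqrt_natr_gt0 R n0.
have sn2 : Num.sqrt (n%:R : R) ^+ 2 = n%:R by rewrite sqr_sqrtr.
have sn1 : 1 <= Num.sqrt (n%:R : R) by rewrite -[leLHS]sqrtr1 ler_sqrt// ler1n.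
have M1 : 0 < `|M| + 1 by rewrite ltr_wpDl.
pose s := (2 * (`|M| + 1) * Num.sqrt (n%:R : R))^-1.
have s0 : 0 < s by rewrite invr_gt0 !mulr_gt0.
have sM : s * `|M| <= (2 * Num.sqrt n%:R)^-1.
  have -> : s * `|M| = `|M| / (`|M| + 1) * (2 * Num.sqrt n%:R)^-1.
    by rewrite /s; field; rewrite !gt_eqF.
  rewrite ler_piMl ?invr_ge0 ?mulr_ge0 ?(ltW sn0)// ler_pdivrMr// mul1r.
  by rewrite lerDl.
have sM1 : s * `|M| <= 1 / 2.
  by apply: le_trans sM _; rewrite mul1r lef_pV2 ?posrE ?mulr_gt0// ler_peMr.
have sM2 : n%:R * (2 * (s * M) ^+ 2) <= 1.
  have : (s * `|M|) ^+ 2 <= ((2 * Num.sqrt n%:R)^-1) ^+ 2.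
    by rewrite lerXn2r ?nnegrE// ?invr_ge0 mulr_ge0// ltW.
  have -> : ((2 * Num.sqrt n%:R)^-1) ^+ 2 = (2 ^+ 2 * n%:R)^-1 :> R.
    by rewrite exprVn exprMn sn2.
  rewrite exprMn real_normK ?num_real// -exprMn => h.
  rewrite mulrCA (@le_trans _ _ (2 * (n%:R * (2 ^+ 2 * n%:R)^-1)))//.
    by rewrite ler_wpM2l// ler_wpM2l.
  have -> : n%:R * (2 ^+ 2 * n%:R)^-1 = (2 ^+ 2)^-1 :> R by field; rewrite gt_eqF// ltr0n.
  lra.
have K (e : R) : e = s \/ e = - s ->
    (\int[P]_w (expR (e * design_sum w))%:E <= (expR 1)%:E)%E.
  move=> es.
  have eM : `|e| * M <= 1 / 2.
    have -> : `|e| = s by case: es => ->; rewrite ?normrN ger0_norm ?(ltW s0).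
    by apply: le_trans sM1; rewrite ler_wpM2l ?(ltW s0)// ler_norm.
  have e2 : (e * M) ^+ 2 = (s * M) ^+ 2 by case: es => -> //; ring.
  apply: (@le_trans _ _ (expR (2 * (e * M) ^+ 2) ^+ n)%:E).
    under eq_integral => w _.
      rewrite mulr_sumr expR_sum; over.
    apply: (@expectation_prod_le _ _ _ _ _ _ n x (fun _ t => expR (e * xi t))).
    - exact: x_iid.1.
    - by move=> i; apply: measurableT_comp => //; apply: measurable_funM.
    - by move=> i t; exact: expR_ge0.
    - by move=> i; exact: design_mgf.
  by rewrite lee_fin -expRM_natl ler_expR e2.
have -> : 2 * 4 ^+ 4 * expR 1 * (2 * (`|M| + 1)) ^+ 4 * n%:R ^+ 2 =
    2 * 4 ^+ 4 * expR 1 / s ^+ 4.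
  rewrite -[in LHS]sn2 /s; field.
  by rewrite !gt_eqF.
apply: fourth_moment_of_mgf => //.
- exact: measurable_design_sum.
- by apply: K; left.
- by apply: K; right.
Qed.

End centered.
End design_statistics.

(** * Grid bound for the norm of the noise *)

Section grid.
Variable R : realType.

(** Point of the lattice of mesh [h] whose coordinates are indexed by
    0, ..., 2K, with K standing for the coordinate 0. *)
Definition grid_pt (h : R) K p (k : {ffun 'I_p -> 'I_(K + K.+1)}) (a : 'I_p) : R :=
  h * ((k a)%:R - K%:R).

Definition in_grid h K p (k : {ffun 'I_p -> 'I_(K + K.+1)}) : bool :=
  \sum_a grid_pt h k a ^+ 2 <= 1.

Definition grid_const (e : R) : R := expR 1 * (2 / (1 - expR (- e ^+ 2))).

Lemma expRN_sqr_lt1 (e : R) : 0 < e -> expR (- e ^+ 2) < 1.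
Proof. by move=> e0; rewrite -expR0 ltr_expR oppr_lt0 exprn_gt0. Qed.

Lemma grid_const_ge1 (e : R) : 0 < e -> 1 <= grid_const e.
Proof.
move=> e0; rewrite -[leLHS]mulr1 ler_pM//.
  by rewrite -[leLHS]expR0 ler_expR.
have r1 := expRN_sqr_lt1 e0; have r0 := expR_ge0 (- e ^+ 2).
by rewrite ler_pdivlMr ?subr_gt0// mul1r; lra.
Qed.

Lemma sum_geometric_le (r : R) m : 0 <= r < 1 -> \sum_(i < m) r ^+ i <= (1 - r)^-1.
Proof.
move=> /andP[r0 r1]; have d0 : 0 < 1 - r by rewrite subr_gt0.
rewrite -[leRHS]mul1r ler_pdivlMr//.
have -> : (\sum_(i < m) r ^+ i) * (1 - r) = 1 - r ^+ m.
  have := subrX1 r m; set X := \sum_(i < m) _ => h.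
  have -> : X * (1 - r) = - ((r - 1) * X) by ring.
  by rewrite -h opprB.
by rewrite gerBl exprn_ge0.
Qed.

(** As j^2 >= |j|, each half of the sum is dominated by a geometric series. *)
Lemma sum_gaussian_lattice_le (e : R) K : 0 < e ->
  \sum_(j < K + K.+1) expR (- (e ^+ 2 * (j%:R - K%:R) ^+ 2)) <=
  2 / (1 - expR (- e ^+ 2)).
Proof.
move=> e0; set r := expR (- e ^+ 2).
have r1 : 0 <= r < 1 by rewrite expR_ge0 expRN_sqr_lt1.
have rm (m : nat) : expR (- (e ^+ 2 * m%:R ^+ 2)) <= r ^+ m.
  rewrite /r -expRM_natl ler_expR mulrN lerN2 mulrC ler_wpM2l ?sqr_ge0//.
  by rewrite -natrX ler_nat; case: m => // m; rewrite expnS expn1 leq_pmulr.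
rewrite big_split_ord /= mulr_natl mulr2n; apply: lerD.
  apply: le_trans (sum_geometric_le K.+1 r1).
  rewrite big_ord_recr /= -[leLHS]addr0 lerD ?exprn_ge0 ?expR_ge0//.
  rewrite (reindex_inj rev_ord_inj)/=.
  rewrite [leRHS](_ : _ = \sum_(i < K) r ^+ i)//.
  apply: (@le_trans _ _ (\sum_(i < K) r ^+ i.+1)).
    apply: ler_sum => i _; apply: le_trans (rm i.+1).
    rewrite natrB ?ltn_ord//.
    by have -> : (K%:R - i.+1%:R - K%:R : R) ^+ 2 = i.+1%:R ^+ 2 by ring.
  apply: ler_sum => i _; rewrite exprS ler_piMl ?exprn_ge0//; by case/andP: r1 => ? /ltW.
apply: le_trans (sum_geometric_le K.+1 r1).
apply: ler_sum => i _; apply: le_trans (rm i).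
by rewrite natrD addrAC subrr add0r.
Qed.

(** Exponential Markov inequality for the counting measure: a point of norm at most
    1 has [expR (p * (1 - |v| ^+ 2)) >= 1], and for the mesh [e / sqrt p] the sum of
    these weights over the lattice is a [p]-th power. *)
Lemma grid_count_le (e : R) K p : 0 < e ->
  \sum_(k : {ffun 'I_p -> 'I_(K + K.+1)}) (in_grid (e / Num.sqrt p%:R) k)%:R
  <= grid_const e ^+ p.
Proof.
move=> e0; set h := e / _.
apply: (@le_trans _ _ (\sum_(k : {ffun 'I_p -> 'I_(K + K.+1)})
   \prod_(a < p) (expR 1 * expR (- (e ^+ 2 * ((k a)%:R - K%:R) ^+ 2))))).
  apply: ler_sum => k _.
  have -> : \prod_(a < p) (expR 1 * expR (- (e ^+ 2 * ((k a)%:R - K%:R) ^+ 2))) =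
      expR (p%:R * (1 - \sum_a grid_pt h k a ^+ 2)).
    under eq_bigr do rewrite -expRD.
    rewrite -expR_sum; congr expR.
    rewrite big_split /= sumr_const card_ord mulrBr mulr1; congr (_ + _).
    rewrite sumrN mulr_sumr; congr (- _); apply: eq_bigr => a _.
    have p0 : (0 < p)%N := leq_ltn_trans (leq0n a) (ltn_ord a).
    rewrite /grid_pt /h exprMn expr_div_n sqr_sqrtr//.
    by field; rewrite gt_eqF// ltr0n.
  rewrite /in_grid; have [H|_] := leP (\sum_a grid_pt h k a ^+ 2) 1; last by rewrite expR_ge0.
  by rewrite -[leLHS]expR0 ler_expR mulr_ge0// subr_ge0.
rewrite -(bigA_distr_bigA (fun (a : 'I_p) (j : 'I_(K + K.+1)) =>
  expR 1 * expR (- (e ^+ 2 * (j%:R - K%:R) ^+ 2)))) /=.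
rewrite prodr_const card_ord lerXn2r ?nnegrE//.
- by apply: sumr_ge0 => j _; rewrite mulr_ge0 ?expR_ge0.
- by rewrite (le_trans ler01) ?grid_const_ge1.
- by rewrite -mulr_sumr ler_wpM2l ?expR_ge0// sum_gaussian_lattice_le.
Qed.

(** Rounding toward 0 does not increase the norm, so the approximation of a vector of
    the unit ball stays in the unit ball. *)
Lemma round_toward_zero (h u : R) K : 0 < h -> h^-1 <= K%:R -> `|u| <= 1 ->
  exists j : 'I_(K + K.+1), `|u - h * (j%:R - K%:R)| <= h /\
    (h * (j%:R - K%:R)) ^+ 2 <= u ^+ 2.
Proof.
move=> h0 hK u1; pose m := Num.truncn (`|u| / h).
have uh0 : 0 <= `|u| / h by rewrite divr_ge0// ltW.
have /andP[m1 m2] := truncn_itv uh0; rewrite -/m in m1 m2.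
have mK : (m <= K)%N.
  rewrite -(ler_nat R) (le_trans m1)// (le_trans _ hK)//.
  by rewrite ler_pdivrMr// mulVf ?gt_eqF.
rewrite ler_pdivlMr// in m1; rewrite ltr_pdivrMr// in m2.
have hm : h * m%:R <= `|u| by rewrite mulrC.
have hm0 : 0 <= h * m%:R by rewrite mulr_ge0// ltW.
have hm2 : `|u| - h * m%:R <= h by rewrite -natr1 in m2; lra.
have sq : (h * m%:R) ^+ 2 <= u ^+ 2.
  by rewrite -[leRHS]real_normK ?num_real// lerXn2r ?nnegrE.
have [u0|u0] := leP 0 u.
  have j1 : (K + m < K + K.+1)%N by rewrite ltn_add2l ltnS.
  exists (Ordinal j1); rewrite /= natrD addrAC subrr add0r; split=> //.
  by rewrite ger0_norm; move: hm2 hm; rewrite ger0_norm//; lra.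
have j1 : (K - m < K + K.+1)%N by rewrite (leq_ltn_trans (leq_subr _ _))// addnS ltnS leq_addr.
exists (Ordinal j1); rewrite /= natrB// addrAC subrr add0r mulrN sqrrN; split=> //.
rewrite ltr0_norm// in hm hm2.
by rewrite opprK ler_norml; apply/andP; split; lra.
Qed.

Lemma grid_dense (e : R) K p (u : 'I_p -> R) : (0 < p)%N -> 0 < e ->
  Num.sqrt p%:R / e <= K%:R -> \sum_a u a ^+ 2 <= 1 ->
  exists k : {ffun 'I_p -> 'I_(K + K.+1)}, in_grid (e / Num.sqrt p%:R) k /\
    \sum_a (u a - grid_pt (e / Num.sqrt p%:R) k a) ^+ 2 <= e ^+ 2.
Proof.
move=> p0 e0 hK u1; set h := e / _.
have sp0 : 0 < Num.sqrt (p%:R : R) by rewrite sqrtr_gt0 ltr0n.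
have h0 : 0 < h by rewrite divr_gt0.
have hK' : h^-1 <= K%:R by rewrite /h invf_div.
have ua a : `|u a| <= 1.
  rewrite -(@ler_pXn2r _ 2) ?nnegrE// real_normK ?num_real// expr1n.
  by rewrite (le_trans _ u1)// (bigD1 a)//= lerDl sumr_ge0// => b _; exact: sqr_ge0.
have /fin_all_exists[k kP] := fun a => round_toward_zero h0 hK' (ua a).
exists [ffun a => k a]; split.
  rewrite /in_grid (le_trans _ u1)//; apply: ler_sum => a _.
  by rewrite /grid_pt ffunE; exact: (kP a).2.
apply: (@le_trans _ _ (\sum_(a < p) h ^+ 2)).
  apply: ler_sum => a _; rewrite /grid_pt ffunE.
  rewrite -[leLHS]real_normK ?num_real// lerXn2r ?nnegrE ?(ltW h0)//.
  exact: (kP a).1.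
rewrite sumr_const card_ord /h expr_div_n sqr_sqrtr// -[leLHS]mulr_natr divfK//.
by rewrite gt_eqF// ltr0n.
Qed.

(** Writing [u = w + (u - w)] with [w] in the grid shows that the norm N of [A]
    satisfies N <= sqrt t + e N. *)
Lemma grid_spectral_bound (e : R) K p n (A : 'M[R]_(n, p)) t : (0 < p)%N -> 0 < e -> e < 1 ->
  Num.sqrt p%:R / e <= K%:R -> 0 <= t ->
  (forall k : {ffun 'I_p -> 'I_(K + K.+1)}, in_grid (e / Num.sqrt p%:R) k ->
     sqn (A *m \col_a grid_pt (e / Num.sqrt p%:R) k a) <= t) ->
  forall v : 'cV_p, sqn (A *m v) <= t / (1 - e) ^+ 2 * sqn v.
Proof.
move=> p0 e0 e1 hK t0 H v.
have d0 : 0 < 1 - e by rewrite subr_gt0.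
have -> : t / (1 - e) ^+ 2 = (Num.sqrt t / (1 - e)) ^+ 2.
  by rewrite expr_div_n sqr_sqrtr.
apply: sqn_mul_spectral.
rewrite ler_pdivlMr// mulrBr mulr1 lerBlDr.
have N0 := spectral_norm_ge0 A.
apply: spectral_norm_le => u u1.
have u1' : \sum_a u a 0 ^+ 2 <= 1 by rewrite -sqn_cV; move: u1; rewrite enorm_le// expr1n.
have [k [kg ku]] := grid_dense p0 e0 hK u1'.
set w := \col_a grid_pt (e / Num.sqrt p%:R) k a.
have -> : u = w + (u - w) by rewrite addrC subrK.
rewrite mulmxDr (le_trans (enormD _ _))// lerD//.
  by rewrite enorm_sqn ler_wsqrtr// H.
rewrite (le_trans (spectral_norm_ub _ _))// ler_wpM2l// enorm_le ?(ltW e0)//.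
rewrite sqn_cV (le_trans _ ku)//; apply: ler_sum => a _.
by rewrite !mxE.
Qed.

End grid.

Section noise_net.
Context dO (Om : measurableType dO) (R : realType) (P : probability Om R).
Variables (n p : nat) (sigma : R) (sigma_gt0 : 0 < sigma).
Variable z : 'I_n -> {RV P >-> p.-tuple R}.

Lemma sqn_noise (v : 'I_p -> R) w :
  sqn ((noise z w)^T *m \col_a v a) = chi_sum z v w.
Proof.
rewrite sqn_cV /chi_sum; apply: eq_bigr => i _; congr (_ ^+ 2).
by rewrite mxE; apply: eq_bigr => a _; rewrite !mxE mulrC.
Qed.

(** Union bound in exponential form: the sum runs over the grid points of the unit
    ball and, for [0 < al], a term is at least 1 when [n * m <= chi_sum] in its
    direction. *)
Definition net_sum (e al m : R) (w : Om) : R :=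
  let K := (Num.truncn (Num.sqrt p%:R / e)).+1 in
  \sum_(k : {ffun 'I_p -> 'I_(K + K.+1)})
    (in_grid (e / Num.sqrt p%:R) k)%:R *
    expR (al * (chi_sum z (grid_pt (e / Num.sqrt p%:R) k) w - n%:R * m)).

Lemma net_sum_ge0 e al m w : 0 <= net_sum e al m w.
Proof. by apply: sumr_ge0 => k _; rewrite mulr_ge0 ?expR_ge0. Qed.

Lemma measurable_net_sum e al m : measurable_fun setT (net_sum e al m).
Proof.
apply: measurable_sum => k; apply: measurable_funM => //.
apply: measurableT_comp => //; apply: measurable_funM => //.
by apply: measurable_funB => //; exact: measurable_chi_sum.
Qed.

(** Each deviation [al * (chi_sum - n * m)] is below its exponential, hence below
    [net_sum]. *)
Lemma noise_norm_le e al m w (v : 'cV[R]_p) : (0 < p)%N -> 0 < e -> e < 1 ->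
  0 < al -> 0 <= m ->
  sqn ((noise z w)^T *m v) <=
    (n%:R * m + net_sum e al m w / al) / (1 - e) ^+ 2 * sqn v.
Proof.
move=> p0 e0 e1 al0 m0.
set K := (Num.truncn (Num.sqrt p%:R / e)).+1.
apply: (@grid_spectral_bound _ e K) => //.
- by rewrite ltW// truncnS_gt.
- by rewrite addr_ge0 ?mulr_ge0 ?net_sum_ge0// invr_ge0 ltW.
move=> k kg; rewrite sqn_noise -lerBlDl ler_pdivlMr// mulrC.
apply: (@le_trans _ _ (expR (al * (chi_sum z (grid_pt (e / Num.sqrt p%:R) k) w - n%:R * m)))).
  by apply: le_trans (expR_ge1Dx _); rewrite lerDr.
rewrite /net_sum -/K (bigD1 k)//= kg mul1r lerDl.
by apply: sumr_ge0 => k' _; rewrite mulr_ge0 ?expR_ge0.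
Qed.

Lemma noise_norm_le_good e al m w (v : 'cV[R]_p) : (0 < p)%N -> 0 < e -> e < 1 ->
  0 < al -> 0 <= m -> net_sum e al m w < 1 ->
  sqn ((noise z w)^T *m v) <= n%:R * m / (1 - e) ^+ 2 * sqn v.
Proof.
move=> p0 e0 e1 al0 m0 good.
set K := (Num.truncn (Num.sqrt p%:R / e)).+1.
apply: (@grid_spectral_bound _ e K) => //.
- by rewrite ltW// truncnS_gt.
- by rewrite mulr_ge0.
move=> k kg; rewrite sqn_noise -subr_le0 -(pmulr_rle0 _ al0) -ler_expR expR0.
apply: le_trans (ltW good).
rewrite /net_sum -/K (bigD1 k)//= kg mul1r lerDl.
by apply: sumr_ge0 => k' _; rewrite mulr_ge0 ?expR_ge0.
Qed.

Hypothesis z_iid : iid_with_law z (isotropic_normal sigma p).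

Lemma expectation_net_sum e al m : 0 < e -> 0 <= al -> 2 * al * sigma ^+ 2 <= 1 / 4 ->
  (\int[P]_w (net_sum e al m w)%:E <=
   (grid_const e ^+ p *
    expR (n%:R * (al * (sigma ^+ 2 - m) + 2 * (al * sigma ^+ 2) ^+ 2)))%:E)%E.
Proof.
move=> e0 al0 als.
set K := (Num.truncn (Num.sqrt p%:R / e)).+1.
set E := expR _.
pose F (k : {ffun 'I_p -> 'I_(K + K.+1)}) w : R :=
  (in_grid (e / Num.sqrt p%:R) k)%:R *
    expR (al * (chi_sum z (grid_pt (e / Num.sqrt p%:R) k) w - n%:R * m)).
have mE k : measurable_fun setT (fun w : Om =>
   (expR (al * (chi_sum z (grid_pt (e / Num.sqrt p%:R) k : 'I_p -> R) w - n%:R * m)))%:E).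
  apply/measurable_EFinP; apply: measurableT_comp => //; apply: measurable_funM => //.
  by apply: measurable_funB => //; exact: measurable_chi_sum.
have -> : (\int[P]_w (net_sum e al m w)%:E = \sum_k \int[P]_w (F k w)%:E)%E.
  rewrite -ge0_integral_sum//.
  - by apply: eq_integral => w _; rewrite sumEFin.
  - by move=> k; under eq_fun do rewrite EFinM; exact: emeasurable_funM.
  - by move=> k w _; rewrite lee_fin mulr_ge0 ?expR_ge0.
apply: (@le_trans _ _ (\sum_(k : {ffun 'I_p -> 'I_(K + K.+1)})
  ((in_grid (e / Num.sqrt p%:R) k)%:R * E)%:E)%E).
  apply: lee_sum => k _; rewrite /F; case: (boolP (in_grid _ _)) => kg; last first.
    under eq_integral do rewrite mul0r.
    by rewrite integral0 mul0r.
  under eq_integral do rewrite mul1r.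
  rewrite mul1r; pose V := \sum_a grid_pt (e / Num.sqrt p%:R) k a ^+ 2.
  have V0 : 0 <= V by exact: sum_sqr_ge0.
  have V1 : V <= 1 by [].
  have s2 : 0 <= sigma ^+ 2 by exact: sqr_ge0.
  have sV : sigma ^+ 2 * V <= sigma ^+ 2 by rewrite ler_piMr.
  have sV0 : 0 <= sigma ^+ 2 * V by rewrite mulr_ge0.
  have aV : al * (sigma ^+ 2 * V) <= al * sigma ^+ 2 by rewrite ler_wpM2l.
  have aV0 : 0 <= al * (sigma ^+ 2 * V) by rewrite mulr_ge0.
  apply: le_trans (chi_sum_mgf sigma_gt0 z_iid _ _) _.
    by rewrite -/V ger0_norm -mulrA ?(mulr_ge0 _ aV0)// (le_trans _ als)// -mulrA ler_wpM2l.
  rewrite lee_fin ler_expR -/V ler_wpM2l// lerD ?ler_wpM2l// ?lerD2r//.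
  by rewrite lerXn2r ?nnegrE// (le_trans aV0).
rewrite sumEFin lee_fin -mulr_suml ler_wpM2r ?expR_ge0//.
exact: grid_count_le.
Qed.

End noise_net.

(** * Upper bounds for means of dominated functions *)

Section mean_bounds.
Context dO (Om : measurableType dO) (R : realType) (P : probability Om R).

Implicit Types (X Y : Om -> R) (c k : R).

(** An upper bound for the mean through a measurable majorant, because integrals
    of nonmeasurable functions are not subadditive. *)
Definition mean_le (X : Om -> R) (c : R) : Prop := exists Y,
  [/\ measurable_fun setT Y, forall w, 0 <= X w <= Y w &
      (\int[P]_w (Y w)%:E <= c%:E)%E].

Lemma mean_le_measurable X c : measurable_fun setT X -> (forall w, 0 <= X w) ->
  (\int[P]_w (X w)%:E <= c%:E)%E -> mean_le X c.
Proof. by move=> mX X0 Xc; exists X; split=> // w; rewrite X0 lexx. Qed.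

Lemma mean_le_integral X c : mean_le X c -> (\int[P]_w (X w)%:E <= c%:E)%E.
Proof.
move=> [Y [_ XY]]; apply: le_trans.
by apply: ge0_le_integral_nonmeasurable => w; have /andP[X0 XY'] := XY w; rewrite lee_fin.
Qed.

Lemma mean_le_dominated X (X' : Om -> R) c : (forall w, 0 <= X w <= X' w) -> mean_le X' c ->
  mean_le X c.
Proof.
move=> XX' [Y [mY X'Y Yc]]; exists Y; split=> // w.
have /andP[X0 h] := XX' w; have /andP[_ h'] := X'Y w.
by rewrite X0 (le_trans h).
Qed.

Lemma mean_le_weaken X c (c' : R) : mean_le X c -> c <= c' -> mean_le X c'.
Proof. by move=> [Y [mY XY Yc]] cc'; exists Y; split=> //; rewrite (le_trans Yc)// lee_fin. Qed.

Lemma mean_le_cst c : 0 <= c -> mean_le (fun=> c) c.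
Proof.
move=> c0; apply: mean_le_measurable => //; rewrite (integral_cst P measurableT).
by rewrite [X in (_ * X)%E](probability_setT P) mule1.
Qed.

Lemma mean_leD X Y c (e : R) : mean_le X c -> mean_le Y e ->
  mean_le (fun w => X w + Y w) (c + e).
Proof.
move=> [X' [mX XX' Xc]] [Y' [mY YY' Ye]]; exists (fun w => X' w + Y' w).
have X'0 w : 0 <= X' w by have /andP[/le_trans] := XX' w; apply.
have Y'0 w : 0 <= Y' w by have /andP[/le_trans] := YY' w; apply.
split.
- exact: measurable_funD.
- move=> w; have /andP[? ?] := XX' w; have /andP[? ?] := YY' w.
  by rewrite addr_ge0 ?lerD.
- under eq_integral do rewrite EFinD.
  rewrite ge0_integralD//; [by rewrite EFinD leeD| | | |].
  + by move=> w _; rewrite lee_fin.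
  + exact/measurable_EFinP.
  + by move=> w _; rewrite lee_fin.
  + exact/measurable_EFinP.
Qed.

Lemma mean_leZ k X c : 0 <= k -> mean_le X c -> mean_le (fun w => k * X w) (k * c).
Proof.
move=> k0 [X' [mX XX' Xc]]; exists (fun w => k * X' w); split.
- exact: measurable_funM.
- by move=> w; have /andP[? ?] := XX' w; rewrite mulr_ge0 ?ler_wpM2l.
- under eq_integral do rewrite EFinM.
  rewrite ge0_integralZl//; [by rewrite EFinM lee_wpmul2l| |].
  + exact/measurable_EFinP.
  + by move=> w _; rewrite lee_fin; have /andP[/le_trans] := XX' w; apply.
Qed.

Lemma mean_le_sum (I : finType) (X : I -> Om -> R) c :
  (forall i, mean_le (X i) c) -> mean_le (fun w => \sum_i X i w) (#|I|%:R * c).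
Proof.
move=> H.
suff h (s : seq I) : mean_le (fun w => \sum_(i <- s) X i w) ((size s)%:R * c).
  by have := h (index_enum I); rewrite cardT enumT /index_enum; case: index_enum_key.
elim: s => [|i s IH].
  under eq_fun do rewrite big_nil.
  by rewrite mul0r; exact: mean_le_cst.
under eq_fun do rewrite big_cons.
by rewrite /= -natr1 mulrDl mul1r addrC; exact: mean_leD.
Qed.

End mean_bounds.

Section algebra.
Variable R : realType.

Lemma sum_sqr_sqr_le (I : finType) (t : I -> R) :
  (\sum_i t i ^+ 2) ^+ 2 <= #|I|%:R * \sum_i t i ^+ 4.
Proof.
have := cauchy_schwarz_sum (fun i => t i ^+ 2) (fun=> 1).
under eq_bigr do rewrite mulr1.
under [X in _ <= X * _]eq_bigr do rewrite -exprM.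
by rewrite expr1n sumr_const mulrC.
Qed.

Lemma sqn_sqr_le m n (A : 'M[R]_(m, n)) :
  sqn A ^+ 2 <= (m * n)%:R * \sum_(ij : 'I_m * 'I_n) A ij.1 ij.2 ^+ 4.
Proof.
rewrite /sqn pair_bigA /=; apply: le_trans (sum_sqr_sqr_le _) _.
by rewrite card_prod !card_ord.
Qed.

(** The first two terms on the right are linear in the noise, and the last one is
    centred when [tau] is [n] times the noise variance. *)
Lemma signal_noise_expansion p q n (U : 'M[R]_(p, q)) (G : 'M[R]_(q, n))
    (Z : 'M[R]_(p, n)) (tau : R) : orthonormal_cols U ->
  (U *m G + Z) *m (U *m G + Z)^T *m U - U *m (G *m G^T) - tau *: U =
  U *m (G *m Z^T *m U) + Z *m G^T + (Z *m Z^T *m U - tau *: U).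
Proof.
move=> Uo.
have -> : (U *m G + Z)^T = G^T *m U^T + Z^T.
  by rewrite -trmx_mul; apply/matrixP => i j; rewrite !mxE.
have E : (G^T *m U^T + Z^T) *m U = G^T + Z^T *m U.
  by rewrite mulmxDl -mulmxA Uo mulmx1.
rewrite -mulmxA E mulmxDl !mulmxDr !mulmxA.
move: (U *m G *m G^T) (U *m G *m Z^T *m U) (Z *m G^T) (Z *m Z^T *m U) (tau *: U).
by move=> a b c e t; apply/matrixP => i j; rewrite !mxE; ring.
Qed.

Lemma sqr_sum3_le (a b c : R) : (3 * (a + b + c)) ^+ 2 <= 27 * (a ^+ 2 + b ^+ 2 + c ^+ 2).
Proof.
have := sqr_ge0 (a - b); have := sqr_ge0 (a - c); have := sqr_ge0 (b - c); nra.
Qed.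

Lemma diff_quartic_le (s t : R) : (s - t) ^+ 4 <= 8 * (s ^+ 4 + t ^+ 4).
Proof.
have h (a b : R) : (a + b) ^+ 2 <= 2 * (a ^+ 2 + b ^+ 2).
  by have := sqr_ge0 (a - b); nra.
rewrite [in leLHS](exprM _ 2 2).
have h1 := h s (- t); rewrite sqrrN in h1.
apply: (@le_trans _ _ ((2 * (s ^+ 2 + t ^+ 2)) ^+ 2)).
  by rewrite lerXn2r ?nnegrE ?sqr_ge0// mulr_ge0// addr_ge0 ?sqr_ge0.
rewrite exprMn; have := h (s ^+ 2) (t ^+ 2); rewrite -!exprM; lra.
Qed.

End algebra.

Section mean_matrices.
Context dO (Om : measurableType dO) (R : realType) (P : probability Om R).

Lemma mean_le_sqn_sqr m n (A : Om -> 'M[R]_(m, n)) c :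
  (forall i j, mean_le P (fun w => A w i j ^+ 4) c) ->
  mean_le P (fun w => sqn (A w) ^+ 2) ((m * n)%:R ^+ 2 * c).
Proof.
move=> H; apply: (@mean_le_dominated _ _ _ _ _ (fun w =>
    (m * n)%:R * \sum_(ij : 'I_m * 'I_n) A w ij.1 ij.2 ^+ 4)).
  by move=> w; rewrite sqr_ge0 sqn_sqr_le.
rewrite expr2 -mulrA; apply: mean_leZ => //.
have -> : (m * n)%:R = #|{: 'I_m * 'I_n}|%:R :> R by rewrite card_prod !card_ord.
by apply: mean_le_sum => -[i j]; exact: H.
Qed.

End mean_matrices.

(** * The leading error term *)

Section observations.
Context dO (Om : measurableType dO) (R : realType) (P : probability Om R).
Variables (n p q d : nat) (sigma : R) (f : 'I_q -> d.-tuple R -> R) (B : R).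
Variables (x : 'I_n -> {RV P >-> d.-tuple R}) (z : 'I_n -> {RV P >-> p.-tuple R}).
Variable U : 'M[R]_(p, q).
Hypotheses (n_gt0 : (0 < n)%N) (q_le_p : (q <= p)%N).
Hypothesis sigma_gt0 : 0 < sigma.
Hypothesis U_orth : orthonormal_cols U.
Hypothesis model : sampling_model sigma x z.
Hypothesis mf : forall k, measurable_fun setT (f k).
Hypothesis f_bounded : forall k t, unit_cube t -> `|f k t| <= B.

Let x_cube : forall i w, unit_cube (x i w). Proof. by case: model. Qed.
Let x_iid : iid_with_law x (uniform_cube R d). Proof. by case: model. Qed.
Let z_iid : iid_with_law z (isotropic_normal sigma p). Proof. by case: model. Qed.
Let xz_indep : independent P (joint x) (joint z). Proof. by case: model. Qed.

Definition scores (w : Om) : 'M[R]_(q, n) := \matrix_(k, i) f k (x i w).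

Lemma observations_eq w :
  eval_design (combine f U) (joint x w) + noise z w = U *m scores w + noise z w.
Proof.
congr (_ + _); apply/matrixP => a i; rewrite !mxE /combine summxE.
by apply: eq_bigr => k _; rewrite !mxE tnth_mktuple mulrC.
Qed.

Definition unit_dir (a : 'I_p) : 'I_p -> R := fun b => (b == a)%:R.

Lemma tdot_unit_dir a (t : p.-tuple R) : tdot (unit_dir a) t = tnth t a.
Proof.
rewrite /tdot (bigD1 a)//= /unit_dir eqxx mul1r big1 ?addr0// => b ba.
by rewrite (negbTE ba) mul0r.
Qed.

Lemma sum_unit_dir a : \sum_b unit_dir a b ^+ 2 = 1.
Proof.
rewrite (bigD1 a)//= /unit_dir eqxx expr1n big1 ?addr0// => b ba.
by rewrite (negbTE ba) expr0n.
Qed.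

Lemma sum_sqr_col k : \sum_b U b k ^+ 2 = 1.
Proof.
have /matrixP/(_ k k) := U_orth; rewrite !mxE eqxx mulr1n => <-.
by apply: eq_bigr => b _; rewrite mxE expr2.
Qed.

Lemma scores_noise_proj w k l :
  (scores w *m (noise z w)^T *m U) k l =
  cross_sum x z (f k) (fun a => U a l) w.
Proof.
rewrite -mulmxA mxE; apply: eq_bigr => i _; rewrite !mxE; congr (_ * _).
by apply: eq_bigr => a _; rewrite !mxE mulrC.
Qed.

Lemma noise_scores w a k :
  (noise z w *m (scores w)^T) a k = cross_sum x z (f k) (unit_dir a) w.
Proof.
rewrite mxE; apply: eq_bigr => i _; rewrite !mxE tdot_unit_dir; exact: mulrC.
Qed.

(** The product of the coordinate [a] of a vector and of its projection on the
    column [k] is, up to a factor 4, a difference of squares along [dirD] and [dirB]. *)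
Definition dirD a k : 'I_p -> R := fun b => unit_dir a b + U b k.
Definition dirB a k : 'I_p -> R := fun b => unit_dir a b - U b k.

Definition centered_chi (v : 'I_p -> R) w : R :=
  chi_sum z v w - n%:R * (sigma ^+ 2 * \sum_b v b ^+ 2).

(** Polarization: 4 z_a (z . u) is the difference of the squares of z . (e_a + u) and
    z . (e_a - u), and the squared norms of these directions differ by 4 u_a. *)
Lemma noise_gram_centered w a k :
  (noise z w *m (noise z w)^T *m U - (n%:R * sigma ^+ 2) *: U) a k =
  4^-1 * (centered_chi (dirD a k) w - centered_chi (dirB a k) w).
Proof.
have tD (s : R) (t : p.-tuple R) : tdot (fun b => unit_dir a b + s * U b k) t =
    tnth t a + s * tdot (fun b => U b k) t.
  rewrite -(tdot_unit_dir a) /tdot mulr_sumr -big_split; apply: eq_bigr => b _ /=.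
  by ring.
have dDE : dirD a k = (fun b => unit_dir a b + 1 * U b k).
  by apply/funext => b; rewrite mul1r.
have dBE : dirB a k = (fun b => unit_dir a b + (-1) * U b k).
  by apply/funext => b; rewrite mulN1r.
have nD : \sum_b dirD a k b ^+ 2 - \sum_b dirB a k b ^+ 2 = 4 * U a k.
  rewrite -sumrB (bigD1 a)//= big1 ?addr0.
    by rewrite /dirD /dirB /unit_dir eqxx mulr1n; ring.
  by move=> b ba; rewrite /dirD /dirB /unit_dir (negbTE ba) add0r sub0r sqrrN subrr.
have cE : chi_sum z (dirD a k) w - chi_sum z (dirB a k) w =
    4 * \sum_i tnth (z i w) a * tdot (fun b => U b k) (z i w).
  rewrite /chi_sum -sumrB mulr_sumr; apply: eq_bigr => i _.
  by rewrite dDE dBE !tD; ring.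
have -> : centered_chi (dirD a k) w - centered_chi (dirB a k) w =
    (chi_sum z (dirD a k) w - chi_sum z (dirB a k) w) -
    n%:R * sigma ^+ 2 * (\sum_b dirD a k b ^+ 2 - \sum_b dirB a k b ^+ 2).
  by rewrite /centered_chi; ring.
have hZ : (noise z w *m (noise z w)^T *m U) a k =
    \sum_i tnth (z i w) a * tdot (fun b => U b k) (z i w).
  rewrite -mulmxA mxE; apply: eq_bigr => i _; rewrite !mxE; congr (_ * _).
  by apply: eq_bigr => b _; rewrite !mxE mulrC.
by rewrite [LHS]mxE hZ [(- (_ *: U)) a k]mxE [(_ *: U) a k]mxE cE nD; field.
Qed.

Lemma sum_sqr_dir_le a k (s : R) : `|s| <= 1 ->
  \sum_b (unit_dir a b + s * U b k) ^+ 2 <= 4.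
Proof.
move=> s1; have s2 : s ^+ 2 <= 1.
  by rewrite -[leLHS]real_normK ?num_real// expr_le1.
apply: (@le_trans _ _ (\sum_b (2 * unit_dir a b ^+ 2 + 2 * U b k ^+ 2))).
  apply: ler_sum => b _; have := sqr_ge0 (unit_dir a b - s * U b k).
  have := sqr_ge0 (U b k); nra.
by rewrite big_split /= -!mulr_sumr sum_unit_dir sum_sqr_col; lra.
Qed.

Definition cross_const : R := 2 * 4 ^+ 4 * expR (B ^+ 2 * sigma ^+ 2).
Definition chi_const : R := 2 * 4 ^+ 4 * expR 1 * (32 * sigma ^+ 2) ^+ 4.

Lemma cross_const_ge0 : 0 <= cross_const.
Proof. by rewrite mulr_ge0 ?expR_ge0// mulr_ge0// exprn_ge0. Qed.

Lemma chi_const_ge0 : 0 <= chi_const.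
Proof.
rewrite mulr_ge0 ?exprn_even_ge0// mulr_ge0 ?expR_ge0// mulr_ge0//; exact: exprn_ge0.
Qed.

Lemma mean_cross_sum k (v : 'I_p -> R) : \sum_b v b ^+ 2 = 1 ->
  mean_le P (fun w => cross_sum x z (f k) v w ^+ 4) (cross_const * n%:R ^+ 2).
Proof.
move=> v1; apply: mean_le_measurable.
- by apply: measurable_funX; exact: (measurable_cross_sum x z (mf k)).
- by move=> w; rewrite exprn_even_ge0.
- apply: (cross_sum_fourth_moment x_cube sigma_gt0 z_iid xz_indep (mf k)) => //.
    exact: f_bounded.
  by rewrite v1.
Qed.

Lemma mean_centered_chi (v : 'I_p -> R) : \sum_b v b ^+ 2 <= 4 ->
  mean_le P (fun w => centered_chi v w ^+ 4) (chi_const * n%:R ^+ 2).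
Proof.
move=> v4; apply: mean_le_measurable.
- by apply: measurable_funX; apply: measurable_funB => //; exact: measurable_chi_sum.
- by move=> w; rewrite exprn_even_ge0.
- exact: chi_sum_fourth_moment.
Qed.

(** The matrix [D] of [sin2_perturbation] with [tau] equal to [n * sigma ^+ 2]. *)
Definition gram_error w : 'M[R]_(p, q) :=
  let Y := U *m scores w + noise z w in
  Y *m Y^T *m U - U *m (scores w *m (scores w)^T) - (n%:R * sigma ^+ 2) *: U.

(** The three groups of entries of [signal_noise_expansion] have fourth moments of
    order n^2, and there are at most p q of them in each group. *)
Lemma mean_gram_error :
  mean_le P (fun w => sqn (gram_error w) ^+ 2)
    (27 * q%:R ^+ 2 * (2 * cross_const + chi_const) * (n%:R * p%:R) ^+ 2).
Proof.
pose A1 w := scores w *m (noise z w)^T *m U.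
pose A2 w := noise z w *m (scores w)^T.
pose A3 w := noise z w *m (noise z w)^T *m U - (n%:R * sigma ^+ 2) *: U.
have m1 : mean_le P (fun w => sqn (A1 w) ^+ 2) ((q * q)%:R ^+ 2 * (cross_const * n%:R ^+ 2)).
  apply: mean_le_sqn_sqr => k l; under eq_fun do rewrite scores_noise_proj.
  exact/mean_cross_sum/sum_sqr_col.
have m2 : mean_le P (fun w => sqn (A2 w) ^+ 2) ((p * q)%:R ^+ 2 * (cross_const * n%:R ^+ 2)).
  apply: mean_le_sqn_sqr => k l; under eq_fun do rewrite noise_scores.
  exact/mean_cross_sum/sum_unit_dir.
have m3 : mean_le P (fun w => sqn (A3 w) ^+ 2) ((p * q)%:R ^+ 2 * (chi_const * n%:R ^+ 2)).
  apply: mean_le_sqn_sqr => a k; under eq_fun do rewrite noise_gram_centered.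
  apply: (@mean_le_dominated _ _ _ _ _ (fun w => 32^-1 *
    (centered_chi (dirD a k) w ^+ 4 + centered_chi (dirB a k) w ^+ 4))).
    move=> w; rewrite exprn_even_ge0//= exprMn.
    have := diff_quartic_le (centered_chi (dirD a k) w) (centered_chi (dirB a k) w).
    have -> : (4^-1 : R) ^+ 4 = 32^-1 * 8^-1 by field.
    by rewrite -mulrA ler_pM2l// => h; rewrite mulrC ler_pdivrMr// mulrC.
  have h4 s : `|s| <= 1 -> \sum_b (fun b => unit_dir a b + s * U b k) b ^+ 2 <= 4.
    exact: sum_sqr_dir_le.
  apply: (@mean_le_weaken _ _ _ _ _ (32^-1 * (chi_const * n%:R ^+ 2 + chi_const * n%:R ^+ 2))).
    apply: mean_leZ => //; apply: mean_leD; apply: mean_centered_chi.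
      have := h4 1; rewrite normr1 => /(_ (lexx _)); apply: le_trans.
      by apply: ler_sum => b _; rewrite mul1r.
    have := h4 (-1); rewrite normrN1 => /(_ (lexx _)); apply: le_trans.
    by apply: ler_sum => b _; rewrite mulN1r.
  have := mulr_ge0 chi_const_ge0 (sqr_ge0 (n%:R : R)); lra.
apply: (@mean_le_dominated _ _ _ _ _ (fun w => 27 *
   (sqn (A1 w) ^+ 2 + sqn (A2 w) ^+ 2 + sqn (A3 w) ^+ 2))).
  move=> w; rewrite sqr_ge0 /=; apply: le_trans (sqr_sum3_le _ _ _).
  rewrite lerXn2r ?nnegrE ?sqn_ge0//; first by rewrite mulr_ge0// !addr_ge0 ?sqn_ge0.
  rewrite /gram_error signal_noise_expansion//; apply: le_trans (sqnD3 _ _ _) _.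
  by rewrite sqn_orth.
have m := mean_leZ (ler0n R 27) (mean_leD (mean_leD m1 m2) m3).
apply: mean_le_weaken m _.
have qp : (q * q)%:R ^+ 2 <= (p * q)%:R ^+ 2 :> R.
  by rewrite lerXn2r ?nnegrE// ler_nat leq_mul2r q_le_p orbT.
have c0 := cross_const_ge0.
have cn0 : 0 <= cross_const * n%:R ^+ 2 by rewrite mulr_ge0 ?sqr_ge0.
have h := ler_wpM2r cn0 qp.
have -> : 27 * q%:R ^+ 2 * (2 * cross_const + chi_const) * (n%:R * p%:R) ^+ 2 =
  27 * ((p * q)%:R ^+ 2 * (cross_const * n%:R ^+ 2) +
    (p * q)%:R ^+ 2 * (cross_const * n%:R ^+ 2) + (p * q)%:R ^+ 2 * (chi_const * n%:R ^+ 2)).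
  by rewrite natrM; ring.
by rewrite ler_pM2l// !lerD2r.
Qed.

End observations.

(** * Mean squared sine of the estimated subspace *)

Section subspace_estimation.
Context dO (Om : measurableType dO) (R : realType) (P : probability Om R).
Variables (n p q d : nat) (sigma : R) (f : 'I_q -> d.-tuple R -> R) (B : R).
Variables (x : 'I_n -> {RV P >-> d.-tuple R}) (z : 'I_n -> {RV P >-> p.-tuple R}).
Variable U : 'M[R]_(p, q).
Hypotheses (n_gt0 : (0 < n)%N) (q_gt0 : (0 < q)%N) (q_le_p : (q <= p)%N).
Hypothesis sigma_gt0 : 0 < sigma.
Hypothesis U_orth : orthonormal_cols U.
Hypothesis model : sampling_model sigma x z.
Hypothesis mf : forall k, measurable_fun setT (f k).
Hypothesis f_bounded : forall k t, unit_cube t -> `|f k t| <= B.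
Variables (lam : 'I_q -> R) (lam0 : R).
Hypothesis lam0_gt0 : 0 < lam0.
Hypothesis lam0_le : forall k, lam0 <= lam k.
Hypothesis f_gram : forall k l,
  (\int[uniform_cube R d]_t (f k t * f l t - lam k *+ (k == l))%:E = 0)%E.

Let x_cube : forall i w, unit_cube (x i w). Proof. by case: model. Qed.
Let x_iid : iid_with_law x (uniform_cube R d). Proof. by case: model. Qed.
Let z_iid : iid_with_law z (isotropic_normal sigma p). Proof. by case: model. Qed.
Let p_gt0 : (0 < p)%N. Proof. exact: leq_trans q_gt0 q_le_p. Qed.
Let nR_gt0 : 0 < n%:R :> R. Proof. by rewrite ltr0n. Qed.
Let pR_ge1 : 1 <= p%:R :> R. Proof. by rewrite ler1n. Qed.

Local Notation G := (scores f x).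
Local Notation Y w := (U *m G w + noise z w).

(** Deviation of the Gram matrix of the signal values from its mean. *)
Definition gram_dev w : 'M[R]_q :=
  G w *m (G w)^T - n%:R *: diag_mx (\row_k lam k).

Lemma gram_devE w k l :
  gram_dev w k l = design_sum x (fun t => f k t * f l t - lam k *+ (k == l)) w.
Proof.
rewrite !mxE /design_sum sumrB; congr (_ - _).
  by apply: eq_bigr => i _; rewrite !mxE.
by rewrite sumr_const card_ord -[RHS]mulr_natl.
Qed.

Definition gram_bound : R := B ^+ 2 + \sum_k `|lam k|.
Definition gram_const : R := 2 * 4 ^+ 4 * expR 1 * (2 * (`|gram_bound| + 1)) ^+ 4.

Lemma gram_const_ge0 : 0 <= gram_const.
Proof.
rewrite mulr_ge0 ?exprn_even_ge0// mulr_ge0 ?expR_ge0// mulr_ge0//; exact: exprn_ge0.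
Qed.

Lemma mean_gram_dev :
  mean_le P (fun w => sqn (gram_dev w) ^+ 2) ((q * q)%:R ^+ 2 * (gram_const * n%:R ^+ 2)).
Proof.
apply: mean_le_sqn_sqr => k l; under eq_fun do rewrite gram_devE.
have mxi : measurable_fun setT (fun t => f k t * f l t - lam k *+ (k == l)).
  by apply: measurable_funB => //; apply: measurable_funM.
apply: mean_le_measurable.
- by apply: measurable_funX; exact: measurable_design_sum.
- by move=> w; rewrite exprn_even_ge0.
apply: (design_sum_fourth_moment x_cube x_iid mxi _ (f_gram k l) n_gt0).
move=> t tc; rewrite (le_trans (ler_normB _ _))// lerD//.
  by rewrite normrM expr2 ler_pM// f_bounded.
rewrite (bigD1 k)//= (@le_trans _ _ `|lam k|)//.
  by case: (k == l); rewrite ?mulr1n ?mulr0n ?normr0.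
by rewrite lerDl sumr_ge0.
Qed.

Lemma scores_lower w : sqn (gram_dev w) <= (n%:R * lam0 / 4) ^+ 2 ->
  forall v : 'cV_q, 3 / 4 * n%:R * lam0 * sqn v <= sqn ((G w)^T *m v).
Proof.
move=> good v.
have c0 : 0 <= n%:R * lam0 / 4 by rewrite divr_ge0 ?mulr_ge0 ?ltW.
pose t := (v^T *m (gram_dev w *m v)) 0 0.
have vv (u : 'cV[R]_n) : u^T *m u = (sqn u)%:M.
  by rewrite [LHS]mx11_scalar sqn_trace /mxtrace big_ord1.
have E : sqn ((G w)^T *m v) = \sum_k n%:R * lam k * v k 0 ^+ 2 + t.
  have GE : G w *m (G w)^T = n%:R *: diag_mx (\row_k lam k) + gram_dev w.
    by rewrite /gram_dev addrC subrK.
  rewrite sqn_trace /mxtrace big_ord1 trmx_mul trmxK -mulmxA (mulmxA (G w)) GE.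
  rewrite mulmxDl mulmxDr mxE; congr (_ + _).
  rewrite -scalemxAl -scalemxAr mxE mul_diag_mx mxE mulr_sumr.
  by apply: eq_bigr => k _; rewrite !mxE; ring.
have t2 : t ^+ 2 <= (n%:R * lam0 / 4 * sqn v) ^+ 2.
  rewrite /t; apply: le_trans (mx11_cauchy_schwarz _ _) _.
  have -> : (n%:R * lam0 / 4 * sqn v) ^+ 2 =
      sqn v * ((n%:R * lam0 / 4) ^+ 2 * sqn v) by ring.
  rewrite sqn_tr ler_wpM2l ?sqn_ge0// (le_trans (sqn_mul _ _))//.
  by rewrite ler_wpM2r ?sqn_ge0.
have t1 : `|t| <= n%:R * lam0 / 4 * sqn v.
  rewrite -(@ler_pXn2r _ 2) ?nnegrE ?(mulr_ge0 c0 (sqn_ge0 v))//.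
  by rewrite real_normK ?num_real.
have h : n%:R * lam0 * sqn v <= \sum_k n%:R * lam k * v k 0 ^+ 2.
  rewrite sqn_cV mulr_sumr; apply: ler_sum => k _.
  by rewrite ler_wpM2r ?sqr_ge0// ler_wpM2l// ltW.
move: t1; rewrite ler_norml => /andP[t1 _]; rewrite E; lra.
Qed.

(** On the good event, where the first two terms are below the thresholds of
    [noise_norm_le_good] and [scores_lower], the third term is the perturbation
    bound with gap [n * lam0 / 2].  Otherwise one of the first two terms is at least
    the trivial bound [q%:R ^+ 2]. *)
Lemma sin2_sqr_le e al m w (Uh : 'M[R]_(p, q)) :
  0 < e -> e < 1 -> 0 < al -> 0 <= m ->
  m / (1 - e) ^+ 2 <= sigma ^+ 2 + lam0 / 4 ->
  top_left_singular_vectors (Y w) Uh ->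
  sin2 Uh U ^+ 2 <= q%:R ^+ 2 * net_sum z e al m w +
    (q%:R ^+ 2 * (4 / (n%:R * lam0)) ^+ 4 * sqn (gram_dev w) ^+ 2 +
     (2 / (n%:R * lam0)) ^+ 4 * sqn (gram_error sigma f x z U w) ^+ 2).
Proof.
move=> e0 e1 al0 m0 gap top.
have Uho := top_left_orthonormal q_le_p top.
have S0 := sin2_ge0 Uho U_orth.
have nl0 : 0 < n%:R * lam0 by rewrite mulr_gt0.
have T1 : 0 <= q%:R ^+ 2 * net_sum z e al m w.
  by rewrite mulr_ge0 ?sqr_ge0// net_sum_ge0.
have T2 : 0 <= q%:R ^+ 2 * (4 / (n%:R * lam0)) ^+ 4 * sqn (gram_dev w) ^+ 2.
  by apply: mulr_ge0 (sqr_ge0 _); apply: mulr_ge0 (sqr_ge0 _) _; rewrite exprn_even_ge0.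
have T3 : 0 <= (2 / (n%:R * lam0)) ^+ 4 * sqn (gram_error sigma f x z U w) ^+ 2.
  by apply: mulr_ge0 (sqr_ge0 _); rewrite exprn_even_ge0.
have Sq : sin2 Uh U ^+ 2 <= q%:R ^+ 2 by rewrite lerXn2r ?nnegrE// sin2_le.
have [bad1|good1] := leP 1 (net_sum z e al m w).
  apply: le_trans Sq _; apply: (@le_trans _ _ (q%:R ^+ 2 * net_sum z e al m w)).
    by rewrite ler_peMr ?sqr_ge0.
  by rewrite lerDl addr_ge0.
have [good2|bad2] := leP (sqn (gram_dev w)) ((n%:R * lam0 / 4) ^+ 2); last first.
  apply: le_trans Sq _.
  apply: (@le_trans _ _ (q%:R ^+ 2 * (4 / (n%:R * lam0)) ^+ 4 * sqn (gram_dev w) ^+ 2)); last lra.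
  rewrite -mulrA ler_peMr ?sqr_ge0//.
  have -> : (4 / (n%:R * lam0)) ^+ 4 = (((n%:R * lam0 / 4) ^+ 2) ^+ 2)^-1.
    by rewrite -exprM -exprVn invf_div.
  rewrite mulrC ler_pdivlMr ?exprn_gt0 ?divr_gt0// mul1r.
  by rewrite lerXn2r ?nnegrE ?sqn_ge0 ?sqr_ge0// ltW.
apply: (@le_trans _ _ ((2 / (n%:R * lam0)) ^+ 4 * sqn (gram_error sigma f x z U w) ^+ 2));
  last lra.
have g0 : 0 < n%:R * lam0 / 2 by rewrite divr_gt0.
have := @sin2_perturbation _ p q n U Uh (G w) (Y w) (noise z w)
  (n%:R * sigma ^+ 2) (3 / 4 * n%:R * lam0) (n%:R * m / (1 - e) ^+ 2)
  (n%:R * lam0 / 2) q_le_p U_orth erefl top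
  (fun v => noise_norm_le_good v p_gt0 e0 e1 al0 m0 good1)
  (scores_lower good2) g0.
have -> : n%:R * lam0 / 2 <=
    n%:R * sigma ^+ 2 + 3 / 4 * n%:R * lam0 - n%:R * m / (1 - e) ^+ 2.
  have := ler_wpM2l (ltW nR_gt0) gap.
  by rewrite mulrA mulrDr; lra.
move=> /(_ isT); rewrite -/(gram_error sigma f x z U w) => h.
have -> : (2 / (n%:R * lam0)) ^+ 4 = (((n%:R * lam0 / 2) ^+ 2) ^+ 2)^-1.
  by rewrite -exprM -exprVn invf_div.
rewrite mulrC ler_pdivlMr ?exprn_gt0// mulrC -exprMn.
by rewrite lerXn2r ?nnegrE ?sqn_ge0 ?(mulr_ge0 (sqr_ge0 _) S0).
Qed.

Let rho : R := lam0 / (4 * sigma ^+ 2).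
(** With rho = lam0 / (4 sigma^2) this is rho / (4 + 4 rho); it is the accuracy of the
    grid as well as the relative deviation allowed for the chi-square statistics,
    small enough for [net_width_gap]. *)
Definition net_width : R := lam0 / (4 * sigma ^+ 2) / (4 + 4 * (lam0 / (4 * sigma ^+ 2))).
Local Notation eta := net_width.

Let rho_gt0 : 0 < rho.
Proof. by rewrite divr_gt0// mulr_gt0// exprn_gt0. Qed.

Lemma net_width_gt0 : 0 < eta.
Proof. by rewrite /eta -/rho divr_gt0//; have := rho_gt0; lra. Qed.

Lemma net_width_le : eta <= 1 / 4.
Proof. by rewrite /eta -/rho; have := rho_gt0 => r0; rewrite ler_pdivrMr; lra. Qed.

Lemma net_width_gap :
  sigma ^+ 2 * (1 + eta) / (1 - eta) ^+ 2 <= sigma ^+ 2 + lam0 / 4.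
Proof.
have s2 : 0 < sigma ^+ 2 by rewrite exprn_gt0.
have r0 := rho_gt0; have e0 := net_width_gt0; have e1 := net_width_le.
have d0 : 0 < 1 - eta by lra.
rewrite ler_pdivrMr ?exprn_gt0//.
have -> : sigma ^+ 2 + lam0 / 4 = sigma ^+ 2 * (1 + rho).
  by rewrite /rho; field; rewrite gt_eqF.
rewrite -[leRHS]mulrA ler_pM2l//.
have eE : eta * (4 + 4 * rho) = rho.
  by rewrite /eta -/rho divfK// gt_eqF//; lra.
have : (1 + rho) * (1 - 2 * eta) <= (1 + rho) * (1 - eta) ^+ 2.
  by rewrite ler_pM2l; [have := sqr_ge0 eta; rewrite sqrrB; lra|lra].
apply: le_trans; nra.
Qed.

(** The four terms come from the range of large [p], the grid, the Gram matrix of the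
    signal and the error matrix. *)
Definition sin2_const : R :=
  q%:R ^+ 2 * (16 * grid_const eta / eta ^+ 2) ^+ 2 +
  (q%:R ^+ 2 * (4 ^+ 5 / eta ^+ 4) +
   (q%:R ^+ 2 * (4 / lam0) ^+ 4 * ((q * q)%:R ^+ 2 * gram_const) +
    (2 / lam0) ^+ 4 * (27 * q%:R ^+ 2 * (2 * cross_const sigma B + chi_const sigma)))).

Lemma mean_sin2_sqr (Uh : Om -> 'M[R]_(p, q)) :
  (forall w, top_left_singular_vectors (Y w) (Uh w)) ->
  mean_le P (fun w => sin2 (Uh w) U ^+ 2) (sin2_const * (p%:R / n%:R) ^+ 2).
Proof.
move=> top.
have s2 : 0 < sigma ^+ 2 by rewrite exprn_gt0.
have e0 := net_width_gt0; have e4 := net_width_le.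
have g1 := grid_const_ge1 e0; have g0 : 0 <= grid_const eta by lra.
have pn0 : 0 <= (p%:R / n%:R) ^+ 2 :> R by exact: sqr_ge0.
have n2 : (n%:R ^+ 2)^-1 <= (p%:R / n%:R) ^+ 2 :> R.
  by rewrite expr_div_n ler_peMl ?invr_ge0 ?sqr_ge0// -[leLHS](expr1n _ 2) lerXn2r ?nnegrE.
have cc := cross_const_ge0 sigma B; have hc := chi_const_ge0 sigma.
have qc := gram_const_ge0.
set K1 := 4 ^+ 5 / eta ^+ 4.
have K10 : 0 <= K1 by rewrite divr_ge0 ?exprn_ge0 ?(ltW e0).
set K2 := q%:R ^+ 2 * (4 / lam0) ^+ 4 * ((q * q)%:R ^+ 2 * gram_const).
have K20 : 0 <= K2.
  apply: mulr_ge0; last exact: (mulr_ge0 (sqr_ge0 _) qc).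
  by apply: mulr_ge0 (sqr_ge0 _) _; rewrite exprn_even_ge0.
set K3 := (2 / lam0) ^+ 4 * (27 * q%:R ^+ 2 * (2 * cross_const sigma B + chi_const sigma)).
have K30 : 0 <= K3.
  rewrite mulr_ge0 ?exprn_even_ge0// mulr_ge0 ?mulr_ge0 ?sqr_ge0// addr_ge0// mulr_ge0//.
have scE : sin2_const = q%:R ^+ 2 * (16 * grid_const eta / eta ^+ 2) ^+ 2 +
   (q%:R ^+ 2 * K1 + (K2 + K3)) by [].
have K0 : 0 <= q%:R ^+ 2 * (16 * grid_const eta / eta ^+ 2) ^+ 2.
  by rewrite mulr_ge0 ?sqr_ge0.
have qK1 : 0 <= q%:R ^+ 2 * K1 by rewrite mulr_ge0 ?sqr_ge0.
have [small|large] := leP (p%:R * grid_const eta) (n%:R * eta ^+ 2 / 16); last first.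
  (* Here [p / n] is bounded below, and the trivial bound has the right order. *)
  apply: (@mean_le_dominated _ _ _ _ _ (fun=> q%:R ^+ 2)).
    move=> w; rewrite sqr_ge0 lerXn2r ?nnegrE ?sin2_le//.
    exact: (sin2_ge0 (top_left_orthonormal q_le_p (top w))).
  apply: mean_le_weaken (mean_le_cst _ (sqr_ge0 _)) _.
  rewrite scE mulrDl; set A := (X in _ <= X + _); set A' := (X in _ <= _ + X).
  have A'0 : 0 <= A' by rewrite mulr_ge0// !addr_ge0.
  suff : q%:R ^+ 2 <= A by lra.
  rewrite /A -mulrA ler_peMr ?sqr_ge0// -exprMn -[leLHS](expr1n _ 2).
  rewrite lerXn2r ?nnegrE//.
    apply: mulr_ge0; last exact: divr_ge0.
    by apply: divr_ge0 (sqr_ge0 _); exact: mulr_ge0.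
  rewrite mulrACA -invfM ler_pdivlMr ?(mulr_gt0 (exprn_gt0 _ e0) nR_gt0)//; lra.
pose al := eta / (4 * sigma ^+ 2).
have al0 : 0 < al by rewrite divr_gt0// mulr_gt0.
pose m := sigma ^+ 2 * (1 + eta).
have m0 : 0 <= m by rewrite mulr_ge0 ?(ltW s2)//; lra.
have als : 2 * al * sigma ^+ 2 <= 1 / 4.
  have -> : 2 * al * sigma ^+ 2 = eta / 2 by rewrite /al; field; rewrite gt_eqF.
  lra.
have mnet : mean_le P (net_sum z eta al m) (K1 * (p%:R / n%:R) ^+ 2).
  apply: mean_le_measurable; [exact: measurable_net_sum|by move=> w; exact: net_sum_ge0|].
  apply: le_trans (expectation_net_sum sigma_gt0 z_iid m e0 (ltW al0) als) _.
  rewrite lee_fin.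
  have -> : al * (sigma ^+ 2 - m) + 2 * (al * sigma ^+ 2) ^+ 2 = - (eta ^+ 2 / 8).
    by rewrite /al /m; field; rewrite gt_eqF.
  apply: (@le_trans _ _ (expR (- (n%:R * eta ^+ 2 / 16)))).
    apply: (@le_trans _ _ (expR (p%:R * grid_const eta) * expR (n%:R * - (eta ^+ 2 / 8)))).
      rewrite ler_wpM2r ?expR_ge0// expRM_natl lerXn2r ?nnegrE ?expR_ge0//.
      by apply: le_trans (expR_ge1Dx _); rewrite lerDr.
    by rewrite -expRD ler_expR; lra.
  set t := n%:R * eta ^+ 2 / 16.
  have t0 : 0 < t by rewrite divr_gt0// mulr_gt0// exprn_gt0.
  apply: (@le_trans _ _ (4 / t ^+ 2)).
    rewrite expRN -[leLHS]mul1r ler_pdivrMr ?expR_gt0// mulrAC ler_pdivlMr ?exprn_gt0// mul1r.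
    have -> : expR t = expR (t / 2) ^+ 2 by rewrite -expRM_natl; congr expR; field.
    have h : t / 2 <= expR (t / 2) by apply: le_trans (expR_ge1Dx _); lra.
    have -> : t ^+ 2 = 4 * (t / 2) ^+ 2 by field.
    by rewrite ler_pM2l// lerXn2r ?nnegrE ?expR_ge0// divr_ge0// ltW.
  have -> : 4 / t ^+ 2 = K1 * (n%:R ^+ 2)^-1.
    by rewrite /t /K1; field; rewrite !gt_eqF.
  by rewrite ler_wpM2l.
have nl : n%:R * lam0 != 0 by rewrite gt_eqF// mulr_gt0.
apply: (@mean_le_dominated _ _ _ _ _ (fun w => q%:R ^+ 2 * net_sum z eta al m w +
    (q%:R ^+ 2 * (4 / (n%:R * lam0)) ^+ 4 * sqn (gram_dev w) ^+ 2 +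
     (2 / (n%:R * lam0)) ^+ 4 * sqn (gram_error sigma f x z U w) ^+ 2))).
  move=> w; rewrite sqr_ge0; apply: sin2_sqr_le => //; first lra.
  exact: net_width_gap.
apply: (@mean_le_weaken _ _ _ _ _ (q%:R ^+ 2 * (K1 * (p%:R / n%:R) ^+ 2) +
  (q%:R ^+ 2 * (4 / (n%:R * lam0)) ^+ 4 * ((q * q)%:R ^+ 2 * (gram_const * n%:R ^+ 2)) +
   (2 / (n%:R * lam0)) ^+ 4 * (27 * q%:R ^+ 2 * (2 * cross_const sigma B + chi_const sigma) *
     (n%:R * p%:R) ^+ 2)))).
  apply: mean_leD; first by apply: mean_leZ => //; exact: sqr_ge0.
  apply: mean_leD; apply: mean_leZ.
  - by apply: mulr_ge0 (sqr_ge0 _) _; rewrite exprn_even_ge0.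
  - exact: mean_gram_dev.
  - by rewrite exprn_even_ge0.
  - exact: (mean_gram_error n_gt0 q_le_p sigma_gt0 U_orth model mf f_bounded).
have -> : q%:R ^+ 2 * (4 / (n%:R * lam0)) ^+ 4 * ((q * q)%:R ^+ 2 * (gram_const * n%:R ^+ 2)) =
    K2 * (n%:R ^+ 2)^-1.
  by rewrite /K2; field; rewrite !gt_eqF.
have -> : (2 / (n%:R * lam0)) ^+ 4 * (27 * q%:R ^+ 2 * (2 * cross_const sigma B + chi_const sigma) *
     (n%:R * p%:R) ^+ 2) = K3 * (p%:R / n%:R) ^+ 2.
  by rewrite /K3; field; rewrite !gt_eqF.
have h0 := mulr_ge0 K0 pn0; have h2 := ler_wpM2l K20 n2.
rewrite scE; move: h0 h2; set c0 := q%:R ^+ 2 * (_ ^+ 2).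
move: ((p%:R / n%:R) ^+ 2) (K1) (K2) (K3) => u k1 k2 k3; lra.
Qed.

End subspace_estimation.

(** * Prediction risk *)

Section prediction.
Variable R : realType.

Lemma positive_lower_bound (I : finType) (lam : I -> R) :
  (forall i, 0 < lam i) -> exists2 lam0, 0 < lam0 & forall i, lam0 <= lam i.
Proof.
move=> lam_gt0; exists (1 + \sum_i (lam i)^-1)^-1.
  by rewrite invr_gt0 ltr_wpDr// sumr_ge0// => i _; rewrite invr_ge0 ltW.
move=> i; rewrite -[leRHS]invrK lef_pV2 ?posrE ?invr_gt0//.
  rewrite (bigD1 i)//= addrCA lerDl addr_ge0// sumr_ge0// => j _.
  by rewrite invr_ge0 ltW.
by rewrite ltr_wpDr// sumr_ge0// => j _; rewrite invr_ge0 ltW.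
Qed.

(** The estimate in the direction of the columns of [V] is [V *m V^T *m Y *m L^T];
    replacing [U] by [Uh] changes the projection only, and the difference of the
    projections has squared Frobenius norm [2 * sin2 Uh U]. *)
Lemma plug_in_error p q n (U Uh : 'M[R]_(p, q)) (G : 'M[R]_(q, n))
    (Y : 'M[R]_(p, n)) (L : 'M[R]_n) (CL y : R) :
  orthonormal_cols U -> orthonormal_cols Uh -> spectral_norm L <= CL ->
  (forall v : 'cV_p, sqn (Y^T *m v) <= y * sqn v) ->
  sqn (U *m G - Uh *m (L *m (Y^T *m Uh))^T) <=
    2 * \sum_k sqn (L *m (Y^T *m col k U) - (row k G)^T) +
    4 * CL ^+ 2 * y * sin2 Uh U.
Proof.
move=> Uo Uho LCL Yy.
pose D := U *m U^T - Uh *m Uh^T.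
have DT : D^T = D.
  by rewrite /D [LHS]linearB /= !trmx_mul !trmxK.
have LT (V : 'M[R]_(p, q)) : V *m (L *m (Y^T *m V))^T = V *m V^T *m Y *m L^T.
  by rewrite !trmx_mul trmxK !mulmxA.
have -> : U *m G - Uh *m (L *m (Y^T *m Uh))^T =
    U *m (G - (L *m (Y^T *m U))^T) + D *m Y *m L^T.
  rewrite mulmxBr !LT /D !mulmxBl; set a := U *m G; set b := _ *m L^T.
  by rewrite addrA subrK.
apply: le_trans (sqnD2 _ _) _; rewrite sqn_orth//; apply: lerD.
  rewrite ler_pM2l// -sqn_tr sqn_cols; apply: ler_sum => k _.
  rewrite le_eqVlt; apply/orP; left; apply/eqP.
  have -> : L *m (Y^T *m col k U) = col k (L *m (Y^T *m U)).
    by rewrite !colE !mulmxA.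
  move: (L *m (Y^T *m U)) => X.
  have -> : col k (G - X^T)^T = - (col k X - (row k G)^T).
    by apply/colP => i; rewrite !mxE opprB.
  by rewrite -scaleN1r sqnZ sqrrN expr1n mul1r.
have -> : 4 * CL ^+ 2 * y * sin2 Uh U = 2 * (CL ^+ 2 * (y * (2 * sin2 Uh U))) by ring.
rewrite ler_pM2l// -sqn_tr trmx_mul trmxK.
apply: le_trans (sqn_mull_le _ (fun v => sqn_mul_spectral v LCL)) _.
rewrite ler_wpM2l ?sqr_ge0// trmx_mul DT -sqn_proj_diff//.
exact: sqn_mull_le.
Qed.

End prediction.

Section risk.
Context dO (Om : measurableType dO) (R : realType) (P : probability Om R).
Variables (n p q d : nat) (f : 'I_q -> d.-tuple R -> R) (B : R).
Variables (x : 'I_n -> {RV P >-> d.-tuple R}) (z : 'I_n -> {RV P >-> p.-tuple R}).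
Variable U : 'M[R]_(p, q).
Hypotheses (n_gt0 : (0 < n)%N) (q_gt0 : (0 < q)%N) (q_le_p : (q <= p)%N).
Hypothesis U_orth : orthonormal_cols U.
Hypothesis x_cube : forall i w, unit_cube (x i w).
Hypothesis mf : forall k, measurable_fun setT (f k).
Hypothesis f_bounded : forall k t, unit_cube t -> `|f k t| <= B.
Variable L : n.-tuple (d.-tuple R) -> 'M[R]_n.
Hypothesis mL : forall i j, measurable_fun setT (fun w => L (joint x w) i j).

Let nR_gt0 : 0 < n%:R :> R. Proof. by rewrite ltr0n. Qed.
Let p_gt0 : (0 < p)%N. Proof. exact: leq_trans q_gt0 q_le_p. Qed.

Local Notation Y w := (eval_design (combine f U) (joint x w) + noise z w).

Definition oracle_error k w : R :=
  sqr_norm_n (L (joint x w) *m ((Y w)^T *m col k U) - fitted (f k) (joint x w)).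

Lemma sqr_norm_nE m (v : 'cV[R]_m) : sqr_norm_n v = m%:R^-1 * sqn v.
Proof. by rewrite /sqr_norm_n enorm_sqr. Qed.

Lemma measurable_oracle_error k : measurable_fun setT (oracle_error k).
Proof.
rewrite /oracle_error; under eq_fun do rewrite sqr_norm_nE sqn_cV.
apply: measurable_funM => //; apply: measurable_sum => i; apply: measurable_funX.
have subE (u v : 'cV[R]_n) : (u - v) i 0 = u i 0 - v i 0 by rewrite !mxE.
have E w : (L (joint x w) *m ((Y w)^T *m col k U) - fitted (f k) (joint x w)) i 0 =
    \sum_j L (joint x w) i j *
      (\sum_a (\sum_l U a l * f l (x j w) + tnth (z j w) a) * U a k) - f k (x i w).
  rewrite subE [fitted _ _ i 0]mxE tnth_mktuple [LHS]addrC [RHS]addrC; congr (_ + _); rewrite [LHS]mxE; apply: eq_bigr => j _; congr (_ * _).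
  rewrite mxE; apply: eq_bigr => a _; rewrite observations_eq !mxE; congr ((_ + _) * _).
  by apply: eq_bigr => l _; rewrite !mxE.
under eq_fun do rewrite E.
have mfx l j : measurable_fun setT (fun w => f l (x j w)).
  by apply: (measurableT_comp (mf l)).
apply: measurable_funB => //; apply: measurable_sum => j; apply: measurable_funM => //.
apply: measurable_sum => a; apply: measurable_funM => //; apply: measurable_funD.
  by apply: measurable_sum => l; apply: measurable_funM.
by apply: (measurableT_comp (@measurable_tnth _ _ p a)).
Qed.

Lemma sqn_scores_le w : sqn (scores f x w) <= n%:R * (q%:R * B ^+ 2).
Proof.
apply: (@le_trans _ _ (\sum_(k < q) \sum_(i < n) B ^+ 2)).
  apply: ler_sum => k _; apply: ler_sum => i _; rewrite mxE.
  have h := f_bounded k (x_cube i w).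
  by rewrite -real_normK ?num_real// lerXn2r ?nnegrE// (le_trans _ h).
by rewrite !sumr_const !card_ord -[_ *+ q]mulr_natl -[B ^+ 2 *+ n]mulr_natl mulrCA.
Qed.

(** Up to the bounded mean of [net_sum], the squared norm of [Y] is of order [n], so
    that [sin2] is multiplied by a constant. *)
Lemma risk_le e al m CL w (Uh : 'M[R]_(p, q)) (fh : 'I_q -> d.-tuple R -> R) :
  0 < e -> e < 1 -> 0 < al -> 0 <= m ->
  orthonormal_cols Uh -> spectral_norm (L (joint x w)) <= CL ->
  (forall k, fitted (fh k) (joint x w) = L (joint x w) *m ((Y w)^T *m col k Uh)) ->
  risk (combine f U) (combine fh Uh) (joint x w) <=
    2 * \sum_k oracle_error k w +
    8 * CL ^+ 2 * (q%:R * B ^+ 2 + m / (1 - e) ^+ 2) * sin2 Uh U +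
    8 * CL ^+ 2 * q%:R / (al * (1 - e) ^+ 2) * (n%:R^-1 * net_sum z e al m w).
Proof.
move=> e0 e1 al0 m0 Uho LCL fhE.
set N := net_sum z e al m w.
have N0 : 0 <= N := net_sum_ge0 z e al m w.
set G := scores f x w.
have YE : Y w = U *m G + noise z w := observations_eq f x z U w.
pose c1 := n%:R * (q%:R * B ^+ 2).
pose c2 := (n%:R * m + N / al) / (1 - e) ^+ 2.
pose y := 2 * c1 + 2 * c2.
have Yy (v : 'cV_p) : sqn ((Y w)^T *m v) <= y * sqn v.
  have -> : (Y w)^T = G^T *m U^T + (noise z w)^T.
    by rewrite YE -trmx_mul; apply/matrixP => i j; rewrite !mxE.
  have -> : y * sqn v = 2 * (c1 * sqn v) + 2 * (c2 * sqn v) by rewrite /y; ring.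
  rewrite mulmxDl (le_trans (sqnD2 _ _))// lerD// ler_pM2l//.
    rewrite -mulmxA; apply: le_trans (sqn_mul _ _) _; rewrite sqn_tr.
    by rewrite ler_pM ?sqn_ge0 ?sqn_trmul_le// sqn_scores_le.
  exact: noise_norm_le.
have riskE : risk (combine f U) (combine fh Uh) (joint x w) =
    n%:R^-1 * sqn (U *m G - Uh *m (L (joint x w) *m ((Y w)^T *m Uh))^T).
  rewrite /risk; congr (_ * _); rewrite sqn_cols; apply: eq_bigr => i _.
  rewrite enorm_sqr; congr sqn; apply/colP => a.
  rewrite [LHS]mxE [RHS]mxE [RHS]mxE /combine summxE; congr (_ + _).
    rewrite [RHS]mxE; apply: eq_bigr => k _.
    by rewrite !mxE tnth_mktuple mulrC.
  rewrite [LHS]mxE [RHS]mxE; congr (- _); rewrite summxE [RHS]mxE.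
  apply: eq_bigr => k _.
  have /colP/(_ i) := fhE k.
  have -> : L (joint x w) *m ((Y w)^T *m col k Uh) = col k (L (joint x w) *m ((Y w)^T *m Uh)).
    by rewrite !colE !mulmxA.
  move: (L (joint x w) *m ((Y w)^T *m Uh)) => X; rewrite mxE [RHS]mxE => h.
  by rewrite !mxE h mulrC.
rewrite riskE ler_pdivrMl//.
apply: le_trans (plug_in_error G U_orth Uho LCL Yy) _.
have oracleE k : sqn (L (joint x w) *m ((Y w)^T *m col k U) - (row k G)^T) =
    n%:R * oracle_error k w.
  rewrite /oracle_error sqr_norm_nE mulrA divff ?gt_eqF// mul1r; congr sqn.
  by congr (_ - _); apply/colP => i; rewrite !mxE tnth_mktuple.
under eq_bigr do rewrite oracleE.
rewrite -mulr_sumr [leRHS]mulrDr [n%:R * (_ + _)]mulrDr; set S := sin2 Uh U.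
have S0 : 0 <= S by exact: sin2_ge0.
have Sq : S <= q%:R by exact: sin2_le.
have d0 : 0 < (1 - e) ^+ 2 by rewrite exprn_gt0// subr_gt0.
rewrite -addrA lerD//; first by rewrite mulrCA.
have -> : 4 * CL ^+ 2 * y * S =
    n%:R * (8 * CL ^+ 2 * (q%:R * B ^+ 2 + m / (1 - e) ^+ 2) * S) +
    8 * CL ^+ 2 / (al * (1 - e) ^+ 2) * N * S.
  rewrite /y /c1 /c2; field.
  by rewrite !gt_eqF//= subr_gt0.
rewrite lerD2l.
have -> : n%:R * (8 * CL ^+ 2 * q%:R / (al * (1 - e) ^+ 2) * (n%:R^-1 * N)) =
    8 * CL ^+ 2 / (al * (1 - e) ^+ 2) * N * q%:R.
  by field; rewrite !gt_eqF//= subr_gt0.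
rewrite ler_wpM2l// mulr_ge0// divr_ge0//; last by rewrite mulr_ge0 ?ltW.
by rewrite mulr_ge0 ?sqr_ge0.
Qed.

End risk.

(** * The theorem *)

Section second_moments.
Variables (R : realType) (d q : nat) (f : 'I_q -> d.-tuple R -> R).
Hypothesis f_L2 : forall k, f k \in Lfun (uniform_cube R d) 2%:E.
Hypothesis f_neq0 : forall k, (\int[uniform_cube R d]_t (f k t ^+ 2)%:E != 0)%E.
Hypothesis f_orthogonal : forall k l, k != l ->
  (\int[uniform_cube R d]_t (f k t * f l t)%:E = 0)%E.

Lemma measurable_signal k : measurable_fun setT (f k).
Proof. by move: (f_L2 k); rewrite inE => /andP[+ _]; rewrite inE. Qed.

Lemma integrable_signal_mul k l :
  (uniform_cube R d).-integrable setT (fun t => (f k t * f l t)%:E).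
Proof. by apply/Lfun1_integrable; exact: Lfun2_mul_Lfun1. Qed.

Definition energy k : R := fine (\int[uniform_cube R d]_t (f k t ^+ 2)%:E)%E.

Lemma energyE k : (\int[uniform_cube R d]_t (f k t ^+ 2)%:E = (energy k)%:E)%E.
Proof.
rewrite /energy fineK//; under eq_integral do rewrite expr2.
exact: integrable_fin_num (integrable_signal_mul k k).
Qed.

Lemma energy_gt0 k : 0 < energy k.
Proof.
rewrite lt_def -eqe -energyE f_neq0 -lee_fin -energyE.
by apply: integral_ge0 => t _; rewrite lee_fin sqr_ge0.
Qed.

Lemma signal_gram k l :
  (\int[uniform_cube R d]_t (f k t * f l t - energy k *+ (k == l))%:E = 0)%E.
Proof.
under eq_integral do rewrite EFinB.
rewrite integralB//; last 2 first.
- exact: integrable_signal_mul.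
- exact: finite_measure_integrable_cst.
rewrite (integral_cst (uniform_cube R d) measurableT)
  [X in (_ * X)%E](probability_setT (uniform_cube R d)) mule1.
case: eqVneq => [<-|kl]; last by rewrite f_orthogonal// mulr0n sube0.
under eq_integral do rewrite -expr2.
by rewrite energyE mulr1n subee.
Qed.

End second_moments.

Lemma sin2_const_ge0 (R : realType) q (sigma B : R) (lam : 'I_q -> R) lam0 :
  0 < sigma -> 0 < lam0 -> 0 <= sin2_const sigma B lam lam0.
Proof.
move=> s0 l0; have e0 := net_width_gt0 s0 l0.
have even4 (a : R) : 0 <= a ^+ 4 by rewrite exprn_even_ge0.
apply: addr_ge0; first exact: mulr_ge0 (sqr_ge0 _) (sqr_ge0 _).
apply: addr_ge0; first exact: mulr_ge0 (sqr_ge0 _) (divr_ge0 (exprn_ge0 5 (ler0n R 4)) (even4 _)).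
apply: addr_ge0.
  apply: mulr_ge0; first exact: mulr_ge0 (sqr_ge0 _) (even4 _).
  exact: mulr_ge0 (sqr_ge0 _) (gram_const_ge0 _ _).
apply: mulr_ge0 (even4 _) _; apply: mulr_ge0; first exact: mulr_ge0 (ler0n _ _) (sqr_ge0 _).
by rewrite addr_ge0 ?chi_const_ge0// mulr_ge0 ?cross_const_ge0.
Qed.

Lemma sin_Theta_norm_pow4_le (R : realType) p q (Uh U : 'M[R]_(p, q)) :
  orthonormal_cols Uh -> orthonormal_cols U ->
  0 <= sin_Theta_norm Uh U ^+ 4 <= sin2 Uh U ^+ 2.
Proof.
move=> Uho Uo; rewrite exprn_even_ge0//= (exprM _ 2 2).
by rewrite lerXn2r ?nnegrE ?sqr_ge0 ?sin2_ge0// sin_Theta_norm_le.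
Qed.

Theorem theorem2p2 (R : realType) (d q : nat)
    (f : 'I_q -> d.-tuple R -> R) (B sigma : R)
    (sigma_gt0 : 0 < sigma)
    (f_L2 : forall k, f k \in Lfun (uniform_cube R d) 2%:E)
    (f_neq0 : forall k, (\int[uniform_cube R d]_t (f k t ^+ 2)%:E != 0)%E)
    (f_orthogonal : forall k l, k != l ->
       (\int[uniform_cube R d]_t (f k t * f l t)%:E = 0)%E)
    (f_bounded : forall k t, unit_cube t -> `|f k t| <= B) :
  (exists C : R, 0 < C /\
     forall (n p : nat) (dO : measure_display) (Om : measurableType dO)
       (P : probability Om R)
       (x : 'I_n -> {RV P >-> d.-tuple R}) (z : 'I_n -> {RV P >-> p.-tuple R})
       (U : 'M[R]_(p, q)) (Uh : Om -> 'M[R]_(p, q)),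
       (0 < n)%N -> (q <= p)%N ->
       orthonormal_cols U ->
       sampling_model sigma x z ->
       let Y w := eval_design (combine f U) (joint x w) + noise z w in
       pca_estimate Y Uh ->
       ('E_P[fun w => (sin_Theta_norm (Uh w) U ^+ 4)%R]
        <= (C * (p%:R / n%:R) ^+ 2)%:E)%E)
  /\
  (forall (r CL Cr C1 C2 : R), exists C : R, 0 < C /\
     forall (n p : nat) (dO : measure_display) (Om : measurableType dO)
       (P : probability Om R)
       (x : 'I_n -> {RV P >-> d.-tuple R}) (z : 'I_n -> {RV P >-> p.-tuple R})
       (U : 'M[R]_(p, q)) (Uh : Om -> 'M[R]_(p, q))
       (S : smoothing_problem R d q)
       (L : n.-tuple (d.-tuple R) -> 'M[R]_n)
       (fh : Om -> 'I_q -> d.-tuple R -> R),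
       (0 < n)%N -> (q <= p)%N ->
       orthonormal_cols U ->
       sampling_model sigma x z ->
       let Y w := eval_design (combine f U) (joint x w) + noise z w in
       pca_estimate Y Uh ->
       (forall w, direction_fits S (joint x w) (Y w) (Uh w) (fh w)) ->
       direction_invariant n p S ->
       linear_smoother p S L ->
       (forall i j, measurable_fun setT (fun w => L (joint x w) i j)) ->
       (forall xs, in_cube xs -> spectral_norm (L xs) <= CL) ->
       attains_rate P f U (joint x) Y L Cr r ->
       p%:R <= C1 * n%:R ->
       p%:R <= C2 * n%:R `^ (1 - r) ->
       ('E_P[fun w => risk (combine f U) (combine (fh w) (Uh w)) (joint x w)]
        <= (C * (q%:R * n%:R `^ (- r)))%:E)%E).
Proof.
have mf := measurable_signal f_L2.
have gram := signal_gram f_L2 f_orthogonal.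
have [lam0 lam0_gt0 lam0_le] := positive_lower_bound (energy_gt0 f_L2 f_neq0).
pose Cs := sin2_const sigma B (energy f) lam0.
have Cs0 : 0 <= Cs by exact: sin2_const_ge0.
have sin2_mean (n p : nat) (dO : measure_display) (Om : measurableType dO)
    (P : probability Om R) (x : 'I_n -> {RV P >-> d.-tuple R})
    (z : 'I_n -> {RV P >-> p.-tuple R}) (U : 'M[R]_(p, q)) (Uh : Om -> 'M[R]_(p, q)) :
    (0 < n)%N -> (0 < q)%N -> (q <= p)%N -> orthonormal_cols U ->
    sampling_model sigma x z ->
    pca_estimate (fun w => eval_design (combine f U) (joint x w) + noise z w) Uh ->
    mean_le P (fun w => sin2 (Uh w) U ^+ 2) (Cs * (p%:R / n%:R) ^+ 2).
  move=> n0 q0 qp Uo model [_ top].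
  apply: (mean_sin2_sqr n0 q0 qp sigma_gt0 Uo model mf f_bounded lam0_gt0 lam0_le gram).
  by move=> w; rewrite -observations_eq.
(* For q = 0 the dimension [p] may vanish, and [p / n] is then no upper bound for
   [1 / n]; all the quantities to be bounded are zero. *)
have [q0|q0] := posnP q.
  split=> [|r CL Cr C1 C2]; exists 1; split=> //.
    move=> n p dO Om P x z U Uh n0 qp Uo model Y [_ top].
    rewrite unlock; apply: mean_le_integral.
    apply: (@mean_le_dominated _ _ _ _ _ (fun=> 0)); last first.
      by apply: mean_le_weaken (mean_le_cst P (lexx 0)) _; rewrite mul1r sqr_ge0.
    move=> w; have Uho := top_left_orthonormal qp (top w).
    have /andP[-> /le_trans] := sin_Theta_norm_pow4_le Uho Uo; apply.
    have -> : sin2 (Uh w) U = 0; last by rewrite expr0n.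
    apply/eqP; rewrite eq_le sin2_ge0// andbT (le_trans (sin2_le _ _))//.
    by rewrite q0.
  move=> n p dO Om P x z U Uh S L fh *.
  have -> : (q%:R : R) = 0 by rewrite q0.
  rewrite unlock mul0r mulr0; apply: mean_le_integral.
  apply: (@mean_le_dominated _ _ _ _ _ (fun=> 0)); last exact: mean_le_cst.
  have combine0 (g : 'I_q -> d.-tuple R -> R) (V : 'M[R]_(p, q)) t : combine g V t = 0.
    by rewrite /combine big1// => k; have := ltn_ord k; rewrite [X in (_ < X)%N]q0.
  move=> w; rewrite /risk big1 ?mulr0 ?lexx// => i _.
  by rewrite !combine0 subrr enorm_sqr sqn0.
split.
  exists (Cs + 1); split; first by rewrite ltr_wpDl.
  move=> n p dO Om P x z U Uh n0 qp Uo model Y pca.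
  have [_ top] := pca.
  rewrite unlock; apply: mean_le_integral.
  apply: (@mean_le_dominated _ _ _ _ _ (fun w => sin2 (Uh w) U ^+ 2)).
    by move=> w; apply: sin_Theta_norm_pow4_le => //; exact: top_left_orthonormal (top w).
  apply: mean_le_weaken (sin2_mean _ _ _ _ _ _ _ _ _ n0 q0 qp Uo model pca) _.
  by rewrite ler_wpM2r ?sqr_ge0// lerDl.
move=> r CL Cr C1 C2.
pose e : R := 1 / 2.
(* [al] is the largest scale that [expectation_net_sum] allows; [m] then makes its
   exponent beat the number of grid points, which is at most exponential in [p],
   hence in [n]. *)
pose al : R := (8 * sigma ^+ 2)^-1.
pose m : R := (`|C1| * grid_const e + 1) / al.
pose A : R := 8 * CL ^+ 2 * (q%:R * B ^+ 2 + m / (1 - e) ^+ 2).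
pose A' : R := 8 * CL ^+ 2 * q%:R / (al * (1 - e) ^+ 2).
pose C := 2 * (q%:R * `|Cr|) + (A * ((Cs + 1) / 2) + A') * `|C2| + 1.
have e0 : 0 < e by rewrite /e; lra.
have e1 : e < 1 by rewrite /e; lra.
have d0 : 0 < (1 - e) ^+ 2 by rewrite exprn_gt0// subr_gt0.
have al0 : 0 < al by rewrite invr_gt0 mulr_gt0// exprn_gt0.
have gc0 : 0 <= grid_const e by rewrite (le_trans ler01) ?grid_const_ge1.
have m0 : 0 <= m by rewrite divr_ge0 ?(ltW al0)// addr_ge0// mulr_ge0.
have CL0 : 0 <= 8 * CL ^+ 2 by rewrite mulr_ge0 ?sqr_ge0.
have A0 : 0 <= A.
  apply: mulr_ge0 => //; apply: addr_ge0; first by rewrite mulr_ge0 ?sqr_ge0.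
  by rewrite divr_ge0 ?(ltW d0).
have A'0 : 0 <= A' by rewrite divr_ge0 ?(mulr_ge0 CL0)// mulr_ge0 ?ltW.
have Cs1 : 0 <= (Cs + 1) / 2 by rewrite divr_ge0// addr_ge0.
have qCr : 0 <= 2 * (q%:R * `|Cr|) by rewrite !mulr_ge0.
have AC2 : 0 <= (A * ((Cs + 1) / 2) + A') * `|C2|.
  by rewrite mulr_ge0// addr_ge0// mulr_ge0.
have C0 : 0 < C by rewrite /C; lra.
exists C; split=> //.
move=> n p dO Om P x z U Uh S L fh n0 qp Uo model Y pca fits _ smoothL mL LCL rate pC1 pC2.
have [_ top] := pca.
have p0 : (0 < p)%N := leq_trans q0 qp.
have nR : 0 < n%:R :> R by rewrite ltr0n.
have pR : 0 < p%:R :> R by rewrite ltr0n.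
have pn0 : 0 < p%:R / n%:R :> R by rewrite divr_gt0.
have cube w : in_cube (joint x w).
  by move=> i; rewrite tnth_mktuple; case: model.
have [x_cube x_iid z_iid _] := model.
have Uho w : orthonormal_cols (Uh w) := top_left_orthonormal qp (top w).
have m_sin2 := sin2_mean _ _ _ _ _ _ _ _ _ n0 q0 qp Uo model pca.
have rk_ge0 w : 0 <= risk (combine f U) (combine (fh w) (Uh w)) (joint x w).
  rewrite /risk mulr_ge0 ?invr_ge0// sumr_ge0// => i _; exact: sqr_ge0.
set nr := n%:R `^ (- r).
have nr0 : 0 < nr by rewrite powR_gt0.
have pnr : p%:R / n%:R <= `|C2| * nr.
  rewrite ler_pdivrMr// (le_trans pC2)// /nr.
  rewrite powRD; last by rewrite [n%:R == 0]gt_eqF// implybT.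
  rewrite powRr1 ?(ltW nR)// mulrA mulrAC.
  rewrite ler_wpM2r ?(ltW nR)// ler_wpM2r ?(ltW nr0)//; exact: ler_norm.
have m_net : mean_le P (net_sum z e al m) 1.
  apply: mean_le_measurable; [exact: measurable_net_sum|by move=> w; exact: net_sum_ge0|].
  apply: le_trans (expectation_net_sum sigma_gt0 z_iid m e0 (ltW al0) _) _.
    have -> : 2 * al * sigma ^+ 2 = 1 / 4 by rewrite /al; field; rewrite gt_eqF.
    by [].
  have gcp : grid_const e ^+ p <= expR (n%:R * (`|C1| * grid_const e)).
    apply: (@le_trans _ _ (expR (p%:R * grid_const e))).
      rewrite expRM_natl lerXn2r ?nnegrE ?expR_ge0//.
      by apply: le_trans (expR_ge1Dx _); rewrite lerDr.
    rewrite ler_expR mulrA ler_wpM2r// mulrC (le_trans pC1)//.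
    by rewrite ler_wpM2r ?(ltW nR)// ler_norm.
  rewrite lee_fin; apply: le_trans (ler_wpM2r (expR_ge0 _) gcp) _.
  rewrite -expRD -mulrDr -[leRHS]expR0 ler_expR pmulr_rle0//.
  have alm : al * m = `|C1| * grid_const e + 1 by rewrite /m mulrC divfK// gt_eqF.
  have als : al * sigma ^+ 2 = 1 / 8 by rewrite /al; field; rewrite gt_eqF.
  rewrite mulrBr alm als; lra.
have m_oracle k : mean_le P (oracle_error f x z U L k) (`|Cr| * nr).
  apply: mean_le_measurable; first exact: measurable_oracle_error.
    by move=> w; rewrite /oracle_error sqr_norm_nE mulr_ge0 ?invr_ge0 ?sqn_ge0.
  have := rate k; rewrite unlock => /le_trans; apply.
  by rewrite lee_fin ler_wpM2r ?(ltW nr0)// ler_norm.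
have m_sin : mean_le P (fun w => sin2 (Uh w) U) ((Cs + 1) / 2 * (p%:R / n%:R)).
  apply: (@mean_le_dominated _ _ _ _ _ (fun w =>
      2^-1 * ((n%:R / p%:R) * sin2 (Uh w) U ^+ 2 + p%:R / n%:R))).
    move=> w; rewrite sin2_ge0//=.
    have h := sqr_ge0 (sin2 (Uh w) U - p%:R / n%:R).
    have -> : n%:R / p%:R = (p%:R / n%:R)^-1 :> R by rewrite invf_div.
    move: (p%:R / n%:R) (sin2 _ _) pn0 h => t s t0 h.
    have -> : 2^-1 * (t^-1 * s ^+ 2 + t) = s + 2^-1 * t^-1 * (s - t) ^+ 2.
      by field; rewrite gt_eqF.
    by rewrite lerDl mulr_ge0// mulr_ge0// invr_ge0 ltW.
  apply: (@mean_le_weaken _ _ _ _ _ (2^-1 * ((n%:R / p%:R) *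
    (Cs * (p%:R / n%:R) ^+ 2) + p%:R / n%:R))).
    apply: mean_leZ => //; apply: mean_leD; last exact: mean_le_cst (ltW pn0).
    by apply: mean_leZ => //; rewrite divr_ge0.
  by rewrite le_eqVlt; apply/orP; left; apply/eqP; field; rewrite !gt_eqF.
rewrite unlock; apply: mean_le_integral.
apply: (@mean_le_dominated _ _ _ _ _ (fun w =>
    2 * \sum_k oracle_error f x z U L k w + A * sin2 (Uh w) U +
    A' * (n%:R^-1 * net_sum z e al m w))).
  move=> w; rewrite rk_ge0 /=; apply: risk_le => //; first exact: LCL.
  by move=> k; apply: (smoothL _ _ _ k (cube w)).2; exact: fits.
apply: (@mean_le_weaken _ _ _ _ _ (2 * (#|'I_q|%:R * (`|Cr| * nr)) +
   A * ((Cs + 1) / 2 * (p%:R / n%:R)) + A' * (n%:R^-1 * 1))).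
  apply: mean_leD; first apply: mean_leD.
  - by apply: mean_leZ => //; exact: mean_le_sum.
  - exact: mean_leZ.
  - by apply: mean_leZ => //; apply: mean_leZ; rewrite ?invr_ge0.
rewrite card_ord mulr1.
have n1 : n%:R^-1 <= p%:R / n%:R :> R.
  by rewrite ler_peMl ?invr_ge0// ler1n.
have h1 : A * ((Cs + 1) / 2 * (p%:R / n%:R)) <= A * ((Cs + 1) / 2) * (`|C2| * nr).
  by rewrite mulrA ler_wpM2l// mulr_ge0.
have h2 : A' * n%:R^-1 <= A' * (`|C2| * nr) by rewrite ler_wpM2l// (le_trans n1).
apply: (@le_trans _ _ (C * nr)).
  rewrite /C; move: (nr) nr0 h1 h2 => u u0 h1 h2; lra.
by rewrite ler_wpM2l ?(ltW C0)// ler_peMl ?(ltW nr0)// ler1n.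
Qed.
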